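(* Let $D\in\{\mathbb R,\mathbb R^+\}$ and let $F:D\to\mathbb R$ be a warping function with $w=(F^{-1})'\in\mathcal C^1(\mathbb R)$, such that for all $x,y\in\mathbb R$ $$\frac{w(x+y)}{w(x)w(y)}\le C<\infty\quad\text{and}\quad\left|\frac{w'}{w}\right|(x)\le D_1<\infty.$$ Furthermore, let $\mathcal U^\delta_F=\{U^\delta_{l,k}\}_{l,k\in\mathbb Z}$ be the $F$-induced $\delta$-cover, let $m_1:D\to\mathbb R^+$ be a weight function such that $m_1\circ F^{-1}$ is $v_1$-moderate for a symmetric, submultiplicative weight function $v_1$, and define $m(x,y,\xi,\omega)=\max\left\{\frac{m_1(x)}{m_1(y)},\frac{m_1(y)}{m_1(x)}\right\}$. Let $\Gamma(x,y,\xi,\omega)=e^{2\pi i(\omega-\xi)x}$. Then $\sup_{l,k\in\mathbb Z}\sup_{(x,\xi),(y,\omega)\in U^\delta_{l,k}}m(x,y,\xi,\omega)<\infty$ and $$\mathrm{osc}_{\mathcal U^\delta_F,\Gamma}\in\mathcal A_m\quad\text{for all nonzero }\theta\in\mathcal C_c^\infty(\mathbb R),\ \delta>0.$$ If furthermore $w,v_1\in\mathcal O\left((1+|\cdot|)^p\right)$ for some $p\in\mathbb R^+$, then $$\mathrm{osc}_{\mathcal U^\delta_F,\Gamma}\in\mathcal A_m\quad\text{for all nonzero }\theta\in\mathcal S(\mathbb R),\ \delta>0.$$ For sufficiently small $\delta$, there are constants $C'>0$ (uniform in such $\delta$) and $C_{m,\mathcal U^\delta_F}\ge\sup_{k,l\in\mathbb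 Z}\sup_{(x,\xi),(y,\omega)\in U^\delta_{l,k}}m(x,y,\xi,\omega)$ such that $C_{m,\mathcal U^\delta_F}<C'$. Furthermore, for every nonzero $\theta\in\mathcal C^\infty_c(\mathbb R)$ (respectively, under the additional polynomial growth assumption on $w,v_1$, for every nonzero $\theta\in\mathcal S(\mathbb R)$) and every $\epsilon>0$ there exists $\delta>0$ such that $\|\mathrm{osc}_{\mathcal U^\delta_F,\Gamma}\|_{\mathcal A_m}<\epsilon$.
   Context: $\mathbb R^+=(0,\infty)$. A weight function $v:\mathbb R\to\mathbb R^+$ is submultiplicative if $v(x+y)\le v(x)v(y)$; a weight function $u:\mathbb R\to\mathbb R^+$ is $v$-moderate if $u(x+y)\le C''v(x)u(y)$ for some submultiplicative weight $v$ and constant $C''<\infty$. $\mathcal O(f)$ denotes the functions that do not grow faster than $f$; $\mathcal S(\mathbb R)$ is the Schwartz class. A bijective function $F:D\to\mathbb R$ is a warping function if $F\in\mathcal C^1(D)$, $F'>0$, $|t_0|<|t_1|\Rightarrow F'(t_1)<F'(t_0)$, and the weight $w(t)=(F^{-1})'(t)=1/F'(F^{-1}(t))$ is $v$-moderate for some submultiplicative weight $v$; if $D=\mathbb R$, $F$ is additionally required to be odd. Fourier transform: $\mathcal Ff(\xi)=\int_{\mathbb R}f(t)e^{-2\pi it\xi}dt$, extended unitarily to $\mathbf L^2(\mathbb R)$; $\check g=\mathcal F^{-1}g$; functions on $D$ are extended by zero to $\mathbb R$. $\mathbf T_xf=f(\cdot-x)$. For $(x,\xi)\in D\times\mathbb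 R$ let $g_x:=\sqrt{F'(x)}\,(\mathbf T_{F(x)}\theta)\circ F$ and $g_{x,\xi}:=\mathbf T_\xi\,\check{g_x}$. The system $\{g_{x,\xi}\}$ is a continuous tight frame for $\mathcal F^{-1}(\mathbf L^2(D))$ with bound $A=\|\theta\|_{\mathbf L^2}^2$. For a kernel $K$ on $(D\times\mathbb R)^2$, with points $(x,\xi)$ and $(y,\omega)$, $\|K\|_{\mathcal A_1}=\max\{\mathrm{ess\,sup}_{(x,\xi)}\int_D\int_{\mathbb R}|K(x,y,\xi,\omega)|\,d\omega\,dy,\ \mathrm{ess\,sup}_{(y,\omega)}\int_D\int_{\mathbb R}|K(x,y,\xi,\omega)|\,d\xi\,dx\}$, and $\mathcal A_m$ is the space of kernels with $\|K\|_{\mathcal A_m}:=\|Km\|_{\mathcal A_1}<\infty$. The $F$-induced $\delta$-cover ($\delta>0$) is $\mathcal U^\delta_F=\{U^\delta_{l,k}\}_{l,k\in\mathbb Z}$ with $U^\delta_{l,k}=I^\delta_{F,l}\times\left[\frac{\delta^2k}{|I^\delta_{F,l}|},\frac{\delta^2(k+1)}{|I^\delta_{F,l}|}\right]$, $I^\delta_{F,l}=[F^{-1}(\delta l),F^{-1}(\delta(l+1))]$, where $|I|$ is the length of $I$. The $\Gamma$-oscillation of $\{g_{x,\xi}\}$ is $$\mathrm{osc}_{\mathcal U^\delta_F,\Gamma}(x,y,\xi,\omega)=A^{-1}\sup_{(z,\eta)\in Q_{y,\omega}}\left|\langle g_{x,\xi},\,g_{y,\omega}-\Gamma(y,z,\omega,\eta)g_{z,\eta}\rangle\right|,\quad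 Q_{y,\omega}=\bigcup_{(l,k):\,(y,\omega)\in U^\delta_{l,k}}U^\delta_{l,k}.$$
   Formalization: Weight functions (m_1, v_1 and the weight moderating w) are assumed Borel measurable; without this the claim fails, e.g. F=arcsinh, v_1=exp|a|, m_1∘F^{-1}=exp(a) with a discontinuous additive, where sup m is infinite. *)

(* Defs.v *)
From HB Require Import structures.
From mathcomp Require Import all_boot all_order all_algebra.
From mathcomp Require Import complex.
From mathcomp Require Import all_classical all_reals all_analysis measurable_realfun ess_sup_inf.
Set Implicit Arguments.
Unset Strict Implicit.
Unset Printing Implicit Defensive.
Import Order.TTheory GRing.Theory Num.Theory.
Import numFieldNormedType.Exports.
Local Open Scope ring_scope.
Local Open Scope classical_set_scope.

Section Weights.
Context {R : realType}.
Implicit Types (D : set R) (u v f g : R -> R).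

(* Weights are measurable, as is implicit whenever they multiply integrands:
   without any regularity a submultiplicative function may be unbounded on
   every interval. *)
Definition weight_on D u :=
  measurable_fun D u /\ (forall x, D x -> 0 < u x).

Definition submultiplicative v :=
  weight_on setT v /\ (forall x y, v (x + y) <= v x * v y).

Definition moderate v u :=
  exists C : R, forall x y, u (x + y) <= C * v x * u y.

(* f \in O(g), for |x| -> oo. *)
Definition bigO_infty f g :=
  exists C M : R, forall x, M <= `|x| -> `|f x| <= C * `|g x|.

End Weights.

Section Warping.
Context {R : realType}.
Implicit Types (D : set R) (F : R -> R).

(* Functions on D are total functions R -> R whose values off D are irrelevant;
   D will always be open, so F^`() is intrinsic on D. *)
Definition warp_inv D F : R -> R := 'pinv_(fun=> 0) D F.

Definition warp_weight D F : R -> R := (warp_inv D F)^`().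

Record warping_function D F : Prop := WarpingFunction {
  warp_bij : set_bij D setT F ;
  warp_derivable : forall t, D t -> derivable F t 1 ;
  warp_C1 : {within D, continuous F^`()} ;
  warp_deriv_gt0 : forall t, D t -> 0 < F^`() t ;
  warp_deriv_decr : forall t0 t1, D t0 -> D t1 ->
    `|t0| < `|t1| -> F^`() t1 < F^`() t0 ;
  warp_moderate : exists2 v, submultiplicative v & moderate v (warp_weight D F) ;
  warp_odd : D = setT -> forall t, F (- t) = - F t
}.

End Warping.

Section ComplexFunctions.
Context {R : realType}.
Local Notation mu := (@lebesgue_measure R).
Implicit Types (f g theta : R -> R[i]).

Definition Cintegral f : R[i] :=
  Complex (\int[mu]_(t in setT) complex.Re (f t)) (\int[mu]_(t in setT) complex.Im (f t)).

Definition inner f g : R[i] := Cintegral (fun t => f t * (g t)^*%C).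

Definition L2norm_sq f : R := \int[mu]_(t in setT) (Normc.normc (f t) ^+ 2).

(* exp(2 i pi s) *)
Definition cis2pi (s : R) : R[i] := Complex (cos (2 * pi * s)) (sin (2 * pi * s)).

(* The integral formula for the inverse Fourier transform. The unitary extension
   to L^2 agrees with it on the intersection of L^1 and L^2, which contains the
   functions warped_proto below when theta is smooth with compact support, or when
   theta is Schwartz and the warping weight has polynomial growth. *)
Definition inv_fourier f (t : R) : R[i] :=
  Cintegral (fun xi => f xi * cis2pi (t * xi)).

Definition smoothR (h : R -> R) := forall n t, derivable (h^`(n)) t 1.

Definition smooth theta :=
  smoothR (@complex.Re R \o theta) /\ smoothR (@complex.Im R \o theta).

Definition Cc_infty theta :=
  smooth theta /\ compact (closure [set t | theta t != 0]).

Definition rapid_decayR (h : R -> R) :=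
  forall k n : nat, exists M : R, forall t, `|t| ^+ k * `|h^`(n) t| <= M.

Definition schwartz theta :=
  [/\ smooth theta, rapid_decayR (@complex.Re R \o theta) &
      rapid_decayR (@complex.Im R \o theta)].

Definition nonzero_fun theta := exists t, theta t != 0.

End ComplexFunctions.

Section WarpedSystem.
Context {R : realType}.
Variables (D : set R) (F : R -> R) (theta : R -> R[i]).

(* g_x, extended by zero off D *)
Definition warped_proto (x : R) (t : R) : R[i] :=
  if t \in D then (Num.sqrt (derive1 F x))%:C%C * theta (F t - F x) else 0.

(* g_{x,xi} *)
Definition warped_atom (x xi : R) (t : R) : R[i] :=
  inv_fourier (warped_proto x) (t - xi).

End WarpedSystem.

Section Kernels.
Context {R : realType}.
Local Notation mu := (@lebesgue_measure R).
Local Open Scope ereal_scope.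

(* Kernels on (D x R)^2 are written K x y xi omega and are \bar R-valued, so that
   the oscillation (a supremum) needs no finiteness proof; their values off
   (D x R)^2 are irrelevant. *)
Definition kernel_type := R -> R -> R -> R -> \bar R.

Implicit Types (D : set R) (K : kernel_type) (m : R -> R -> R -> R -> R).

(* Restricting the (nonnegative) marginals by 0 off D x R does not change the
   essential supremum over D x R. *)
Definition A1_norm D K : \bar R :=
  maxe
    (ess_sup (mu \x mu) ((fun p : R * R =>
       \int[mu]_(y in D) \int[mu]_(omega in setT) `|K p.1 y p.2 omega|)
         \_ (D `*` setT)))
    (ess_sup (mu \x mu) ((fun q : R * R =>
       \int[mu]_(x in D) \int[mu]_(xi in setT) `|K x q.1 xi q.2|)
         \_ (D `*` setT))).

Definition Am_norm D m K : \bar R :=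
  A1_norm D (fun x y xi omega => K x y xi omega * (m x y xi omega)%:E).

Definition in_Am D m K : Prop :=
  measurable_fun ((D `*` setT) `*` (D `*` setT))
    (fun pq : (R * R) * (R * R) => K pq.1.1 pq.2.1 pq.1.2 pq.2.2) /\
  Am_norm D m K < +oo.

End Kernels.

Section Oscillation.
Context {R : realType}.
Variables (D : set R) (F : R -> R).

Definition warp_itv (delta : R) (l : int) : set R :=
  `[warp_inv D F (delta * l%:~R), warp_inv D F (delta * (l + 1)%:~R)].

Definition warp_itv_length (delta : R) (l : int) : R :=
  warp_inv D F (delta * (l + 1)%:~R) - warp_inv D F (delta * l%:~R).

Definition warp_cover (delta : R) (l k : int) : set (R * R) :=
  warp_itv delta l `*`
  `[delta ^+ 2 * k%:~R / warp_itv_length delta l,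
    delta ^+ 2 * (k + 1)%:~R / warp_itv_length delta l].

(* Q_{y,omega} *)
Definition cover_nbhd (delta y omega : R) : set (R * R) :=
  [set q | exists l k, warp_cover delta l k (y, omega) /\ warp_cover delta l k q].

(* sup over l, k and over pairs of points of U_{l,k} *)
Definition cover_sup (delta : R) (m : R -> R -> R -> R -> R) : \bar R :=
  ereal_sup [set s | exists l k p q,
    [/\ warp_cover delta l k p, warp_cover delta l k q &
        s = (m p.1 q.1 p.2 q.2)%:E]].

Definition oscillation (delta : R) (Gamma : R -> R -> R -> R -> R[i])
    (theta : R -> R[i]) : kernel_type :=
  fun x y xi omega =>
  (((L2norm_sq theta)^-1)%:E *
   ereal_sup [set (Normc.normc (inner (warped_atom D F theta x xi)
       (fun t => warped_atom D F theta y omega t -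
          Gamma y q.1 omega q.2 * warped_atom D F theta q.1 q.2 t)))%:E
     | q in cover_nbhd delta y omega])%E.

End Oscillation.

Section Phase.
Context {R : realType}.

Definition weight_kernel (m1 : R -> R) (x y xi omega : R) : R :=
  Num.max (m1 x / m1 y) (m1 y / m1 x).

Definition phase (x y xi omega : R) : R[i] := cis2pi ((omega - xi) * x).

End Phase.

(* Main.v *)
Require Import Defs.
From mathcomp Require Import all_boot all_order all_algebra.
From mathcomp Require Import complex ring lra.
From mathcomp Require Import all_classical all_reals all_analysis measurable_realfun ess_sup_inf.
Set Implicit Arguments.
Unset Strict Implicit.
Unset Printing Implicit Defensive.
Import Order.TTheory GRing.Theory Num.Theory.
Import numFieldNormedType.Exports.
Local Open Scope ring_scope.
Local Open Scope classical_set_scope.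

(** Write [G] for the inverse of [F], so that [w = G'], and [a], [b], [c] for the
    warped positions [F x], [F y], [F z].

    The inner product of [g_{x,xi}] with [g_{y,om} - Gamma g_{z,eta}] is, by
    Parseval ([atom_inner]), an integral over [D] in the frequency variable [s].
    Its integrand is a profile in [u = F s] times the wave
    [exp (2 i pi (om - xi) s)] ([modulated_product]). The profile is the product of
    [theta (u - a)] with a difference of two translates of the conjugate of
    [theta], centred at [b] and [c].

    Two facts about such integrals carry the proof. First, two integrations by
    parts ([wave_decay], [wave_bound]): differentiating in [s] divides by [w], and
    as [w'] is dominated by [w], a profile that is concentrated at [b] yields the
    Lorentzian [w b / (1 + (w b * (om - xi)) ^+ 2)], whose integral in [om] or in
    [xi] is [pi] whatever [b] is. Second, the difference is of size [delta]
    together with its first two derivatives ([atom_difference_bounded]). Indeed a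
    cell has warped length [delta] and, since its length is of order
    [delta * w b], frequency height of order [delta / w b]; and the phase [Gamma]
    turns the change of frequency into the factor
    [exp (2 i pi (eta - om) (s - y))], which is close to [1] where
    [theta (u - c)] is not small.

    What remains is bookkeeping of growth. The gauge [L] is [exp |t|] when [theta]
    has compact support, and [1 + |t|] when [theta] is a Schwartz function; in both
    cases [theta] and its derivatives decay faster than every power of [L], while
    a power of [L] controls the variation of [w] and of [m1 \o G]. For the
    exponential gauge this control is automatic: [ln w] is Lipschitz
    ([exp_growth]), and a measurable submultiplicative weight grows at most
    exponentially ([submultiplicative_exp]). Powers of [1 / L (u - a)] and
    [1 / L (u - b)] are traded for powers of [1 / L (a - b)], which pay for the
    weight [m] and for replacing [w a] by [w b], and leave the integrable factor
    [1 / (1 + (a - b) ^+ 2)]. The outcome is [osc_entry_bound]; integrating it in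
    frequency and then in position bounds both marginals by
    [delta * osc_const * pi ^+ 2] ([oscillation_norm_le]), which is finite for
    every [delta] and tends to [0] with [delta].

    Parseval is obtained from Fubini's theorem and from pointwise Fourier
    inversion ([fourier_inversion]); the latter applies because the first fact,
    used with a single window, makes the atoms integrable. The oscillation is
    measurable because each inner product is continuous in [(z, eta)], which
    reduces the supremum over a cell to one over a countable grid
    ([oscillation_measurable]). *)

(** * Comparison, domination and exhaustion for Lebesgue integrals *)

Section integral_order.
Context {d} {T : measurableType d} {R : realType}.
Variable mu : {measure set T -> \bar R}.
Local Open Scope ereal_scope.

Import HBNNSimple.

(** The integral of a nonnegative function is a supremum over simple functions
    below it, so monotonicity holds without measurability; this spares proving
    the partial integrals of the oscillation measurable. *)
Lemma ge0_le_integral_nomeas (D : set T) (f g : T -> \bar R) :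
  (forall x, D x -> 0 <= f x) -> (forall x, D x -> f x <= g x) ->
  \int[mu]_(x in D) f x <= \int[mu]_(x in D) g x.
Proof.
move=> f0 fg; rewrite (integral_mkcond _ f) (integral_mkcond _ g).
have f0' : forall x, 0 <= (f \_ D) x by apply: erestrict_ge0.
have fg' : forall x, (f \_ D) x <= (g \_ D) x by apply: lee_restrict.
rewrite !ge0_integralTE//; last by move=> x; exact: le_trans (fg' x).
apply: ereal_sup_le => _ [h hf <-]; by exists h => // x; exact: le_trans (hf x) (fg' x).
Qed.

End integral_order.

Section real_integrable.
Context {d} {T : measurableType d} {R : realType}.
Variables (mu : {measure set T -> \bar R}) (D : set T).
Hypothesis mD : measurable D.
Implicit Types f g : T -> R.

Lemma integrable_scale k f : mu.-integrable D (EFin \o f) ->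
  mu.-integrable D (EFin \o (fun s => k * f s)).
Proof.
move=> hf; rewrite (_ : _ \o _ = (fun s => k%:E * (EFin \o f) s)%E).
  exact: integrableZl.
by apply/funext => s.
Qed.

Lemma integrable_add f g : mu.-integrable D (EFin \o f) ->
  mu.-integrable D (EFin \o g) -> mu.-integrable D (EFin \o (fun s => f s + g s)).
Proof.
move=> hf hg; rewrite (_ : _ \o _ = ((EFin \o f) \+ (EFin \o g))%E).
  exact: integrableD.
by apply/funext => s.
Qed.

Lemma integrable_sub f g : mu.-integrable D (EFin \o f) ->
  mu.-integrable D (EFin \o g) -> mu.-integrable D (EFin \o (fun s => f s - g s)).
Proof.
move=> hf hg; rewrite (_ : _ \o _ = ((EFin \o f) \- (EFin \o g))%E).
  exact: integrableB.
by apply/funext => s.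
Qed.

Lemma integrable_dominated f g : measurable_fun D f ->
  (forall x, D x -> `|f x| <= g x) -> mu.-integrable D (EFin \o g) ->
  mu.-integrable D (EFin \o f).
Proof.
move=> mf fg; apply: le_integrable => //; first exact/measurable_EFinP.
by move=> x Dx; rewrite /= lee_fin (le_trans (fg _ Dx)) // ler_norm.
Qed.

Lemma Rdominated_convergence (f_ : nat -> T -> R) f g :
  (forall n, measurable_fun D (f_ n)) ->
  (forall x, D x -> f_ ^~ x @ \oo --> f x) ->
  (forall n x, D x -> `|f_ n x| <= g x) -> mu.-integrable D (EFin \o g) ->
  \int[mu]_(x in D) f_ n x @[n --> \oo] --> \int[mu]_(x in D) f x.
Proof.
move=> mf f_f fg ig.
have mf' : measurable_fun D f by exact: measurable_fun_cvg f_f.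
have [if_ _ cv] : [/\ mu.-integrable D (EFin \o f),
  [sequence \int[mu]_(x in D) `|(EFin \o f_ n) x - (EFin \o f) x|]_n @ \oo --> 0 &
  [sequence \int[mu]_(x in D) (EFin \o f_ n) x]_n @ \oo --> \int[mu]_(x in D) (EFin \o f) x]%E.
  apply: (@dominated_convergence _ _ _ mu D mD (fun n => EFin \o f_ n) (EFin \o f) (EFin \o g)) => //.
  - by move=> n; exact/measurable_EFinP.
  - exact/measurable_EFinP.
  - by apply: aeW => x Dx; apply: cvg_EFin; [exact: nearW | exact: f_f].
  - by apply: aeW => x n Dx; rewrite /= lee_fin fg.
have fin : (\int[mu]_(x in D) (f x)%:E)%E \is a fin_num by exact: integrable_fin_num.
by rewrite -(fineK fin) in cv; exact: (fine_cvg cv).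
Qed.

Lemma Rintegral_cst0 : \int[mu]_(x in D) (cst 0 : T -> R) x = 0.
Proof. by rewrite /Rintegral integral0. Qed.

End real_integrable.

Section parametric_measurability.
Context {d1 d2} {T1 : measurableType d1} {T2 : measurableType d2} {R : realType}.
Variable mu : {sigma_finite_measure set T2 -> \bar R}.

(** Tonelli's theorem, applied to the positive and to the negative part of [g]. *)
Lemma measurable_Rintegral_param (g : T1 * T2 -> R) : measurable_fun setT g ->
  measurable_fun setT (fun x => \int[mu]_y g (x, y)).
Proof.
move=> mg; apply: (measurableT_comp (f := fine)); first by [].
have mg' : measurable_fun setT (EFin \o g) by exact/measurable_EFinP.
rewrite (_ : (fun x => _) = (fun x => \int[mu]_y (EFin \o g)^\+ (x, y) - \int[mu]_y (EFin \o g)^\- (x, y))%E); last first.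
  apply/funext => x; rewrite integralE.
  by congr (_ - _)%E; apply: eq_integral => y _; rewrite ?funeposE ?funenegE.
apply: emeasurable_funB.
  by apply: (measurable_fun_fubini_tonelli_F (EFin \o g)^\+%E) => //; exact: measurable_funepos.
by apply: (measurable_fun_fubini_tonelli_F (EFin \o g)^\-%E) => //; exact: measurable_funeneg.
Qed.

End parametric_measurability.

(** The fundamental theorem of calculus on an open interval, bounded or not,
    exhausted by compact ones: the improper integral is the limit of increments of
    a primitive. *)
Section exhausting_FTC.
Context {R : realType}.
Notation mu := (@lebesgue_measure R).
Variables (D : set R) (l r : nat -> R) (P p : R -> R).
Hypothesis mD : measurable D.
Hypothesis lr : forall n, l n < r n.
Hypothesis lD : forall n x, l n <= x <= r n -> D x.
Hypothesis nd : forall m n x, (m <= n)%N -> l m <= x <= r m -> l n <= x <= r n.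
Hypothesis ex : forall x, D x -> exists n, l n <= x <= r n.
Hypothesis dP : forall x, D x -> is_derive x 1 P (p x).
Hypothesis cp : forall x, D x -> {for x, continuous p}.

Lemma FTC_segment n :
  (\int[mu]_(x in `[l n, r n]) (p x)%:E = (P (r n))%:E - (P (l n))%:E)%E.
Proof.
have cP x : D x -> {for x, continuous P}.
  by move=> Dx; apply: differentiable_continuous; apply/derivable1_diffP; have [] := dP Dx.
have Dlr x : x \in `[l n, r n]%R -> D x by rewrite in_itv; exact: lD.
apply: continuous_FTC2 => //.
- apply: continuous_in_subspaceT => x /set_mem /= xlr.
  by apply: cp; apply: Dlr.
- split.
  + move=> x xlr; have [] // := dP (Dlr x _).
    exact: subset_itv_oo_cc.
  + apply: cvg_at_right_filter; apply: cP; apply: Dlr.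
    by rewrite in_itv /= lexx ltW.
  + apply: cvg_at_left_filter; apply: cP; apply: Dlr.
    by rewrite in_itv /= lexx ltW.
- move=> x xlr; rewrite derive1E; apply: (@derive_val _ _ _ _ _ _ _ (dP _)).
  by apply: Dlr; exact: subset_itv_oo_cc.
Qed.

Lemma measurable_exhausted : measurable_fun D p.
Proof.
have -> : D = \bigcup_n `[l n, r n]%classic.
  apply/seteqP; split=> [x /ex[n xn]|x [n _]]; last by rewrite /= in_itv; exact: lD.
  by exists n => //=; rewrite in_itv.
apply/measurable_fun_bigcup => n; first by exact: measurable_itv.
apply: subspace_continuous_measurable_fun; first exact: measurable_itv.
apply: continuous_in_subspaceT => x /set_mem /= xlr.
by apply: cp; apply: (@lD n); move: xlr; rewrite in_itv.
Qed.

Let pn n := (EFin \o p) \_ `[l n, r n].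

Let intpn n : (\int[mu]_(x in D) pn n x = (P (r n))%:E - (P (l n))%:E)%E.
Proof.
rewrite -FTC_segment /pn integral_mkcond -patch_setI [RHS]integral_mkcond.
congr (integral _ _ (_ \_ _)); apply/setIidr => x /=; rewrite in_itv; exact: lD.
Qed.

Let mpn n : measurable_fun D (pn n).
Proof.
apply/measurable_restrict => //.
apply: measurable_funS (_ : measurable_fun D _) => //.
by apply/measurable_EFinP; exact: measurable_exhausted.
Qed.

Let cvg_pn x : D x -> pn ^~ x @ \oo --> (p x)%:E.
Proof.
move=> Dx; have [n xn] := ex Dx.
apply/cvg_ballP => e e0; exists n => // m /= nm.
rewrite /pn /patch mem_set /=; first exact: ballxx.
by rewrite in_itv /=; apply: nd xn.
Qed.

Lemma FTC_exhausting_le B : (forall x, D x -> 0 <= p x) ->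
  (forall n, P (r n) - P (l n) <= B) -> (\int[mu]_(x in D) (p x)%:E <= B%:E)%E.
Proof.
move=> p0 PB.
have ge0 n x : D x -> (0 <= pn n x)%E.
  by move=> Dx; rewrite /pn /patch; case: ifP => //= _; rewrite lee_fin p0.
have ndp x : D x -> {homo pn ^~ x : n m / (n <= m)%N >-> (n <= m)%E}.
  move=> Dx m n mn; rewrite /pn /patch.
  case: ifPn => [/set_mem /= xm|_]; last by apply: (ge0 n).
  rewrite mem_set //=; rewrite in_itv /=; apply: nd mn _.
  by move: xm; rewrite in_itv.
have cv := @cvg_monotone_convergence _ _ _ mu _ mD _ mpn ge0 ndp.
rewrite [leLHS](_ : _ = limn (fun n => \int[mu]_(x in D) pn n x))%E; last first.
  rewrite (cvg_lim _ cv) //; apply: eq_integral => x /set_mem Dx; symmetry.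
  by apply/cvg_lim => //; exact: cvg_pn.
apply: lime_le; first by apply/cvg_ex; eexists; exact: cv.
by apply: nearW => n /=; rewrite intpn -EFinB lee_fin.
Qed.

Lemma FTC_exhausting L : mu.-integrable D (EFin \o p) ->
  P (r n) - P (l n) @[n --> \oo] --> L -> \int[mu]_(x in D) p x = L.
Proof.
move=> ip PL.
have [_ _ cv] : [/\ mu.-integrable D (EFin \o p),
  [sequence \int[mu]_(x in D) `|pn n x - (p x)%:E|]_n @ \oo --> 0 &
  [sequence \int[mu]_(x in D) (pn n x)]_n @ \oo --> \int[mu]_(x in D) (p x)%:E]%E.
  apply: (@dominated_convergence _ _ _ mu D mD pn (EFin \o p) (fun x => `|(p x)%:E|%E)) => //.
  - by apply/measurable_EFinP; exact: measurable_exhausted.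
  - by apply: aeW => x Dx; exact: cvg_pn.
  - exact: integrable_abse.
  - apply: aeW => x n Dx; rewrite /pn /patch; case: ifP => //= _.
    by rewrite normr0 lee_fin normr_ge0.
have E : [sequence (\int[mu]_(x in D) pn n x)%E]_n = EFin \o (fun n => P (r n) - P (l n)).
  by apply/funext => n /=; rewrite intpn -EFinB.
rewrite E in cv.
have cv' : (EFin \o (fun n => P (r n) - P (l n))) n @[n --> \oo] --> L%:E.
  by apply: cvg_EFin => //; apply: nearW.
by rewrite /Rintegral -(cvg_lim _ cv) // (cvg_lim _ cv').
Qed.

End exhausting_FTC.

(** * Analytic content of a warping function *)

Section warp_data.
Context {R : realType}.

(** What the estimates use of a warping function [F] on an open interval [D]:
    [G] inverts [F], [w = G'], and [w1 = w'] is dominated by [w]. Affine maps of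
    the line fit too, which yields the Cauchy density as a special case. *)
Record warp_data (D : set R) (F G w w1 : R -> R) (D1 : R) : Prop := WarpData {
  wd_open : open D ;
  wd_convex : forall s t x, D s -> D t -> s <= x <= t -> D x ;
  wd_GD : forall u, D (G u) ;
  wd_FG : forall u, F (G u) = u ;
  wd_GF : forall s, D s -> G (F s) = s ;
  wd_G_lt : forall u v, u < v -> G u < G v ;
  wd_dG : forall u, is_derive u (1 : R) G (w u) ;
  wd_w_gt0 : forall u, 0 < w u ;
  wd_dF : forall s, D s -> is_derive s (1 : R) F (w (F s))^-1 ;
  wd_dw : forall u, is_derive u (1 : R) w (w1 u) ;
  wd_w1_continuous : continuous w1 ;
  wd_w1_le : forall u, `|w1 u| <= D1 * w u
}.

Lemma is_derive_continuous (f : R -> R) (x df : R) :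
  is_derive x 1 f df -> {for x, continuous f}.
Proof.
by case=> df1 _; apply: differentiable_continuous; exact/derivable1_diffP.
Qed.

Lemma warping_function_data (D : set R) (F : R -> R) (D1 : R) :
  D = setT \/ D = `]0, +oo[ ->
  warping_function D F ->
  (forall s, derivable (warp_weight D F) s 1) ->
  continuous (derive1 (warp_weight D F)) ->
  (forall x, `|derive1 (warp_weight D F) x / warp_weight D F x| <= D1) ->
  warp_data D F (warp_inv D F) (warp_weight D F) (derive1 (warp_weight D F)) D1.
Proof.
move=> hD [[bF1 bF2 bF3] dF cF F0 _ _ _] dw cw hD1.
set G := warp_inv D F; set w := warp_weight D F.
have oD : open D by case: hD => ->; [exact: openT | exact: interval_open].
have cvD s t x : D s -> D t -> s <= x <= t -> D x.
  case: hD => -> //=; rewrite !in_itv /= !andbT => s0 _ /andP[sx _].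
  exact: lt_le_trans s0 sx.
have FinD s : D s -> is_derive s 1 F (F^`() s).
  by move=> Ds; rewrite derive1E; apply: DeriveDef => //; exact: dF.
have Fc s : D s -> {for s, continuous F}.
  by move=> /FinD; exact: is_derive_continuous.
have Flt s t : D s -> D t -> s < t -> F s < F t.
  move=> Ds Dt st.
  have stD x : x \in `[s, t]%R -> D x by rewrite in_itv; exact: cvD.
  have [||c cst e] := @MVT _ F F^`() s t st.
  - by move=> x xst; apply: FinD; apply: stD; exact: subset_itv_oo_cc.
  - by apply: continuous_in_subspaceT => x /set_mem /= xst; apply: Fc; exact: stD.
  rewrite -subr_gt0 e mulr_gt0 ?subr_gt0 //; apply: F0; apply: stD.
  exact: subset_itv_oo_cc.
have surjF : set_surj D setT F by [].
have GD u : D (G u).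
  by apply: (@surjpinv_image_sub _ _ (fun=> 0) D setT F surjF); exists u.
have FG u : F (G u) = u by apply: (@surjpK _ _ (fun=> 0) D setT F surjF); rewrite inE.
have GF s : D s -> G (F s) = s.
  by move=> Ds; apply: (@pinvKV _ _ (fun=> 0) D F bF2); rewrite inE.
have Glt u v : u < v -> G u < G v.
  move=> uv; rewrite ltNge; apply/negP; rewrite le_eqVlt => /predU1P[e|/Flt].
    by move: uv; rewrite -(FG u) -(FG v) e ltxx.
  by move=> /(_ (GD _) (GD _)); rewrite !FG => /(lt_trans uv); rewrite ltxx.
have dG (u : R) : is_derive u (1 : R) G (derive1 F (G u))^-1.
  rewrite -{1}(FG u); apply: is_derive_inverse.
  - by near=> s; apply: GF; near: s; apply: open_nbhs_nbhs; split.
  - by near=> s; apply: Fc; near: s; apply: open_nbhs_nbhs; split.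
  - exact: FinD.
  - by rewrite gt_eqF // F0.
have wE u : w u = (derive1 F (G u))^-1.
  by rewrite /w /warp_weight derive1E; apply: (@derive_val _ _ _ _ _ _ _ (dG u)).
have w0 u : 0 < w u by rewrite wE invr_gt0 F0.
split.
- exact: oD.
- exact: cvD.
- exact: GD.
- exact: FG.
- exact: GF.
- exact: Glt.
- by move=> u; rewrite wE; exact: dG.
- exact: w0.
- by move=> s Ds; rewrite wE GF // invrK; exact: FinD.
- by move=> u; rewrite derive1E; apply: DeriveDef => //; exact: dw.
- exact: cw.
- by move=> u; rewrite -ler_pdivrMr // -[X in _ / X](gtr0_norm (w0 u)) -normf_div.
Unshelve. all: by end_near. Qed.

End warp_data.

(** * Functions with two controlled derivatives *)

(** Pointwise forms of the differentiation rules for real functions, with the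
    derivative written as a product in the field. *)
Section real_derivatives.
Context {R : realType}.
Implicit Types (f g : R -> R) (x a b : R).

Lemma is_derive_mul f g x a b :
  is_derive x (1 : R) f a -> is_derive x (1 : R) g b ->
  is_derive x (1 : R) (fun u => f u * g u) (a * g x + f x * b).
Proof.
move=> df dg; apply: is_derive_eq.
by rewrite /GRing.scale /= addrC [a * _]mulrC.
Qed.

Lemma is_derive_add f g x a b :
  is_derive x (1 : R) f a -> is_derive x (1 : R) g b ->
  is_derive x (1 : R) (fun u => f u + g u) (a + b).
Proof. by move=> df dg; apply: is_derive_eq. Qed.

Lemma is_derive_scale k f x a :
  is_derive x (1 : R) f a -> is_derive x (1 : R) (fun u => k * f u) (k * a).
Proof.
move=> df; have h := is_derive_mul (is_derive_cst k x (1 : R)) df; apply: (is_derive_eq h).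
by rewrite mul0r add0r.
Qed.

Lemma is_derive_opp f x a :
  is_derive x (1 : R) f a -> is_derive x (1 : R) (fun u => - f u) (- a).
Proof. by move=> df; apply: is_derive_eq. Qed.

Lemma is_derive_inv f x a : f x != 0 ->
  is_derive x (1 : R) f a -> is_derive x (1 : R) (fun u => (f u)^-1) (- (a / f x ^+ 2)).
Proof.
move=> f0 df; have h := is_deriveV f0 df; apply: (is_derive_eq h).
by rewrite /GRing.scale /= mulNr mulrC.
Qed.

Lemma is_derive_compose f g x a b :
  is_derive (g x) (1 : R) f a -> is_derive x (1 : R) g b ->
  is_derive x (1 : R) (fun u => f (g u)) (a * b).
Proof. by move=> df dg; apply: is_derive1_comp. Qed.

Lemma is_derive_affine c p x : is_derive x (1 : R) (fun u => c * u + p) c.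
Proof.
have h := is_derive_add (is_derive_scale c (is_derive_id x (1 : R))) (is_derive_cst p x (1 : R)).
apply: (is_derive_eq h).
by rewrite mulr1 addr0.
Qed.

Lemma is_derive_shift f x a c :
  is_derive (x - c) (1 : R) f a -> is_derive x (1 : R) (fun u => f (u - c)) a.
Proof.
move=> df.
have hg := is_derive_add (is_derive_id x (1 : R)) (is_derive_cst (- c) x (1 : R)).
have h := @is_derive_compose f (fun u => u - c) x a _ df hg.
apply: (is_derive_eq h).
by rewrite addr0 mulr1.
Qed.

End real_derivatives.

(** Two integrations by parts only need the first two derivatives to be
    controlled by one common pointwise majorant; such pairs are stable under
    sums and products. *)
Section C2_bounded.
Context {R : realType}.
Implicit Types f g B : R -> R.

Definition C2_bounded f B := exists f1 f2 : R -> R,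
  [/\ forall u, is_derive u (1 : R) f (f1 u),
      forall u, is_derive u (1 : R) f1 (f2 u),
      continuous f2 &
      forall u, [/\ `|f u| <= B u, `|f1 u| <= B u & `|f2 u| <= B u]].

Lemma C2_bounded_le f B B' : (forall u, B u <= B' u) ->
  C2_bounded f B -> C2_bounded f B'.
Proof.
move=> BB' [f1 [f2 [df df1 cf2 fB]]]; exists f1, f2; split => // u.
by have [b0 b1 b2] := fB u; split; apply: le_trans (BB' u).
Qed.

Lemma C2_boundedD f g B B' : C2_bounded f B -> C2_bounded g B' ->
  C2_bounded (fun u => f u + g u) (fun u => B u + B' u).
Proof.
move=> [f1 [f2 [df df1 cf2 fB]]] [g1 [g2 [dg dg1 cg2 gB]]].
exists (fun u => f1 u + g1 u), (fun u => f2 u + g2 u); split => u.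
- exact: is_derive_add.
- exact: is_derive_add.
- by apply: cvgD; [exact: cf2 | exact: cg2].
- have [a0 a1 a2] := fB u; have [b0 b1 b2] := gB u.
  by split; apply: le_trans (ler_normD _ _) _; exact: lerD.
Qed.

Lemma C2_boundedZ k f B : C2_bounded f B ->
  C2_bounded (fun u => k * f u) (fun u => `|k| * B u).
Proof.
move=> [f1 [f2 [df df1 cf2 fB]]].
exists (fun u => k * f1 u), (fun u => k * f2 u); split => u.
- exact: is_derive_scale.
- exact: is_derive_scale.
- by apply: cvgMr; exact: cf2.
- have [a0 a1 a2] := fB u.
  by split; rewrite normrM ler_wpM2l.
Qed.

Lemma C2_boundedN f B : C2_bounded f B -> C2_bounded (fun u => - f u) B.
Proof.
move=> /(C2_boundedZ (-1)); rewrite normrN1.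
under eq_fun do rewrite mulN1r.
by under [X in C2_bounded _ X]eq_fun do rewrite mul1r.
Qed.

Lemma C2_boundedB f g B B' : C2_bounded f B -> C2_bounded g B' ->
  C2_bounded (fun u => f u - g u) (fun u => B u + B' u).
Proof. by move=> hf hg; apply: C2_boundedD => //; exact: C2_boundedN. Qed.

(** Leibniz' rule: the coefficients of [(f * g)''] add up to [4]. *)
Lemma C2_boundedM f g B B' : C2_bounded f B -> C2_bounded g B' ->
  C2_bounded (fun u => f u * g u) (fun u => 4 * (B u * B' u)).
Proof.
move=> [f1 [f2 [df df1 cf2 fB]]] [g1 [g2 [dg dg1 cg2 gB]]].
have cf u : {for u, continuous f} by apply: is_derive_continuous; exact: df.
have cg u : {for u, continuous g} by apply: is_derive_continuous; exact: dg.
have cf1 u : {for u, continuous f1} by apply: is_derive_continuous; exact: df1.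
have cg1 u : {for u, continuous g1} by apply: is_derive_continuous; exact: dg1.
exists (fun u => f1 u * g u + f u * g1 u),
  (fun u => f2 u * g u + 2 * (f1 u * g1 u) + f u * g2 u); split => u.
- exact: is_derive_mul.
- have h := is_derive_add (is_derive_mul (df1 u) (dg u)) (is_derive_mul (df u) (dg1 u)).
  by apply: (is_derive_eq h); ring.
- apply: cvgD; first apply: cvgD.
  + by apply: cvgM; [exact: cf2 | exact: cg].
  + by apply: cvgMr; apply: cvgM; [exact: cf1 | exact: cg1].
  + by apply: cvgM; [exact: cf | exact: cg2].
- have [a0 a1 a2] := fB u; have [b0 b1 b2] := gB u.
  have P x y : `|x| <= B u -> `|y| <= B' u -> `|x * y| <= B u * B' u.
    by move=> *; rewrite normrM ler_pM.
  have BB : 0 <= B u * B' u by apply: le_trans (P _ _ a0 b0).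
  have := P _ _ a0 b0; have := P _ _ a1 b0; have := P _ _ a0 b1.
  have := P _ _ a2 b0; have := P _ _ a1 b1; have := P _ _ a0 b2.
  move: BB; set X := B u * B' u => BB h1 h2 h3 h4 h5 h6; split.
  + by apply: le_trans h6 _; lra.
  + by apply: le_trans (ler_normD _ _) _; lra.
  + apply: le_trans (ler_normD _ _) _; apply: le_trans (lerD (ler_normD _ _) (lexx _)) _.
    by rewrite (normrM 2) (ger0_norm (ler0n _ 2)); lra.
Qed.

End C2_bounded.

(** * Gauges *)

Section gauge.
Context {R : realType}.

(** The scale in which decay and moderateness are both measured. Two instances
    are needed: exponential and affine. *)
Record gauge (L : R -> R) : Prop := Gauge {
  gauge_ge : forall t, 1 + `|t| <= L t ;
  gauge_sub : forall s t, L (s + t) <= L s * L t ;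
  gauge_mono : forall s t, `|s| <= `|t| -> L s <= L t
}.

Variable L : R -> R.
Hypothesis hL : gauge L.

Lemma gauge_ge1 t : 1 <= L t.
Proof. by apply: le_trans (gauge_ge hL t); rewrite lerDl. Qed.

Lemma gauge_gt0 t : 0 < L t.
Proof. exact: lt_le_trans ltr01 (gauge_ge1 t). Qed.

Lemma gaugeN t : L (- t) = L t.
Proof. by apply/eqP; rewrite eq_le !(gauge_mono hL) // normrN. Qed.

Lemma gauge_norm t : L `|t| = L t.
Proof. by apply/eqP; rewrite eq_le !(gauge_mono hL) // normr_id. Qed.
Lemma gauge_expr_ge1 n t : 1 <= L t ^+ n.
Proof. by rewrite exprn_ege1 // gauge_ge1. Qed.

Lemma gauge_expr_gt0 n t : 0 < L t ^+ n.
Proof. by rewrite exprn_gt0 // gauge_gt0. Qed.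

Lemma gauge_sqr_ge t : 1 + t ^+ 2 <= L t ^+ 2.
Proof.
apply: (@le_trans _ _ ((1 + `|t|) ^+ 2)).
  by rewrite sqrrD -real_normK ?num_real //; have := normr_ge0 t; lra.
by rewrite ler_sqr ?nnegrE ?(gauge_ge hL) ?addr_ge0 // ltW // gauge_gt0.
Qed.

(** A triangle inequality: decay around two centres forces decay in their
    distance. *)
Lemma gauge_sub_sub s t u : L (s - t) <= L (u - s) * L (u - t).
Proof.
rewrite -(gaugeN (u - s)) opprB.
by rewrite (_ : s - t = (s - u) + (u - t)) ?(gauge_sub hL) //; ring.
Qed.

Lemma gauge_inv_expr n s t u :
  (L (u - s) ^+ n)^-1 * (L (u - t) ^+ n)^-1 <= (L (s - t) ^+ n)^-1.
Proof.
rewrite -invfM -exprMn lef_pV2 ?posrE ?gauge_expr_gt0 //.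
  apply: lerXn2r; rewrite ?nnegrE; last exact: gauge_sub_sub.
    by rewrite ltW // gauge_gt0.
  by rewrite mulr_ge0 // ltW // gauge_gt0.
by rewrite exprn_gt0 // mulr_gt0 // gauge_gt0.
Qed.

End gauge.

(** * Oscillatory integrals in the warped variable *)

Section oscillatory.
Context {R : realType}.
Notation mu := (@lebesgue_measure R).
Variables (D : set R) (F G w w1 : R -> R) (D1 : R).
Hypothesis hW : warp_data D F G w w1 D1.

Let nn n : R := n.+1%:R.
Let gl n := G (- nn n).
Let gr n := G (nn n).

Lemma warp_measurable : measurable D.
Proof. by apply: open_measurable; exact: wd_open hW. Qed.

Lemma warp_G_le u v : (G u <= G v) = (u <= v).
Proof.
have [uv|vu|->] := ltgtP u v; rewrite ?lexx //.
- by rewrite ltW // (wd_G_lt hW).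
- by apply/negbTE; rewrite -ltNge (wd_G_lt hW).
Qed.

Lemma warp_F_continuous s : D s -> {for s, continuous F}.
Proof. by move=> Ds; apply: is_derive_continuous; exact: wd_dF hW _ Ds. Qed.

Lemma warp_w_continuous u : {for u, continuous w}.
Proof. by apply: is_derive_continuous; exact: wd_dw hW _. Qed.

Lemma D1_ge0 : 0 <= D1.
Proof.
have := wd_w1_le hW 0; have := normr_ge0 (w1 0) => h1 h2.
by rewrite -(pmulr_lge0 _ (wd_w_gt0 hW 0)) (le_trans h1 h2).
Qed.

Let glr n : gl n < gr n.
Proof. by apply: (wd_G_lt hW); rewrite /nn; have := ltr0Sn R n; lra. Qed.

Let glrD n x : gl n <= x <= gr n -> D x.
Proof. by apply: (wd_convex hW); exact: wd_GD hW _. Qed.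

Let glrnd m n x : (m <= n)%N -> gl m <= x <= gr m -> gl n <= x <= gr n.
Proof.
move=> mn /andP[a b]; apply/andP; split.
  by apply: le_trans a; rewrite warp_G_le lerN2 ler_nat.
by apply: le_trans b _; rewrite warp_G_le ler_nat.
Qed.

Let glrex x : D x -> exists n, gl n <= x <= gr n.
Proof.
move=> Dx; exists (Num.truncn `|F x|).
suff: gl (Num.truncn `|F x|) <= G (F x) <= gr (Num.truncn `|F x|) by rewrite (wd_GF hW Dx).
by rewrite !warp_G_le -ler_norml; apply: ltW; exact: truncnS_gt.
Qed.

Lemma warp_FTC_le (P p : R -> R) B :
  (forall s, D s -> is_derive s (1 : R) P (p s)) ->
  (forall s, D s -> {for s, continuous p}) -> (forall s, D s -> 0 <= p s) ->
  (forall s t, P s - P t <= B) -> (\int[mu]_(s in D) (p s)%:E <= B%:E)%E.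
Proof.
move=> dP cp p0 PB.
by apply: (FTC_exhausting_le warp_measurable glr glrD glrnd glrex dP cp p0).
Qed.

Lemma warp_FTC0 (P p : R -> R) :
  (forall s, D s -> is_derive s (1 : R) P (p s)) ->
  (forall s, D s -> {for s, continuous p}) ->
  mu.-integrable D (EFin \o p) ->
  P (G n.+1%:R) @[n --> \oo] --> (0 : R) -> P (G (- n.+1%:R)) @[n --> \oo] --> (0 : R) ->
  \int[mu]_(s in D) p s = 0.
Proof.
move=> dP cp ip Pr Pl.
apply: (FTC_exhausting warp_measurable glr glrD glrnd glrex dP cp ip).
by rewrite -[X in _ --> X]subr0; apply: cvgB.
Qed.

(** Pull-back under [F] of the Cauchy density centred at [b], so that its mass does
    not depend on [b]; the profiles below are dominated by multiples of it. *)
Definition warp_cauchy b s := (w (F s))^-1 / (1 + (F s - b) ^+ 2).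

Lemma onesqr_gt0 (t : R) : 0 < 1 + t ^+ 2.
Proof. by have := sqr_ge0 t; lra. Qed.

Lemma warp_cauchy_ge0 b s : 0 <= warp_cauchy b s.
Proof.
by rewrite divr_ge0 ?invr_ge0 ?ltW ?(wd_w_gt0 hW) // onesqr_gt0.
Qed.

Lemma warp_wF_continuous s : D s -> {for s, continuous (fun s => (w (F s))^-1)}.
Proof.
move=> Ds; apply: cvgV; first by rewrite gt_eqF // (wd_w_gt0 hW).
apply: (@continuous_comp _ _ _ F w); first exact: warp_F_continuous.
exact: warp_w_continuous.
Qed.

Lemma warp_cauchy_continuous b s : D s -> {for s, continuous (warp_cauchy b)}.
Proof.
move=> Ds; apply: cvgM; first exact: warp_wF_continuous.
apply: cvgV; first by rewrite gt_eqF // onesqr_gt0.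
apply: cvgD; first exact: cvg_cst.
have h : {for s, continuous (fun s => F s - b)}.
  by apply: cvgB; [exact: warp_F_continuous | exact: cvg_cst].
by apply: cvgM.
Qed.

(** A primitive is [atan (F s - b)]. *)
Lemma warp_cauchy_integral b : (\int[mu]_(s in D) (warp_cauchy b s)%:E <= pi%:E)%E.
Proof.
apply: (@warp_FTC_le (fun s => atan (F s - b))).
- move=> s Ds; have hF : is_derive s (1:R) (fun s => F s - b) (w (F s))^-1.
    have h := is_derive_add (wd_dF hW Ds) (is_derive_cst (- b) s (1 : R)).
    by apply: (is_derive_eq h); rewrite addr0.
  have h := @is_derive_compose _ atan (fun s => F s - b) s _ _ (is_derive1_atan _) hF.
  by apply: (is_derive_eq h); rewrite mulrC.
- by move=> s; exact: warp_cauchy_continuous.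
- by move=> s _; exact: warp_cauchy_ge0.
- by move=> s t; have := atan_ltpi2 (F s - b); have := atan_gtNpi2 (F t - b); lra.
Qed.

Lemma warp_continuous_measurable (p : R -> R) :
  (forall s, D s -> {for s, continuous p}) -> measurable_fun D p.
Proof. by move=> cp; exact: (measurable_exhausted glrD glrex cp). Qed.

Lemma warp_cauchy_integrable b : mu.-integrable D (EFin \o warp_cauchy b).
Proof.
apply/integrableP; split.
  apply/measurable_EFinP; apply: warp_continuous_measurable => s.
  exact: warp_cauchy_continuous.
under eq_integral do rewrite /= ger0_norm ?warp_cauchy_ge0 //.
by rewrite (le_lt_trans (warp_cauchy_integral b)) // ltry.
Qed.

Lemma cauchy_dominated (f : R -> R) b K : measurable_fun D f ->
  (forall s, D s -> `|f s| <= K * warp_cauchy b s) ->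
  mu.-integrable D (EFin \o f) /\ `|\int[mu]_(s in D) f s| <= K * pi.
Proof.
move=> mf fK.
have ik : mu.-integrable D (EFin \o (fun s => K * warp_cauchy b s)).
  by apply: integrable_scale; [exact: warp_measurable | exact: warp_cauchy_integrable].
have K0 s : D s -> 0 <= K * warp_cauchy b s by move=> /fK; exact: le_trans.
have if_ : mu.-integrable D (EFin \o f).
  apply: le_integrable ik; [exact: warp_measurable | exact/measurable_EFinP |].
  by move=> s Ds /=; rewrite lee_fin (le_trans (fK _ Ds)) // ler_norm.
split => //.
apply: (@le_trans _ _ (\int[mu]_(s in D) `|f s|)).
  exact: (@le_normr_Rintegral _ _ _ mu D f warp_measurable if_).
apply: (@le_trans _ _ (\int[mu]_(s in D) (K * warp_cauchy b s))).
  by apply: le_Rintegral => //; [exact: warp_measurable | exact: integrable_norm].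
rewrite RintegralZl; [|exact: warp_measurable|exact: warp_cauchy_integrable].
have K1 : 0 <= K.
  have := K0 _ (wd_GD hW b); rewrite /warp_cauchy (wd_FG hW) subrr expr0n /= addr0 divr1.
  by rewrite pmulr_lge0 // invr_gt0 (wd_w_gt0 hW).
rewrite ler_wpM2l // -lee_fin; apply: le_trans (warp_cauchy_integral b).
rewrite /Rintegral fineK //; apply: integrable_fin_num; first exact: warp_measurable.
exact: warp_cauchy_integrable.
Qed.

Variables (L : R -> R) (C1 : R) (q : nat).
Hypothesis hL : gauge L.
Hypothesis hwL : forall s t, w (s + t) <= C1 * L s ^+ q * w t.

(** Moderateness of [w], taken at the origin. *)
Lemma wL_C1_ge : 1 <= C1 * L 0 ^+ q.
Proof.
have := hwL 0 0; rewrite addr0 => h.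
by rewrite -(ler_pM2r (wd_w_gt0 hW 0)) mul1r.
Qed.

Lemma wL_C1_gt0 : 0 < C1.
Proof.
by rewrite -(pmulr_lgt0 _ (gauge_expr_gt0 hL q 0)) (lt_le_trans _ wL_C1_ge).
Qed.

Lemma wL_factor_ge1 t : 1 <= C1 * L t ^+ q.
Proof.
apply: le_trans wL_C1_ge _; rewrite ler_pM2l ?wL_C1_gt0 //.
apply: lerXn2r; rewrite ?nnegrE ?(ltW (gauge_gt0 hL _)) //.
by apply: (gauge_mono hL); rewrite normr0.
Qed.

Lemma w_le u b : w u <= C1 * L (u - b) ^+ q * w b.
Proof. by have := hwL (u - b) b; rewrite subrK. Qed.

Lemma w_ge u b : w b <= C1 * L (u - b) ^+ q * w u.
Proof. by have := hwL (b - u) u; rewrite subrK -(gaugeN hL (b - u)) opprB. Qed.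

Lemma gauge_inv_expr2 t : (L t ^+ q.+2)^-1 <= (L t ^+ q)^-1 / (1 + t ^+ 2).
Proof.
rewrite -addn2 exprD invfM ler_pM2l ?invr_gt0 ?(gauge_expr_gt0 hL) //.
by rewrite lef_pV2 ?posrE ?onesqr_gt0 ?(gauge_expr_gt0 hL) // gauge_sqr_ge.
Qed.

(** [q] of the [q + 2] powers of the gauge compare [w (F s)] with [w b]; the other
    two make up the Cauchy density. *)
Lemma pullback_dominated (x B b s : R) : `|x| <= B / L (F s - b) ^+ q.+2 ->
  `|x| <= B * C1 * w b * warp_cauchy b s.
Proof.
set u := F s => xB.
have B0 : 0 <= B.
  have := le_trans (normr_ge0 _) xB.
  by rewrite pmulr_lge0 // invr_gt0 (gauge_expr_gt0 hL).
apply: le_trans xB _.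
rewrite -!mulrA ler_wpM2l //; apply: le_trans (gauge_inv_expr2 _) _.
rewrite /warp_cauchy -/u !mulrA ler_pM2r ?invr_gt0 ?onesqr_gt0 //.
rewrite ler_pdivlMr ?(wd_w_gt0 hW) // ler_pdivrMl ?(gauge_expr_gt0 hL) //.
by apply: le_trans (w_le u b) _; rewrite mulrCA mulrA.
Qed.

Lemma pullback_dominated2 (x B b s : R) : `|x| <= B / L (F s - b) ^+ q.+2 ->
  `|x| / w (F s) ^+ 2 <= B * C1 / w b * warp_cauchy b s.
Proof.
set u := F s => xB.
have B0 : 0 <= B.
  have := le_trans (normr_ge0 _) xB.
  by rewrite pmulr_lge0 // invr_gt0 (gauge_expr_gt0 hL).
have wu := wd_w_gt0 hW u; have wb := wd_w_gt0 hW b.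
have Lq := gauge_expr_gt0 hL q (u - b).
rewrite ler_pdivrMr ?exprn_gt0 //; apply: le_trans xB _.
rewrite -!mulrA ler_wpM2l //; apply: le_trans (gauge_inv_expr2 _) _.
rewrite /warp_cauchy -/u.
rewrite (_ : C1 * _ = (C1 * w u / w b) / (1 + (u - b) ^+ 2)); last first.
  by field; rewrite !gt_eqF // onesqr_gt0.
rewrite ler_pM2r ?invr_gt0 ?onesqr_gt0 //.
rewrite ler_pdivlMr // ler_pdivrMl //.
by apply: le_trans (w_ge u b) _; rewrite mulrCA mulrA.
Qed.

Section wave.
Variables (H : R -> R) (B b : R).
Hypothesis hH : C2_bounded H (fun u => B / L (u - b) ^+ q.+2).

Lemma C2_bounded_majorant_ge0 : 0 <= B.
Proof.
have [f1 [f2 [_ _ _ /(_ b)[h _ _]]]] := hH.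
have := le_trans (normr_ge0 _) h.
by rewrite pmulr_lge0 // invr_gt0 (gauge_expr_gt0 hL).
Qed.

Let H_continuous u : {for u, continuous H}.
Proof.
by have [f1 [f2 [d1 _ _ _]]] := hH; apply: is_derive_continuous; exact: d1.
Qed.

Let wave_continuous c phi : continuous (fun s : R => cos (c * s + phi)).
Proof.
move=> s; apply: is_derive_continuous.
Qed.

Let comp_continuous (f : R -> R) : continuous f ->
  forall s, D s -> {for s, continuous (fun s => f (F s))}.
Proof.
move=> cf s Ds; apply: (@continuous_comp _ _ _ F f); last exact: cf.
exact: warp_F_continuous.
Qed.

(** The bound without cancellation, for low frequencies. *)
Lemma wave_mass c phi :
  mu.-integrable D (EFin \o (fun s => H (F s) * cos (c * s + phi))) /\
  `|\int[mu]_(s in D) (H (F s) * cos (c * s + phi))| <= B * C1 * w b * pi.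
Proof.
apply: (@cauchy_dominated _ b).
  apply: warp_continuous_measurable => s Ds.
  apply: cvgM; last exact: wave_continuous.
  by apply: comp_continuous.
move=> s Ds; rewrite normrM.
apply: (@le_trans _ _ (`|H (F s)|)).
  by rewrite ler_piMr // ler_norml cos_geN1 cos_le1.
apply: pullback_dominated.
by have [f1 [f2 [_ _ _ /(_ (F s))[]]]] := hH.
Qed.

(** Two integrations by parts, for high frequencies. One derivative of [H (F s)]
    in [s] costs [1 / w], and [w'] is at most [D1 * w], so the second derivative is
    still of order [1 / w ^ 2]. The boundary terms are collected in one primitive
    [P] that vanishes at both ends of [D]. *)
Lemma wave_decay c phi : c != 0 ->
  `|\int[mu]_(s in D) (H (F s) * cos (c * s + phi))|
    <= (1 + D1) * (B * C1 / w b * pi) / c ^+ 2.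
Proof.
move=> c0; have [H1 [H2 [dH dH1 cH2 hB]]] := hH.
have cH1 : continuous H1.
  by move=> u; apply: is_derive_continuous; exact: dH1.
pose h1 s := H1 (F s) / w (F s).
pose h2u u := (H2 u / w u - H1 u * w1 u / w u ^+ 2) / w u.
pose h2 s := h2u (F s).
have dh s : D s -> is_derive s (1:R) (fun s => H (F s)) (h1 s).
  by move=> Ds; exact: is_derive_compose (dH _) (wd_dF hW Ds).
have dwV u : is_derive u (1:R) (fun u => (w u)^-1) (- (w1 u / w u ^+ 2)).
  by apply: is_derive_inv; [rewrite gt_eqF // (wd_w_gt0 hW) | exact: (wd_dw hW)].
have dh1 s : D s -> is_derive s (1:R) h1 (h2 s).
  move=> Ds.
  have k := @is_derive_compose _ (fun u => H1 u * (w u)^-1) F s _ _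
     (is_derive_mul (dH1 (F s)) (dwV (F s))) (wd_dF hW Ds).
  by apply: (is_derive_eq k); rewrite /h2 /h2u mulrN mulrA.
pose phase s : R := c * s + phi.
have dcos (s : R) : is_derive s (1:R) (fun s => cos (phase s)) (- sin (phase s) * c).
  exact: (@is_derive_compose _ cos _ _ _ _ (is_derive_cos _) (is_derive_affine c phi s)).
have dsin (s : R) : is_derive s (1:R) (fun s => sin (phase s)) (cos (phase s) * c).
  exact: (@is_derive_compose _ sin _ _ _ _ (is_derive_sin _) (is_derive_affine c phi s)).
pose P s := c^-1 * (H (F s) * sin (phase s)) + (c ^+ 2)^-1 * (h1 s * cos (phase s)).
pose p s := H (F s) * cos (phase s) + (c ^+ 2)^-1 * (h2 s * cos (phase s)).
have dP s : D s -> is_derive s (1:R) P (p s).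
  move=> Ds.
  have k := is_derive_add (is_derive_scale c^-1 (is_derive_mul (dh s Ds) (dsin s)))
    (is_derive_scale (c ^+ 2)^-1 (is_derive_mul (dh1 s Ds) (dcos s))).
  by apply: (is_derive_eq k); rewrite /p; field.
have cw u : {for u, continuous w} by exact: warp_w_continuous.
have cwV : continuous (fun u => (w u)^-1).
  by move=> u; apply: is_derive_continuous; exact: dwV.
have cwV2 : continuous (fun u => (w u ^+ 2)^-1).
  have -> : (fun u => (w u ^+ 2)^-1) = (fun u => (w u)^-1 * (w u)^-1).
    by apply/funext => v; rewrite expr2 invfM.
  by move=> u; apply: cvgM; exact: cwV.
have ch2u : continuous h2u.
  move=> u; apply: cvgM; last exact: cwV.
  apply: cvgB; first by apply: cvgM; [exact: cH2 | exact: cwV].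
  apply: cvgM; last exact: cwV2.
  by apply: cvgM; [exact: cH1 | exact: (wd_w1_continuous hW)].
have ch2cos s : D s -> {for s, continuous (fun s => h2 s * cos (phase s))}.
  move=> Ds; apply: cvgM; last exact: wave_continuous.
  exact: (comp_continuous ch2u).
have chcos s : D s -> {for s, continuous (fun s => H (F s) * cos (phase s))}.
  move=> Ds; apply: cvgM; last exact: wave_continuous.
  exact: (comp_continuous H_continuous).
have h2B s : D s -> `|h2 s * cos (phase s)| <= (1 + D1) * (B * C1 / w b) * warp_cauchy b s.
  move=> Ds; rewrite normrM; apply: (@le_trans _ _ `|h2 s|).
    by rewrite ler_piMr // ler_norml cos_geN1 cos_le1.
  have [_ b1 b2] := hB (F s); have wu := wd_w_gt0 hW (F s).
  have := pullback_dominated2 b1; have := pullback_dominated2 b2 => k2 k1.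
  apply: (@le_trans _ _ (`|H2 (F s)| / w (F s) ^+ 2 + D1 * (`|H1 (F s)| / w (F s) ^+ 2))).
    rewrite /h2 /h2u normrM; set u := F s in wu *.
    rewrite (gtr0_norm (x := (w u)^-1)) ?invr_gt0 //.
    rewrite ler_pdivrMr //; apply: le_trans (ler_normB _ _) _.
    rewrite !normrM !normfV (gtr0_norm (x := w u ^+ 2)) ?exprn_gt0 // (gtr0_norm wu).
    rewrite (_ : _ * w u = `|H2 u| / w u + `|H1 u| * (D1 * w u) / w u ^+ 2); last first.
      by field; rewrite gt_eqF.
    rewrite lerD2l ler_pM2r ?invr_gt0 ?exprn_gt0 //.
    by rewrite ler_wpM2l // (wd_w1_le hW).
  rewrite -mulrA mulrDl mul1r; apply: lerD => //.
  by rewrite ler_wpM2l // D1_ge0.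
have [i2 I2] := @cauchy_dominated _ b _ (warp_continuous_measurable ch2cos) h2B.
have [i1 _] := wave_mass c phi.
have i2c : mu.-integrable D (EFin \o (fun s => (c ^+ 2)^-1 * (h2 s * cos (phase s)))).
  by apply: integrable_scale => //; exact: warp_measurable.
have ip : mu.-integrable D (EFin \o p).
  by apply: integrable_add => //; exact: warp_measurable.
(* one spare power of the gauge makes [P] vanish at the ends of [D] *)
have PG u : `|P (G u)| <= (`|c^-1| * B + (c ^+ 2)^-1 * (B * C1 / w b)) * L b / (1 + `|u|).
  have [b0 b1 _] := hB u.
  have B0 := C2_bounded_majorant_ge0.
  have wu := wd_w_gt0 hW u; have wb := wd_w_gt0 hW b.
  have Lt : 1 <= L (u - b) by exact: gauge_ge1.
  have Lt0 : 0 < L (u - b) by exact: gauge_gt0.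
  have Lq : 1 <= L (u - b) ^+ q by exact: gauge_expr_ge1.
  have Lq0 : 0 < L (u - b) ^+ q by exact: gauge_expr_gt0.
  have LV : (L (u - b))^-1 <= L b / (1 + `|u|).
    rewrite ler_pdivlMr ?ltr_wpDr // ler_pdivrMl //.
    by apply: le_trans (gauge_ge hL u) _; rewrite -[X in L X <= _](subrK b) (gauge_sub hL).
  have LVq : (L (u - b) ^+ q.+2)^-1 <= (L (u - b) ^+ q)^-1 * (L (u - b))^-1.
    rewrite -invfM -addn2 exprD expr2 mulrA lef_pV2 ?posrE ?mulr_gt0 //.
    by rewrite ler_peMr // ltW // mulr_gt0.
  have HB : `|H u| <= B * (L b / (1 + `|u|)).
    apply: le_trans b0 _; rewrite ler_wpM2l //; apply: le_trans LVq _.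
    by apply: le_trans LV; rewrite ler_piMl ?invr_ge0 ?(ltW Lt0) // invf_le1.
  have H1B : `|H1 u / w u| <= B * C1 / w b * (L b / (1 + `|u|)).
    rewrite normrM (gtr0_norm (x := (w u)^-1)) ?invr_gt0 // ler_pdivrMr //.
    apply: le_trans b1 _.
    rewrite (_ : _ * _ * w u = B * ((C1 / w b * w u) * (L b / (1 + `|u|)))); last by ring.
    rewrite ler_wpM2l //; apply: le_trans LVq _.
    apply: ler_pM; rewrite ?invr_ge0 ?(ltW Lq0) ?(ltW Lt0) //.
    rewrite mulrAC ler_pdivlMr // ler_pdivrMl //.
    by apply: le_trans (w_ge u b) _; rewrite mulrCA mulrA.
  rewrite /P /h1 (wd_FG hW); apply: le_trans (ler_normD _ _) _.
  rewrite -(mulrA _ (L b)) mulrDl; apply: lerD; rewrite normrM.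
    rewrite -mulrA ler_wpM2l // normrM; apply: le_trans HB.
    by rewrite ler_piMr // ler_norml sin_geN1 sin_le1.
  rewrite ger0_norm ?invr_ge0 ?sqr_ge0 // -(mulrA (c ^+ 2)^-1).
  rewrite ler_wpM2l ?invr_ge0 ?sqr_ge0 //.
  by rewrite normrM; apply: le_trans H1B; rewrite ler_piMr // ler_norml cos_geN1 cos_le1.
have PG0 (e : R) : `|e| = 1 -> P (G (e * n.+1%:R)) @[n --> \oo] --> (0 : R).
  move=> e1; apply/norm_cvg0P.
  pose K := (`|c^-1| * B + (c ^+ 2)^-1 * (B * C1 / w b)) * L b.
  apply: (@squeeze_cvgr _ _ _ _ (fun=> 0) (fun n => K * harmonic n)).
  - apply: nearW => n; rewrite normr_ge0 /=.
    apply: le_trans (PG _) _; rewrite -/K normrM e1 mul1r /=.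
    rewrite ler_wpM2l ?lef_pV2 ?posrE ?ltr_wpDr //.
    + rewrite mulr_ge0 ?(ltW (gauge_gt0 hL _)) // addr_ge0 ?mulr_ge0 ?invr_ge0 ?sqr_ge0 //;
      rewrite ?C2_bounded_majorant_ge0 ?(ltW wL_C1_gt0) ?(ltW (wd_w_gt0 hW _)) //.
    + by rewrite ger0_norm // lerDr.
  - exact: cvg_cst.
  - by rewrite -[X in _ --> X](mulr0 K); apply: cvgMr; exact: cvg_harmonic.
have I0 : \int[mu]_(s in D) p s = 0.
  apply: (@warp_FTC0 P) => //.
  - move=> s Ds; apply: cvgD; first exact: chcos.
    by apply: cvgMr; exact: ch2cos.
  - by have := PG0 1 (normr1 _); under eq_fun do rewrite mul1r.
  - by have := PG0 (-1) (normrN1 _); under eq_fun do rewrite mulN1r.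
have -> : \int[mu]_(s in D) (H (F s) * cos (c * s + phi)) =
    - ((c ^+ 2)^-1 * \int[mu]_(s in D) (h2 s * cos (phase s))).
  rewrite -RintegralZl //; last exact: warp_measurable.
  apply/eqP; rewrite -addr_eq0 -RintegralD //; last exact: warp_measurable.
  exact/eqP.
rewrite normrN normrM ger0_norm ?invr_ge0 ?sqr_ge0 // mulrC.
rewrite ler_pM2r ?invr_gt0 ?exprn_even_gt0 //.
by rewrite mulrA; exact: I2.
Qed.

(** [wave_mass] and [wave_decay] cross over at frequency [1 / w b]. *)
Lemma wave_bound tau phi :
  `|\int[mu]_(s in D) (H (F s) * cos (2 * pi * tau * s + phi))|
    <= 2 * (1 + D1) * C1 * pi * B * w b / (1 + (w b * tau) ^+ 2).
Proof.
have B0 := C2_bounded_majorant_ge0; have wb := wd_w_gt0 hW b.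
have K0 : 0 <= C1 * pi * B * w b.
  by rewrite !mulr_ge0 ?pi_ge0 ?(ltW wL_C1_gt0) // ltW.
have d1 := D1_ge0; have s0 := sqr_ge0 (w b * tau).
rewrite ler_pdivlMr ?onesqr_gt0 //.
have [le1|gt1] := leP ((w b * tau) ^+ 2) 1.
  have [_ I] := wave_mass (2 * pi * tau) phi.
  apply: (@le_trans _ _ (B * C1 * w b * pi * 2)).
    by apply: ler_pM => //; rewrite ?addr_ge0 //; lra.
  rewrite (_ : B * _ * _ * _ * _ = 2 * (C1 * pi * B * w b)); last by ring.
  rewrite (_ : 2 * _ * _ * _ * _ * _ = 2 * (1 + D1) * (C1 * pi * B * w b)); last by ring.
  by rewrite ler_wpM2r // ler_peMr; lra.
have tau0 : tau != 0 by apply: contraTneq gt1 => ->; rewrite mulr0 expr0n /= ltr10.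
have c0 : 2 * pi * tau != 0 :> R by rewrite !mulf_neq0 // gt_eqF // pi_gt0.
have I := wave_decay phi c0.
apply: (@le_trans _ _ ((1 + D1) * (B * C1 / w b * pi) / (2 * pi * tau) ^+ 2 * (2 * (w b * tau) ^+ 2))).
  by apply: ler_pM => //; rewrite ?addr_ge0 //; lra.
rewrite (_ : _ * _ = (2 * (1 + D1) * C1 * pi * B * w b) * (2 * pi)^-2); last first.
  move: (pi_gt0 R); move: (pi : R) => p p0.
  by field; rewrite tau0 !gt_eqF.
rewrite ler_piMr //.
  rewrite (_ : 2 * _ * _ * _ * _ * _ = 2 * (1 + D1) * (C1 * pi * B * w b)); last by ring.
  by rewrite mulr_ge0 //; lra.
rewrite invf_le1 ?exprn_gt0 ?mulr_gt0 ?pi_gt0 // exprn_ege1 //.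
by have := pi_ge2 R; lra.
Qed.

End wave.

End oscillatory.

(** * Laplace and Poisson kernels *)

Section laplace_kernel.
Context {R : realType}.
Notation mu := (@lebesgue_measure R).

(** The Cauchy density [cauchy] is [warp_cauchy] for an affine warping, and
    inherits its mass bound. *)
Lemma affine_warp_data (k p : R) : 0 < k ->
  warp_data setT (fun s => k * s + p) (fun u => k^-1 * u + (- (k^-1 * p)))
    (fun=> k^-1) (fun=> 0) 0.
Proof.
move=> k0; have kn0 : k != 0 by rewrite gt_eqF.
split.
- exact: openT.
- by [].
- by [].
- by move=> u; field.
- by move=> s _; field.
- by move=> u v uv; rewrite ltrD2r ltr_pM2l // invr_gt0.
- by move=> u; exact: is_derive_affine.
- by move=> u; rewrite invr_gt0.
- by move=> s _; rewrite invrK; exact: is_derive_affine.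
- by move=> u; exact: is_derive_cst.
- by move=> u; exact: cvg_cst.
- by move=> u; rewrite normr0 mul0r.
Qed.

Definition cauchy (k p s : R) := k / (1 + (k * s + p) ^+ 2).

Lemma cauchyE k p : 0 < k -> cauchy k p = warp_cauchy (fun s => k * s + p) (fun=> k^-1) 0.
Proof. by move=> k0; apply/funext => s; rewrite /cauchy /warp_cauchy invrK subr0. Qed.

Lemma cauchy_ge0 k p s : 0 < k -> 0 <= cauchy k p s.
Proof. by move=> k0; rewrite divr_ge0 ?ltW ?onesqr_gt0. Qed.

Lemma cauchy_integral k p : 0 < k -> (\int[mu]_s (cauchy k p s)%:E <= pi%:E)%E.
Proof. by move=> k0; rewrite cauchyE //; exact: warp_cauchy_integral (affine_warp_data p k0) _. Qed.

Lemma cauchy_integrable k p : 0 < k -> mu.-integrable setT (EFin \o cauchy k p).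
Proof. by move=> k0; rewrite cauchyE //; exact: warp_cauchy_integrable (affine_warp_data p k0) _. Qed.

Lemma le_expR_cauchy (c t : R) : 0 < c -> expR (- (c * `|t|)) <= 2 / c * cauchy (c / 2) 0 t.
Proof.
move=> c0; rewrite /cauchy addr0.
rewrite (_ : 2 / c * _ = (1 + (c / 2 * t) ^+ 2)^-1); last first.
  by rewrite mulrA (_ : 2 / c * _ = 1) ?mul1r //; field; rewrite gt_eqF.
have ct : 0 <= c * `|t| by rewrite mulr_ge0 // ltW.
rewrite expRN lef_pV2 ?posrE ?expR_gt0 ?onesqr_gt0 //.
have -> : c * `|t| = c * `|t| / 2 + c * `|t| / 2 by field.
rewrite expRD -expr2; apply: (@le_trans _ _ ((1 + c * `|t| / 2) ^+ 2)).
  rewrite -(real_normK (x := c / 2 * t)) ?num_real // normrM (gtr0_norm (x := c / 2)) ?divr_gt0 //.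
  by rewrite mulrAC; set x := c * _ / 2; have : 0 <= x by [rewrite divr_ge0]; nra.
by rewrite ler_sqr ?nnegrE ?expR_ge0 ?expR_ge1Dx // addr_ge0 // divr_ge0.
Qed.

Lemma continuous_expRabs (c : R) : continuous (fun t : R => expR (- (c * `|t|))).
Proof.
move=> t; apply: (@continuous_comp _ _ _ (fun t : R => - (c * `|t|)) expR).
  by apply: cvgN; apply: cvgMr; exact: norm_continuous.
exact: continuous_expR.
Qed.

Lemma expRabs_integrable (c : R) : 0 < c ->
  mu.-integrable setT (EFin \o (fun t => expR (- (c * `|t|)))).
Proof.
move=> c0; apply: (@integrable_dominated _ _ _ mu setT _ _ (fun t => 2 / c * cauchy (c / 2) 0 t)) => //.
- by apply: continuous_measurable_fun; exact: continuous_expRabs.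
- by move=> t _; rewrite ger0_norm ?expR_ge0 // le_expR_cauchy.
- by apply: integrable_scale => //; apply: cauchy_integrable; rewrite divr_gt0.
Qed.

Let wave_continuous (c phi : R) : continuous (fun s : R => cos (c * s + phi)).
Proof. by move=> s; apply: is_derive_continuous. Qed.

Lemma expRabs_wave_integrable (c b phi : R) : 0 < c ->
  mu.-integrable setT (EFin \o (fun t => expR (- (c * `|t|)) * cos (b * t + phi))).
Proof.
move=> c0; apply: integrable_dominated (expRabs_integrable c0) => //.
- apply: continuous_measurable_fun => t; apply: cvgM; first exact: continuous_expRabs.
  exact: wave_continuous.
- move=> t _; rewrite normrM ger0_norm ?expR_ge0 //.
  by rewrite ler_piMr ?expR_ge0 // ler_norml cos_geN1 cos_le1.
Qed.

Lemma derive_exp_wave (c b phi t : R) : c ^+ 2 + b ^+ 2 != 0 ->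
  is_derive t (1 : R) (fun t => (c ^+ 2 + b ^+ 2)^-1 *
     (expR (c * t + 0) * (c * cos (b * t + phi) + b * sin (b * t + phi))))
   (expR (c * t) * cos (b * t + phi)).
Proof.
move=> cb.
have de := @is_derive_compose _ expR _ _ _ _ (is_derive_expR _) (is_derive_affine c 0 t).
have dc := @is_derive_compose _ cos _ _ _ _ (is_derive_cos _) (is_derive_affine b phi t).
have ds := @is_derive_compose _ sin _ _ _ _ (is_derive_sin _) (is_derive_affine b phi t).
have h := is_derive_scale (c ^+ 2 + b ^+ 2)^-1
  (is_derive_mul de (is_derive_add (is_derive_scale c dc) (is_derive_scale b ds))).
by apply: (is_derive_eq h); rewrite addr0; field.
Qed.

Let halfr n : R := n.+2%:R.
Let halfl n : R := n.+2%:R^-1.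

Let halfl_lt1 n : 0 < halfl n < 1.
Proof. by rewrite invr_gt0 ltr0Sn invf_lt1 ?ltr0Sn // ltr1n. Qed.

Let halfr_gt1 n : 1 < halfr n.
Proof. by rewrite /halfr ltr1n. Qed.

Let cvg_halfl : halfl @ \oo --> (0 : R).
Proof.
have := @cvg_harmonic R; rewrite -(cvg_shiftn 1); apply: cvg_trans.
by apply: near_eq_cvg; apply: nearW => n; rewrite /harmonic /= /halfl addn1.
Qed.

Let halfl_le m n : (m <= n)%N -> halfl n <= halfl m.
Proof. by move=> mn; rewrite /halfl lef_pV2 ?posrE ?ltr0Sn // ler_nat. Qed.

Let halfr_le m n : (m <= n)%N -> halfr m <= halfr n.
Proof. by move=> mn; rewrite /halfr ler_nat. Qed.

Let half_ex (x : R) : 0 < x -> exists n, halfl n <= x <= halfr n.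
Proof.
move=> x0; exists (Num.truncn x + Num.truncn x^-1)%N; apply/andP; split.
  rewrite /halfl invf_ple ?posrE ?ltr0Sn //; apply: le_trans (ltW (truncnS_gt _)) _.
  by rewrite ler_nat ltnS leqW // leq_addl.
by apply: le_trans (ltW (truncnS_gt _)) _; rewrite ler_nat ltnS leqW // leq_addr.
Qed.

Section half_lines.
Variables (c b phi : R).
Hypothesis c0 : 0 < c.

Let cb : c ^+ 2 + b ^+ 2 != 0.
Proof. by rewrite gt_eqF // ltr_wpDr ?sqr_ge0 ?exprn_gt0. Qed.

(* [e] is [1] or [-1]: one primitive serves both half-lines *)
Let Q (e t : R) := (c ^+ 2 + b ^+ 2)^-1 *
  (expR (e * c * t + 0) * (e * c * cos (b * t + phi) + b * sin (b * t + phi))).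

Let dQ (e t : R) : `|e| = 1 ->
  is_derive t (1 : R) (Q e) (expR (e * c * t) * cos (b * t + phi)).
Proof.
move=> e1; have ee : (e * c) ^+ 2 = c ^+ 2.
  by rewrite exprMn -(real_normK (x := e)) ?num_real // e1 expr1n mul1r.
by have := @derive_exp_wave (e * c) b phi t; rewrite ee => /(_ cb).
Qed.

Let cQ (e t : R) : `|e| = 1 -> {for t, continuous (Q e)}.
Proof. by move=> e1; apply: is_derive_continuous; exact: dQ. Qed.

Let cdQ (e : R) : continuous (fun t => expR (e * c * t) * cos (b * t + phi)).
Proof.
move=> t; apply: cvgM; last exact: wave_continuous.
apply: (@continuous_comp _ _ _ (fun t : R => e * c * t) expR); last exact: continuous_expR.
by apply: cvgMr; exact: cvg_id.
Qed.

Let Q_le (e : R) n : `|e| = 1 ->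
  `|Q e (- e * halfr n)| <= (c ^+ 2 + b ^+ 2)^-1 * ((c + `|b|) / c) * halfl n.
Proof.
move=> e1; have ee : e * e = 1.
  by rewrite -expr2 -(real_normK (x := e)) ?num_real // e1 expr1n.
have r0 : 0 < halfr n by exact: lt_trans (halfr_gt1 n).
rewrite /Q normrM ger0_norm ?invr_ge0 ?addr_ge0 ?sqr_ge0 // -(mulrA (_ + _)^-1).
rewrite ler_wpM2l ?invr_ge0 ?addr_ge0 ?sqr_ge0 //.
rewrite addr0 (_ : e * c * _ = - (c * halfr n)); last first.
  by rewrite -[RHS]mulr1 -ee; ring.
rewrite normrM ger0_norm ?expR_ge0 // mulrC (_ : (c + `|b|) / c * halfl n = (c + `|b|) * (c * halfr n)^-1); last first.
  by rewrite /halfl -/(halfr n); field; rewrite !gt_eqF.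
apply: ler_pM; rewrite ?expR_ge0 //.
- apply: le_trans (ler_normD _ _) _; rewrite !normrM e1 mul1r (gtr0_norm c0).
  by apply: lerD; rewrite ler_piMr ?(ltW c0) // ler_norml ?cos_geN1 ?cos_le1 ?sin_geN1 ?sin_le1.
- rewrite expRN lef_pV2 ?posrE ?expR_gt0 ?mulr_gt0 //.
  by apply: le_trans (expR_ge1Dx _); rewrite lerDr.
Qed.

Let cvgQ_far (e : R) : `|e| = 1 -> Q e (- e * halfr n) @[n --> \oo] --> (0 : R).
Proof.
move=> e1; apply/norm_cvg0P.
apply: (@squeeze_cvgr _ _ _ _ (fun=> 0) (fun n => (c ^+ 2 + b ^+ 2)^-1 * ((c + `|b|) / c) * halfl n)).
- by apply: nearW => n; rewrite normr_ge0 /= Q_le.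
- exact: cvg_cst.
- by rewrite -[X in _ --> X](mulr0 ((c ^+ 2 + b ^+ 2)^-1 * ((c + `|b|) / c))); apply: cvgMr.
Qed.

Let cvgQ_near (e : R) : `|e| = 1 -> Q e (- e * halfl n) @[n --> \oo] --> Q e 0.
Proof.
move=> e1; apply: (@cvg_comp _ _ _ (fun n => - e * halfl n) (Q e) _ (nbhs (0 : R))).
  by rewrite -(mulr0 (- e)); apply: cvgMr.
exact: cQ.
Qed.

Lemma exp_wave_right : \int[mu]_(t in `]0, +oo[) (expR (- (c * `|t|)) * cos (b * t + phi)) =
  (c ^+ 2 + b ^+ 2)^-1 * (c * cos phi - b * sin phi).
Proof.
have Dp : (`]0, +oo[%classic : set R) = [set t | 0 < t].
  by apply/seteqP; split => t /=; rewrite in_itv /= andbT.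
rewrite (@eq_Rintegral _ _ _ mu _ (fun t => expR (- 1 * c * t) * cos (b * t + phi))); last first.
  by move=> t; rewrite Dp inE /= => t0; rewrite gtr0_norm // mulN1r mulNr.
apply: (@FTC_exhausting _ _ halfl halfr (Q (-1))).
- exact: measurable_itv.
- by move=> n; have /andP[_ h] := halfl_lt1 n; exact: lt_trans h (halfr_gt1 n).
- move=> n x /andP[lx _]; rewrite Dp /=; apply: lt_le_trans lx.
  by have /andP[] := halfl_lt1 n.
- move=> m n x mn /andP[a1 a2]; rewrite (le_trans (halfl_le mn) a1).
  by rewrite (le_trans a2 (halfr_le mn)).
- by move=> x; rewrite Dp /=; exact: half_ex.
- by move=> x _; apply: dQ; rewrite normrN1.
- by move=> x _; exact: cdQ.
- apply: (@eq_integrable _ _ _ mu _ _ (EFin \o (fun t => expR (- (c * `|t|)) * cos (b * t + phi)))).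
  + exact: measurable_itv.
  + by move=> t; rewrite Dp inE /= => t0; rewrite gtr0_norm // mulN1r mulNr.
  + apply: integrableS (expRabs_wave_integrable b phi c0) => //; exact: measurable_itv.
- rewrite (_ : _ * _ = 0 - Q (-1) 0); last first.
    by rewrite /Q !mulr0 !add0r expR0; ring.
  apply: cvgB.
    by have := @cvgQ_far (-1) (normrN1 _); under eq_fun do rewrite opprK mul1r.
  by have := @cvgQ_near (-1) (normrN1 _); under eq_fun do rewrite opprK mul1r.
Qed.

Lemma exp_wave_left : \int[mu]_(t in `]-oo, 0[) (expR (- (c * `|t|)) * cos (b * t + phi)) =
  (c ^+ 2 + b ^+ 2)^-1 * (c * cos phi + b * sin phi).
Proof.
have Dp : (`]-oo, 0[%classic : set R) = [set t | t < 0].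
  by apply/seteqP; split => t /=; rewrite in_itv /=.
rewrite (@eq_Rintegral _ _ _ mu _ (fun t => expR (1 * c * t) * cos (b * t + phi))); last first.
  by move=> t; rewrite Dp inE /= => t0; rewrite ltr0_norm // mul1r mulrN opprK.
apply: (@FTC_exhausting _ _ (fun n => - halfr n) (fun n => - halfl n) (Q 1)).
- exact: measurable_itv.
- by move=> n; have /andP[_ h] := halfl_lt1 n; rewrite ltrN2; exact: lt_trans h (halfr_gt1 n).
- move=> n x /andP[_ lx]; rewrite Dp /=; apply: le_lt_trans lx _.
  by rewrite oppr_lt0; have /andP[] := halfl_lt1 n.
- move=> m n x mn; move=> /andP[a1 a2]; apply/andP; split.
    by apply: le_trans a1; rewrite lerN2; exact: halfr_le.
  by apply: (le_trans a2); rewrite lerN2; exact: halfl_le.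
- move=> x; rewrite Dp /= -oppr_gt0 => /half_ex[n /andP[a1 a2]]; exists n.
  by rewrite lerNl a2 lerNr a1.
- by move=> x _; apply: dQ; rewrite normr1.
- by move=> x _; exact: cdQ.
- apply: (@eq_integrable _ _ _ mu _ _ (EFin \o (fun t => expR (- (c * `|t|)) * cos (b * t + phi)))).
  + exact: measurable_itv.
  + by move=> t; rewrite Dp inE /= => t0; rewrite ltr0_norm // mul1r mulrN opprK.
  + apply: integrableS (expRabs_wave_integrable b phi c0) => //; exact: measurable_itv.
- rewrite (_ : _ * _ = Q 1 0 - 0); last first.
    by rewrite /Q !mulr0 !add0r expR0; ring.
  apply: cvgB.
    by have := @cvgQ_near 1 (normr1 _); under eq_fun do rewrite mulN1r.
  by have := @cvgQ_far 1 (normr1 _); under eq_fun do rewrite mulN1r.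
Qed.

(** The Fourier transform of the Laplace kernel is the Poisson kernel; [phi]
    covers the cosine and the sine transform at once. *)
Lemma exp_wave_integral : \int[mu]_t (expR (- (c * `|t|)) * cos (b * t + phi)) =
  2 * c / (c ^+ 2 + b ^+ 2) * cos phi.
Proof.
have E : [set: R] = `]-oo, 0[ `|` `[0, +oo[.
  by apply/seteqP; split => // t _ /=; rewrite !in_itv /= andbT; case: (ltP t 0); [left | right].
have ii := expRabs_wave_integrable b phi c0.
rewrite E Rintegral_setU //.
- rewrite -Rintegral_itv_obnd_cbnd.
    by rewrite exp_wave_left exp_wave_right; ring.
  by apply: integrableS ii => //; exact: measurable_itv.
- by rewrite -E.
- rewrite disj_set2E; apply/eqP/seteqP; split => t //=; rewrite !in_itv /= andbT.
  by case=> t0; rewrite leNgt t0.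
Qed.

End half_lines.

Definition poisson (c r : R) : R := 2 * c / (c ^+ 2 + (2 * pi * r) ^+ 2).

Section poisson.
Variables (s0 : R).

Let poissonE (c s : R) : 0 < c ->
  poisson c (s - s0) = pi^-1 * cauchy (2 * pi / c) (- (2 * pi / c * s0)) s.
Proof.
move=> c0; rewrite /poisson /cauchy -mulrBr.
have := pi_gt0 R; move: (pi : R) => p p0; move: (s - s0) => r.
have h (x : R) : x ^+ 2 + c ^+ 2 != 0 by rewrite gt_eqF // ltr_wpDl ?sqr_ge0 ?exprn_gt0.
have h1 : 1 + (2 * p / c * r) ^+ 2 != 0 by rewrite gt_eqF // onesqr_gt0.
rewrite (_ : 1 + (2 * p / c * r) ^+ 2 = ((2 * p * r) ^+ 2 + c ^+ 2) / c ^+ 2); last first.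
  by field; rewrite gt_eqF.
rewrite (addrC (c ^+ 2)).
by field; rewrite !gt_eqF //= ?ltr_wpDl ?sqr_ge0 ?exprn_gt0.
Qed.

Lemma poisson_ge0 (c s : R) : 0 < c -> 0 <= poisson c (s - s0).
Proof.
by move=> c0; rewrite poissonE // mulr_ge0 ?invr_ge0 ?pi_ge0 // cauchy_ge0 // divr_gt0 ?mulr_gt0 ?pi_gt0.
Qed.

Lemma poisson_integrable (c : R) : 0 < c ->
  mu.-integrable setT (EFin \o (fun s => poisson c (s - s0))).
Proof.
move=> c0; rewrite (_ : _ \o _ = EFin \o (fun s => pi^-1 * cauchy (2 * pi / c) (- (2 * pi / c * s0)) s)).
  by apply: integrable_scale => //; apply: cauchy_integrable; rewrite divr_gt0 ?mulr_gt0 ?pi_gt0.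
by apply/funext => s /=; rewrite poissonE.
Qed.

Lemma cauchy_mass k p : 0 < k -> \int[mu]_s cauchy k p s = pi.
Proof.
move=> k0.
have r_cvg : k * n.+1%:R + p @[n --> \oo] --> +oo.
  apply/cvgryPge => A; near=> n.
  rewrite -lerBlDr -ler_pdivrMl //; apply: le_trans (_ : n%:R <= _); last by rewrite ler_nat.
  by near: n; apply: cvgry_ge; exact: cvgr_idn.
have l_cvg : k * n.+1%:R - p @[n --> \oo] --> +oo.
  apply/cvgryPge => A; near=> n.
  rewrite lerBrDr -ler_pdivrMl //; apply: le_trans (_ : n%:R <= _); last by rewrite ler_nat.
  by near: n; apply: cvgry_ge; exact: cvgr_idn.
apply: (@FTC_exhausting _ _ (fun n => - n.+1%:R) (fun n => n.+1%:R) (fun s => atan (k * s + p))) => //.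
- by move=> n; have := ltr0Sn R n; lra.
- move=> m n x mn /andP[a1 a2]; rewrite (le_trans _ a1) ?lerN2 ?ler_nat //=.
  by rewrite (le_trans a2) // ler_nat.
- move=> x _; exists (Num.truncn `|x|); rewrite -ler_norml; apply: ltW; exact: truncnS_gt.
- move=> x _.
  have h := @is_derive_compose _ atan (fun s => k * s + p) x _ _ (is_derive1_atan _) (is_derive_affine k p x).
  by apply: (is_derive_eq h); rewrite mulrC.
- move=> x _; rewrite cauchyE //; exact: (warp_cauchy_continuous (affine_warp_data p k0)).
- exact: cauchy_integrable.
- have e n : k * - n.+1%:R + p = - (k * n.+1%:R - p) by ring.
  under eq_fun do rewrite e atanN opprK.
  have -> : pi = pi / 2 + pi / 2 :> R by move: (pi : R) => t; field.
  by apply: cvgD; apply: (cvg_comp _ _ _ (@cvgy_atan R)).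
Unshelve. all: by end_near. Qed.

Lemma poisson_mass (c : R) : 0 < c -> \int[mu]_s poisson c (s - s0) = 1.
Proof.
move=> c0; rewrite (@eq_Rintegral _ _ _ mu _ (fun s => pi^-1 * cauchy (2 * pi / c) (- (2 * pi / c * s0)) s)).
  have k0 : 0 < 2 * pi / c by rewrite divr_gt0 ?mulr_gt0 ?pi_gt0.
  rewrite RintegralZl //; last exact: cauchy_integrable.
  by rewrite cauchy_mass // mulVf // gt_eqF // pi_gt0.
by move=> s _; rewrite poissonE.
Qed.

Lemma poisson_le (c r : R) : 0 < c <= 1 -> r != 0 -> poisson c r <= c / r ^+ 2.
Proof.
move=> /andP[c0 c1] r0; rewrite /poisson.
have r2 : 0 < r ^+ 2 by rewrite exprn_even_gt0.
have pp : 4 <= (2 * pi : R) by have := pi_ge2 R; lra.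
have h : 2 * r ^+ 2 <= (2 * pi * r) ^+ 2.
  rewrite exprMn ler_pM2r //; apply: le_trans (_ : 4 ^+ 2 <= _); first by rewrite expr2; lra.
  by rewrite ler_sqr ?nnegrE //; lra.
have c2 : 0 < c ^+ 2 by rewrite exprn_gt0.
rewrite ler_pdivrMr; last by lra.
rewrite mulrAC ler_pdivlMr //; move: h c2; set X := (2 * pi * r) ^+ 2; set Y := r ^+ 2 => h c2.
rewrite (_ : 2 * c * Y = c * (2 * Y)); last by ring.
by rewrite ler_pM2l //; lra.
Qed.

Lemma poisson_le1 (c r : R) : 0 < c -> `|r| * poisson c r <= 1.
Proof.
move=> c0; rewrite /poisson mulrA ler_pdivrMr; last first.
  by rewrite ltr_wpDr ?sqr_ge0 ?exprn_gt0.
have := pi_ge2 R; move: (pi : R) => p p2.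
have -> : (2 * p * r) ^+ 2 = (2 * p * `|r|) ^+ 2.
  by rewrite [LHS]exprMn [RHS]exprMn real_normK ?num_real.
have x0 := normr_ge0 r; move: x0; set x := `|r| => x0.
have h1 := sqr_ge0 (c - 2 * p * x).
have h2 : 0 <= (p - 2) * (c * x) by rewrite !mulr_ge0 ?(ltW c0) //; lra.
have xx : 0 <= c * x by rewrite mulr_ge0 ?(ltW c0).
have -> : 1 * (c ^+ 2 + (2 * p * x) ^+ 2) = x * (2 * c) + ((c - 2 * p * x) ^+ 2 + 4 * ((p - 2) * (c * x)) + 6 * (c * x)) by ring.
by rewrite lerDl; lra.
Qed.

(** Away from [s0] the kernels tend to [0]; near [s0] the Lipschitz bound absorbs
    their peak ([poisson_le1]). Hence one Cauchy density dominates
    [(f s - f s0) * poisson c (s - s0)] for all widths [c <= 1]. *)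
Lemma poisson_cvg (f : R -> R) (K M : R) :
  measurable_fun setT f ->
  (forall s, `|f s - f s0| <= K * `|s - s0|) ->
  (forall s, `|f s - f s0| <= M) ->
  (forall n, mu.-integrable setT (EFin \o (fun s => f s * poisson (harmonic n) (s - s0)))) /\
  \int[mu]_s (f s * poisson (harmonic n) (s - s0)) @[n --> \oo] --> f s0.
Proof.
move=> mf fK fM.
have M0 : 0 <= M by exact: le_trans (fM s0).
have K0 : 0 <= K.
  have := fK (s0 + 1); rewrite addrAC subrr add0r normr1 mulr1.
  exact: le_trans.
have h0 n : 0 < (harmonic n : R) by rewrite /harmonic /= invr_gt0.
have h1 n : 0 < (harmonic n : R) <= 1 by rewrite h0 /harmonic /= invf_le1 // ler1n.
have mp n : measurable_fun setT (fun s : R => poisson (harmonic n) (s - s0)).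
  by apply/measurable_EFinP; have /(measurable_int mu) := poisson_integrable (h0 n).
pose g n s := (f s - f s0) * poisson (harmonic n) (s - s0).
have mg n : measurable_fun setT (g n).
  by apply: measurable_funM => //; apply: measurable_funB.
pose dom s := 2 * (K + M) * cauchy 1 (- s0) s.
have gdom n s : `|g n s| <= dom s.
  rewrite /g /dom /cauchy mul1r normrM (ger0_norm (poisson_ge0 _ (h0 n))).
  have fKs := fK s; have fMs := fM s; have p0 := poisson_ge0 s (h0 n).
  move: fKs fMs p0; set r := s - s0 => fKs fMs p0.
  rewrite mul1r -/r ler_pdivlMr ?onesqr_gt0 //.
  have q1 := poisson_le1 r (h0 n).
  have q2 := @poisson_le _ r (h1 n).
  move: p0 q1 q2; move: (poisson (harmonic n) r) => p p0 q1 q2.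
  have P0 : 0 <= `|f s - f s0| * p by rewrite mulr_ge0.
  have S0 := ltW (onesqr_gt0 r).
  have [r1|r1] := leP `|r| 1.
    apply: (@le_trans _ _ (K * 2)); last by lra.
    apply: ler_pM => //.
      apply: (@le_trans _ _ (K * `|r| * p)); first by rewrite ler_wpM2r.
      by rewrite -mulrA -[leRHS]mulr1 ler_wpM2l.
    by rewrite -(real_normK (num_real r)) -[leRHS]/(1 + 1) lerD2l expr_le1.
  have r0 : r != 0 by rewrite -normr_gt0 (lt_trans _ r1).
  have r2 : 1 <= r ^+ 2 by rewrite -(real_normK (num_real r)) exprn_ege1 // ltW.
  apply: (@le_trans _ _ (M * (1 / r ^+ 2) * (2 * r ^+ 2))).
    apply: ler_pM => //; last by lra.
    apply: ler_pM => //; apply: le_trans (q2 r0) _.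
    by rewrite ler_pM2r ?invr_gt0 ?(lt_le_trans _ r2) //; have /andP[] := h1 n.
  rewrite (_ : M * _ * _ = M * 2); first by lra.
  by field; rewrite r0.
have idom : mu.-integrable setT (EFin \o dom).
  by apply: integrable_scale => //; exact: cauchy_integrable.
have ig n : mu.-integrable setT (EFin \o g n).
  apply: (@integrable_dominated _ _ _ mu setT _ _ dom).
  - exact: measurableT.
  - exact: mg.
  - by move=> s _; exact: gdom.
  - exact: idom.
have ip n := poisson_integrable (h0 n).
have ic n : mu.-integrable setT (EFin \o (fun s => f s0 * poisson (harmonic n) (s - s0))).
  by apply: integrable_scale.
have fE n : (fun s => f s * poisson (harmonic n) (s - s0)) =
    (fun s => g n s + f s0 * poisson (harmonic n) (s - s0)).
  by apply/funext => s; rewrite /g; ring.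
split => [n|].
  by rewrite fE; apply: integrable_add.
have -> : (fun n => \int[mu]_s (f s * poisson (harmonic n) (s - s0))) =
    (fun n => \int[mu]_s g n s + f s0).
  apply/funext => n; rewrite fE RintegralD // RintegralZl // poisson_mass // mulr1 //.
rewrite -[X in _ --> X]add0r; apply: cvgD; last exact: cvg_cst.
rewrite -(Rintegral_cst0 mu setT).
apply: (@Rdominated_convergence _ _ _ mu setT _ g (cst 0) dom) => //.
- move=> s _; rewrite /cst; have [->|ss0] := eqVneq s s0.
    by rewrite /g subrr; under eq_fun do rewrite mul0r; exact: cvg_cst.
  have r0 : s - s0 != 0 by rewrite subr_eq0.
  apply/norm_cvg0P; apply: (@squeeze_cvgr _ _ _ _ (fun=> 0) (fun n => M / (s - s0) ^+ 2 * harmonic n)).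
  + apply: nearW => n; rewrite normr_ge0 /= normrM (ger0_norm (poisson_ge0 _ (h0 n))).
    rewrite mulrAC -mulrA; apply: ler_pM; rewrite ?(poisson_ge0 _ (h0 n)) //.
    exact: poisson_le.
  + exact: cvg_cst.
  + by rewrite -[X in _ --> X](mulr0 (M / (s - s0) ^+ 2)); apply: cvgMr; exact: cvg_harmonic.
Qed.

End poisson.
End laplace_kernel.

(** * Complex-valued functions through their real and imaginary parts *)

Section complex_parts.
Context {R : realType}.
Local Notation Cre := (@complex.Re R).
Local Notation Cim := (@complex.Im R).
Implicit Types z : R[i].

Lemma complex_ext z1 z2 : Cre z1 = Cre z2 -> Cim z1 = Cim z2 -> z1 = z2.
Proof. by case: z1 => a b; case: z2 => c d /= -> ->. Qed.

Lemma creM z1 z2 : Cre (z1 * z2) = Cre z1 * Cre z2 - Cim z1 * Cim z2.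
Proof. by case: z1; case: z2. Qed.

Lemma cimM z1 z2 : Cim (z1 * z2) = Cre z1 * Cim z2 + Cim z1 * Cre z2.
Proof. by case: z1; case: z2. Qed.

Lemma creB z1 z2 : Cre (z1 - z2) = Cre z1 - Cre z2.
Proof. by case: z1; case: z2. Qed.

Lemma cimB z1 z2 : Cim (z1 - z2) = Cim z1 - Cim z2.
Proof. by case: z1; case: z2. Qed.

Lemma creD z1 z2 : Cre (z1 + z2) = Cre z1 + Cre z2.
Proof. by case: z1; case: z2. Qed.

Lemma cimD z1 z2 : Cim (z1 + z2) = Cim z1 + Cim z2.
Proof. by case: z1; case: z2. Qed.

Lemma cre_conj z : Cre z^*%C = Cre z.
Proof. by case: z. Qed.

Lemma cim_conj z : Cim z^*%C = - Cim z.
Proof. by case: z. Qed.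

Lemma cis2piD (a b : R) : cis2pi (a + b) = cis2pi a * cis2pi b.
Proof.
by apply: complex_ext; rewrite ?creM ?cimM /= mulrDr ?cosD ?sinD //; ring.
Qed.

Lemma conj_cis2pi (a : R) : (cis2pi a)^*%C = cis2pi (- a).
Proof. by apply: complex_ext; rewrite /= ?cre_conj ?cim_conj /= mulrN ?cosN ?sinN. Qed.

(** Taxicab norm on the complex plane: submultiplicative, and compatible with
    separate estimates of real and imaginary parts. *)
Definition cnorm1 z : R := `|Cre z| + `|Cim z|.

Lemma cnorm1_ge0 z : 0 <= cnorm1 z.
Proof. by rewrite addr_ge0. Qed.

Lemma cre_le z : `|Cre z| <= cnorm1 z.
Proof. by rewrite lerDl. Qed.

Lemma cim_le z : `|Cim z| <= cnorm1 z.
Proof. by rewrite lerDr. Qed.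

Lemma cnorm1M z1 z2 : cnorm1 (z1 * z2) <= cnorm1 z1 * cnorm1 z2.
Proof.
rewrite /cnorm1 creM cimM; apply: le_trans (lerD (ler_normB _ _) (ler_normD _ _)) _.
by rewrite !normrM; lra.
Qed.

Lemma cnorm1_cis2pi (a : R) : cnorm1 (cis2pi a) <= 2.
Proof.
by rewrite /cnorm1 /= -[leRHS]/(1 + 1); apply: lerD; rewrite ler_norml ?cos_geN1 ?cos_le1 ?sin_geN1 ?sin_le1.
Qed.

Lemma cnorm1_conj z : cnorm1 z^*%C = cnorm1 z.
Proof. by rewrite /cnorm1 cre_conj cim_conj normrN. Qed.

Lemma normc_le_cnorm1 z : Normc.normc z <= cnorm1 z.
Proof.
case: z => a b; rewrite /cnorm1 /=.
rewrite -[`|a| + `|b|]ger0_norm ?addr_ge0 // -sqrtr_sqr ler_wsqrtr //.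
rewrite sqrrD -(real_normK (num_real a)) -(real_normK (num_real b)).
by have := mulr_ge0 (normr_ge0 a) (normr_ge0 b); lra.
Qed.

End complex_parts.

Section complex_integral.
Context {R : realType}.
Notation mu := (@lebesgue_measure R).
Local Notation Cre := (@complex.Re R).
Local Notation Cim := (@complex.Im R).
Implicit Types (f g k : R -> R[i]).

Definition cintegrable f :=
  mu.-integrable setT (EFin \o (fun t => Cre (f t))) /\
  mu.-integrable setT (EFin \o (fun t => Cim (f t))).

Definition cmeasurable d (T : measurableType d) (f : T -> R[i]) :=
  measurable_fun setT (fun t => Cre (f t)) /\ measurable_fun setT (fun t => Cim (f t)).

Lemma cmeasurableM d (T : measurableType d) (f g : T -> R[i]) :
  cmeasurable f -> cmeasurable g -> cmeasurable (fun t => f t * g t).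
Proof.
move=> [f1 f2] [g1 g2]; split.
  under eq_fun do rewrite creM.
  by apply: measurable_funB; apply: measurable_funM.
under eq_fun do rewrite cimM.
by apply: measurable_funD; apply: measurable_funM.
Qed.

Lemma cmeasurableB d (T : measurableType d) (f g : T -> R[i]) :
  cmeasurable f -> cmeasurable g -> cmeasurable (fun t => f t - g t).
Proof.
move=> [f1 f2] [g1 g2]; split.
  by under eq_fun do rewrite creB; apply: measurable_funB.
by under eq_fun do rewrite cimB; apply: measurable_funB.
Qed.

Lemma cmeasurable_conj d (T : measurableType d) (f : T -> R[i]) :
  cmeasurable f -> cmeasurable (fun t => (f t)^*%C).
Proof.
move=> [f1 f2]; split; first by under eq_fun do rewrite cre_conj.
by under eq_fun do rewrite cim_conj; apply: measurable_funN.
Qed.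

Lemma measurable_cos : measurable_fun setT (@cos R).
Proof. by apply: continuous_measurable_fun; exact: continuous_cos. Qed.

Lemma measurable_sin : measurable_fun setT (@sin R).
Proof. by apply: continuous_measurable_fun; exact: continuous_sin. Qed.

Lemma cmeasurable_cis d (T : measurableType d) (h : T -> R) :
  measurable_fun setT h -> cmeasurable (fun t => cis2pi (h t)).
Proof.
move=> mh; have mh' : measurable_fun setT (fun t => 2 * pi * h t) by apply: measurable_funM.
split; first by apply: (measurableT_comp measurable_cos).
by apply: (measurableT_comp measurable_sin).
Qed.

Lemma cmeasurable_comp d1 d2 (T1 : measurableType d1) (T2 : measurableType d2)
    (f : T2 -> R[i]) (h : T1 -> T2) :
  cmeasurable f -> measurable_fun setT h -> cmeasurable (f \o h).
Proof. by move=> [f1 f2] mh; split; [exact: (measurableT_comp f1) | exact: (measurableT_comp f2)]. Qed.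

Lemma cintegrable_measurable f : cintegrable f -> cmeasurable f.
Proof. by move=> [/(measurable_int mu)/measurable_EFinP f1 /(measurable_int mu)/measurable_EFinP f2]. Qed.

Lemma cintegrable_cnorm1 f : cintegrable f -> mu.-integrable setT (EFin \o (fun t => cnorm1 (f t))).
Proof.
by move=> [f1 f2]; apply: integrable_add => //; apply: integrable_norm.
Qed.

Lemma cintegrable_dominated f (g : R -> R) : cmeasurable f ->
  (forall t, cnorm1 (f t) <= g t) -> mu.-integrable setT (EFin \o g) -> cintegrable f.
Proof.
move=> [f1 f2] fg ig; split; apply: (@integrable_dominated _ _ _ mu setT _ _ g) => //.
  by move=> t _; apply: le_trans (fg t); exact: cre_le.
by move=> t _; apply: le_trans (fg t); exact: cim_le.
Qed.

Lemma cintegrable_Mcis f (h : R -> R) : measurable_fun setT h -> cintegrable f ->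
  cintegrable (fun t => f t * cis2pi (h t)).
Proof.
move=> mh hf; apply: (@cintegrable_dominated _ (fun t => 2 * cnorm1 (f t))).
- apply: cmeasurableM; first exact: cintegrable_measurable.
  exact: cmeasurable_cis.
- move=> t; apply: le_trans (cnorm1M _ _) _; rewrite mulrC ler_wpM2r ?cnorm1_ge0 //.
  exact: cnorm1_cis2pi.
- by apply: integrable_scale => //; exact: cintegrable_cnorm1.
Qed.

Lemma cintegrableZ c f : cintegrable f -> cintegrable (fun t => c * f t).
Proof.
move=> hf; apply: (@cintegrable_dominated _ (fun t => cnorm1 c * cnorm1 (f t))).
- by apply: cmeasurableM; [split; exact: measurable_cst | exact: cintegrable_measurable].
- by move=> t; exact: cnorm1M.
- by apply: integrable_scale => //; exact: cintegrable_cnorm1.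
Qed.

Lemma cintegrableB f g : cintegrable f -> cintegrable g -> cintegrable (fun t => f t - g t).
Proof.
move=> [f1 f2] [g1 g2]; split.
  rewrite (_ : _ \o _ = EFin \o (fun t => Cre (f t) - Cre (g t))).
    exact: integrable_sub.
  by apply/funext => t /=; rewrite creB.
rewrite (_ : _ \o _ = EFin \o (fun t => Cim (f t) - Cim (g t))).
  exact: integrable_sub.
by apply/funext => t /=; rewrite cimB.
Qed.

Lemma cintegrable_conj f : cintegrable f -> cintegrable (fun t => (f t)^*%C).
Proof.
move=> [f1 f2]; split.
  rewrite (_ : _ \o _ = EFin \o (fun t => Cre (f t))) //.
  by apply/funext => t /=; rewrite cre_conj.
rewrite (_ : _ \o _ = EFin \o (fun t => (-1) * Cim (f t))).
  exact: integrable_scale.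
by apply/funext => t /=; rewrite cim_conj mulN1r.
Qed.

Lemma CintegralZ c f : cintegrable f -> Cintegral (fun t => c * f t) = c * Cintegral f.
Proof.
move=> [f1 f2]; apply: complex_ext; rewrite ?creM ?cimM /=.
  under eq_Rintegral do rewrite creM.
  by rewrite RintegralB ?RintegralZl //; exact: integrable_scale.
under eq_Rintegral do rewrite cimM.
by rewrite RintegralD ?RintegralZl //; exact: integrable_scale.
Qed.

Lemma CintegralB f g : cintegrable f -> cintegrable g ->
  Cintegral (fun t => f t - g t) = Cintegral f - Cintegral g.
Proof.
move=> [f1 f2] [g1 g2]; apply: complex_ext; rewrite ?creB ?cimB /=.
  by under eq_Rintegral do rewrite creB; rewrite RintegralB.
by under eq_Rintegral do rewrite cimB; rewrite RintegralB.
Qed.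

Lemma Cintegral_conj f : cintegrable f -> Cintegral (fun t => (f t)^*%C) = (Cintegral f)^*%C.
Proof.
move=> [f1 f2]; apply: complex_ext; rewrite ?cre_conj ?cim_conj /=.
  by under eq_Rintegral do rewrite cre_conj.
under eq_Rintegral do rewrite cim_conj -mulN1r.
by rewrite RintegralZl // mulN1r.
Qed.

Lemma eq_Cintegral f g : f =1 g -> Cintegral f = Cintegral g.
Proof. by move=> /funext ->. Qed.

End complex_integral.

(** * Fourier duality and pointwise inversion *)

Section fourier.
Context {R : realType}.
Notation mu := (@lebesgue_measure R).
Local Notation Cre := (@complex.Re R).
Local Notation Cim := (@complex.Im R).
Implicit Types (f g k : R -> R[i]).

Lemma integrable_tensor (a b : R -> R) :
  mu.-integrable setT (EFin \o a) -> mu.-integrable setT (EFin \o b) ->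
  (mu \x mu)%E.-integrable setT (EFin \o (fun p : R * R => a p.1 * b p.2)).
Proof.
move=> ia ib.
have ma : measurable_fun setT a by apply/measurable_EFinP; exact: measurable_int ia.
have mb : measurable_fun setT b by apply/measurable_EFinP; exact: measurable_int ib.
have mab : measurable_fun setT (EFin \o (fun p : R * R => a p.1 * b p.2)).
  apply/measurable_EFinP; apply: measurable_funM.
    exact: (measurableT_comp ma measurable_fst).
  exact: (measurableT_comp mb measurable_snd).
apply/integrable12ltyP => //=.
have iB : (\int[mu]_y `|(b y)%:E| < +oo)%E by have /integrableP[] := ib.
have iA : (\int[mu]_y `|(a y)%:E| < +oo)%E by have /integrableP[] := ia.
rewrite [ltLHS](_ : _ = \int[mu]_x (`|(a x)%:E| * \int[mu]_y `|(b y)%:E|))%E; last first.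
  apply: eq_integral => x _; rewrite -ge0_integralZl //.
  - by apply: eq_integral => y _; rewrite /= normrM EFinM.
  - by apply: measurableT_comp => //; exact/measurable_EFinP.
rewrite ge0_integralZr //.
- by apply: lte_mul_pinfty => //; [exact: integral_ge0 | rewrite ge0_fin_numE // integral_ge0 ].
- by apply: measurableT_comp => //; exact/measurable_EFinP.
- exact: integral_ge0.
Qed.

Lemma Rintegral_fubini (g : R * R -> R) :
  (mu \x mu)%E.-integrable setT (EFin \o g) ->
  (forall x, mu.-integrable setT (EFin \o (fun y => g (x, y)))) ->
  (forall y, mu.-integrable setT (EFin \o (fun x => g (x, y)))) ->
  \int[mu]_x \int[mu]_y g (x, y) = \int[mu]_y \int[mu]_x g (x, y).
Proof.
move=> ig i1 i2; congr fine.
have e1 x : ((\int[mu]_y g (x, y))%:E = \int[mu]_y (EFin \o g) (x, y))%E.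
  by rewrite /Rintegral fineK //; exact: (integrable_fin_num measurableT (i1 x)).
have e2 y : ((\int[mu]_x g (x, y))%:E = \int[mu]_x (EFin \o g) (x, y))%E.
  by rewrite /Rintegral fineK //; exact: (integrable_fin_num measurableT (i2 y)).
rewrite [LHS](_ : _ = \int[mu]_x \int[mu]_y (EFin \o g) (x, y))%E; last first.
  by apply: eq_integral => x _; exact: e1.
rewrite [RHS](_ : _ = \int[mu]_y \int[mu]_x (EFin \o g) (x, y))%E; last first.
  by apply: eq_integral => y _; exact: e2.
exact: (Fubini ig).
Qed.

Section multiplication.
Variables (f k : R -> R[i]).
Hypotheses (hf : cintegrable f) (hk : cintegrable k).

Let Phi (p : R * R) := f p.2 * k p.1 * cis2pi (p.1 * p.2).

Let mPhi : cmeasurable Phi.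
Proof.
apply: cmeasurableM; first apply: cmeasurableM.
- exact: (cmeasurable_comp (cintegrable_measurable hf) measurable_snd).
- exact: (cmeasurable_comp (cintegrable_measurable hk) measurable_fst).
- by apply: cmeasurable_cis; apply: measurable_funM; [exact: measurable_fst | exact: measurable_snd].
Qed.

Let Phi_le p : cnorm1 (Phi p) <= (2 * cnorm1 (k p.1)) * cnorm1 (f p.2).
Proof.
apply: le_trans (cnorm1M _ _) _.
rewrite (_ : 2 * _ * _ = (cnorm1 (f p.2) * cnorm1 (k p.1)) * 2); last by ring.
by apply: ler_pM; rewrite ?cnorm1_ge0 ?cnorm1_cis2pi ?cnorm1M.
Qed.

Let iPhi : (mu \x mu)%E.-integrable setT (EFin \o (fun p => (2 * cnorm1 (k p.1)) * cnorm1 (f p.2))).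
Proof.
apply: (integrable_tensor (a := fun t => 2 * cnorm1 (k t)) (b := fun t => cnorm1 (f t))).
  by apply: integrable_scale => //; exact: cintegrable_cnorm1.
exact: cintegrable_cnorm1.
Qed.

Let iPhi1 x : cintegrable (fun y => Phi (x, y)).
Proof.
rewrite (_ : (fun y => _) = (fun y => (k x * f y) * cis2pi (x * y))).
  by apply: cintegrable_Mcis; [apply: measurable_funM | exact: cintegrableZ].
by apply/funext => y; rewrite /Phi /= (mulrC (f y)).
Qed.

Let iPhi2 y : cintegrable (fun x => Phi (x, y)).
Proof.
rewrite (_ : (fun x => _) = (fun x => (f y * k x) * cis2pi (x * y))).
  by apply: cintegrable_Mcis; [apply: measurable_funM | exact: cintegrableZ].
by apply/funext => x; rewrite /Phi.
Qed.

(** Fubini's theorem for the absolutely integrable function [Phi]. *)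
Lemma fourier_multiplication :
  Cintegral (fun t => inv_fourier f t * k t) = Cintegral (fun s => f s * inv_fourier k s).
Proof.
have E1 t : inv_fourier f t * k t = Cintegral (fun s => Phi (t, s)).
  rewrite mulrC /inv_fourier -CintegralZ; last first.
    by apply: cintegrable_Mcis => //; exact: measurable_funM.
  by apply: eq_Cintegral => s; rewrite /Phi /=; ring.
have E2 s : f s * inv_fourier k s = Cintegral (fun t => Phi (t, s)).
  rewrite /inv_fourier -CintegralZ; last first.
    by apply: cintegrable_Mcis => //; exact: measurable_funM.
  by apply: eq_Cintegral => t; rewrite /Phi /= (mulrC s t); ring.
rewrite (eq_Cintegral E1) (eq_Cintegral E2).
have [m1 m2] := mPhi.
apply: complex_ext => /=.
- apply: (@Rintegral_fubini (fun p => Cre (Phi p))).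
  + apply: (@integrable_dominated _ _ _ (mu \x mu)%E setT measurableT
      (fun p => Cre (Phi p)) (fun p => (2 * cnorm1 (k p.1)) * cnorm1 (f p.2))) => //.
    by move=> p _; apply: le_trans (Phi_le p); exact: cre_le.
  + by move=> x; have [] := iPhi1 x.
  + by move=> y; have [] := iPhi2 y.
- apply: (@Rintegral_fubini (fun p => Cim (Phi p))).
  + apply: (@integrable_dominated _ _ _ (mu \x mu)%E setT measurableT
      (fun p => Cim (Phi p)) (fun p => (2 * cnorm1 (k p.1)) * cnorm1 (f p.2))) => //.
    by move=> p _; apply: le_trans (Phi_le p); exact: cim_le.
  + by move=> x; have [] := iPhi1 x.
  + by move=> y; have [] := iPhi2 y.
Qed.

End multiplication.

(** The multiplication formula with the conjugate of [U] as second factor. *)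
Lemma fourier_duality f U : cintegrable f -> cintegrable U ->
  inner (inv_fourier f) U =
  Cintegral (fun s => f s * (Cintegral (fun t => U t * cis2pi (- (t * s))))^*%C).
Proof.
move=> hf hU; rewrite /inner (fourier_multiplication hf (cintegrable_conj hU)).
apply: eq_Cintegral => s; congr (_ * _).
rewrite -Cintegral_conj; last first.
  by apply: cintegrable_Mcis => //; apply: measurable_funN; exact: measurable_funM.
apply: eq_Cintegral => t; apply: complex_ext.
  by rewrite cre_conj !creM cre_conj cim_conj (mulrC s t) /= mulrN cosN sinN; ring.
by rewrite cim_conj !cimM cre_conj cim_conj (mulrC s t) /= mulrN cosN sinN; ring.
Qed.

Lemma measurable_inv_fourier f : cmeasurable f -> cmeasurable (inv_fourier f).
Proof.
move=> mf.
have [m1 m2] : cmeasurable (fun p : R * R => f p.2 * cis2pi (p.1 * p.2)).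
  apply: cmeasurableM; first exact: (cmeasurable_comp mf measurable_snd).
  by apply: cmeasurable_cis; apply: measurable_funM; [exact: measurable_fst | exact: measurable_snd].
split.
  exact: (@measurable_Rintegral_param _ _ _ _ _ mu _ m1).
exact: (@measurable_Rintegral_param _ _ _ _ _ mu _ m2).
Qed.

(** Abel summation: by [fourier_multiplication], damping the transform by
    [exp (- c |t|)] replaces [f s0] by a Poisson average of [f]; both sides
    converge as [c] tends to [0]. A Lipschitz condition at the single point [s0]
    suits the windows, which are differentiable on [D] but possibly not at its
    boundary. *)
Lemma fourier_inversion f (s0 K M : R) :
  cintegrable f -> cintegrable (inv_fourier f) ->
  (forall s, cnorm1 (f s - f s0) <= K * `|s - s0|) ->
  (forall s, cnorm1 (f s - f s0) <= M) ->
  Cintegral (fun t => inv_fourier f t * cis2pi (- (t * s0))) = f s0.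
Proof.
move=> hf hF fK fM.
have [mf1 mf2] := cintegrable_measurable hf.
have h0 n : 0 < (harmonic n : R) by rewrite /harmonic /= invr_gt0.
pose damp n (t : R) : R := expR (- (harmonic n * `|t|)).
pose damped n (t : R) : R[i] := (damp n t)%:C%C * cis2pi (- (t * s0)).
have mcis : measurable_fun setT (fun t : R => - (t * s0)).
  by apply: measurable_funN; exact: measurable_funM.
have hdamp n : cintegrable (fun t => (damp n t)%:C%C).
  split; first exact: expRabs_integrable.
  by rewrite (_ : _ \o _ = cst 0%E) //; exact: integrable0.
have hk n : cintegrable (damped n) by exact: cintegrable_Mcis.
have kE n s : inv_fourier (damped n) s = (poisson (harmonic n) (s - s0))%:C%C.
  have E (phi t : R) : expR (- (harmonic n * `|t|)) * cos (2 * pi * (s - s0) * t + phi) =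
      damp n t * cos (2 * pi * (- (t * s0) + s * t) + phi).
    by congr (_ * cos _); ring.
  have -> : inv_fourier (damped n) s = Cintegral (fun t =>
      Complex (damp n t * cos (2 * pi * (- (t * s0) + s * t)))
              (damp n t * sin (2 * pi * (- (t * s0) + s * t)))).
    apply: eq_Cintegral => t; rewrite /damped -mulrA -cis2piD.
    by apply: complex_ext; rewrite ?creM ?cimM /= mul0r ?subr0 ?addr0.
  apply: complex_ext => /=.
  - have := @exp_wave_integral R (harmonic n) (2 * pi * (s - s0)) 0 (h0 n).
    rewrite cos0 mulr1 /poisson => <-; apply: eq_Rintegral => t _.
    by rewrite E addr0.
  - have := @exp_wave_integral R (harmonic n) (2 * pi * (s - s0)) (- (pi / 2)) (h0 n).
    rewrite cosN cos_pihalf mulr0 => <-; apply: eq_Rintegral => t _.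
    by rewrite E cosBpihalf.
have step n : Cintegral (fun t => inv_fourier f t * damped n t) =
    Cintegral (fun s => f s * (poisson (harmonic n) (s - s0))%:C%C).
  rewrite (fourier_multiplication hf (hk n)).
  by apply: eq_Cintegral => s; rewrite kE.
have rhs1 : complex.Re (Cintegral (fun s => f s * (poisson (harmonic n) (s - s0))%:C%C))
    @[n --> \oo] --> complex.Re (f s0).
  rewrite /=; under eq_fun do under eq_Rintegral do rewrite creM /= mulr0 subr0.
  have [//|s|s|_ h] := @poisson_cvg R s0 (fun s => complex.Re (f s)) K M; last exact: h.
    by rewrite -creB; apply: le_trans (fK s); exact: cre_le.
  by rewrite -creB; apply: le_trans (fM s); exact: cre_le.
have rhs2 : complex.Im (Cintegral (fun s => f s * (poisson (harmonic n) (s - s0))%:C%C))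
    @[n --> \oo] --> complex.Im (f s0).
  rewrite /=; under eq_fun do under eq_Rintegral do rewrite cimM /= mulr0 add0r.
  have [//|s|s|_ h] := @poisson_cvg R s0 (fun s => complex.Im (f s)) K M; last exact: h.
    by rewrite -cimB; apply: le_trans (fK s); exact: cim_le.
  by rewrite -cimB; apply: le_trans (fM s); exact: cim_le.
pose u t := inv_fourier f t * cis2pi (- (t * s0)).
have hu : cintegrable u by exact: cintegrable_Mcis.
have dampE n t : inv_fourier f t * damped n t = (damp n t)%:C%C * u t.
  by rewrite /damped /u; ring.
have damp1 t : damp n t @[n --> \oo] --> (1 : R).
  have A : - (harmonic n * `|t|) @[n --> \oo] --> (0 : R).
    rewrite -[X in _ --> X]oppr0 -[X in - X](mul0r `|t|); apply: cvgN; apply: cvgMl.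
    exact: cvg_harmonic.
  rewrite -[X in _ --> X](@expR0 R).
  by apply: (cvg_comp _ _ A); exact: continuous_expR.
have damp_le n t x : `|damp n t * x| <= `|x|.
  rewrite normrM ger0_norm ?expR_ge0 // ler_piMl // -[leRHS](@expR0 R) ler_expR.
  by rewrite oppr_le0 mulr_ge0 // ltW.
have mdamp n : measurable_fun setT (damp n).
  apply: continuous_measurable_fun; exact: continuous_expRabs.
have [iu1 iu2] := hu; have [mu1 mu2] := cintegrable_measurable hu.
have dct (h : R -> R) : measurable_fun setT h -> mu.-integrable setT (EFin \o h) ->
    \int[mu]_t (damp n t * h t) @[n --> \oo] --> \int[mu]_t h t.
  move=> mh ih.
  apply: (@Rdominated_convergence _ _ _ mu setT measurableT (fun n t => damp n t * h t) h (fun t => `|h t|)).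
  - by move=> n; apply: measurable_funM; [exact: mdamp | exact: mh].
  - by move=> t _; rewrite -[X in _ --> X]mul1r; apply: cvgMl; exact: damp1.
  - by move=> n t _; exact: damp_le.
  - exact: integrable_norm.
have lhs1 : complex.Re (Cintegral (fun s => f s * (poisson (harmonic n) (s - s0))%:C%C))
    @[n --> \oo] --> complex.Re (Cintegral u).
  have -> : (fun n => complex.Re (Cintegral (fun s => f s * (poisson (harmonic n) (s - s0))%:C%C)))
      = (fun n => \int[mu]_t (damp n t * complex.Re (u t))); last exact: dct.
  apply/funext => n; rewrite -step (eq_Cintegral (dampE n)); apply: eq_Rintegral => t _.
  by rewrite creM /= mul0r subr0.
have lhs2 : complex.Im (Cintegral (fun s => f s * (poisson (harmonic n) (s - s0))%:C%C))
    @[n --> \oo] --> complex.Im (Cintegral u).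
  have -> : (fun n => complex.Im (Cintegral (fun s => f s * (poisson (harmonic n) (s - s0))%:C%C)))
      = (fun n => \int[mu]_t (damp n t * complex.Im (u t))); last exact: dct.
  apply/funext => n; rewrite -step (eq_Cintegral (dampE n)); apply: eq_Rintegral => t _.
  by rewrite cimM /= mul0r addr0.
apply: complex_ext.
- exact: (cvg_unique _ lhs1 rhs1).
- exact: (cvg_unique _ lhs2 rhs2).
Qed.

End fourier.

(** * Windows and their translates *)

Section decay.
Context {R : realType}.

Lemma le_derive_lipschitz (f df : R -> R) (x y K : R) :
  (forall z, is_derive z (1 : R) f (df z)) ->
  (forall z, `|z - x| <= `|y - x| -> `|df z| <= K) -> `|f y - f x| <= K * `|y - x|.
Proof.
move=> dfE dfK.
have cf : continuous f by move=> z; apply: is_derive_continuous; exact: dfE.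
have [xy|yx] := leP x y.
  have [c /andP[xc cy] ->] := MVT_segment xy (fun z _ => dfE z) (continuous_subspaceT cf).
  rewrite normrM ler_wpM2r // dfK //.
  by rewrite !ger0_norm ?subr_ge0 // lerD2r.
have [c /andP[yc cx] e] := MVT_segment (ltW yx) (fun z _ => dfE z) (continuous_subspaceT cf).
rewrite distrC e normrM (distrC y x) ler_wpM2r // dfK //.
by rewrite distrC (distrC y) !ger0_norm ?subr_ge0 ?(ltW yx) // lerB.
Qed.

Variable L : R -> R.
Hypothesis hL : gauge L.

(** Three derivatives are needed: two for the integrations by parts, and one
    more to measure the effect of a small translation. *)
Definition decays (N : nat) (M : R) (f : R -> R) := exists f1 f2 f3 : R -> R,
  [/\ forall t, is_derive t (1 : R) f (f1 t), forall t, is_derive t (1 : R) f1 (f2 t),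
      forall t, is_derive t (1 : R) f2 (f3 t) &
      forall t, [/\ `|f t| <= M / L t ^+ N, `|f1 t| <= M / L t ^+ N,
                    `|f2 t| <= M / L t ^+ N & `|f3 t| <= M / L t ^+ N]].

Lemma decays_ge0 N M f : decays N M f -> 0 <= M.
Proof.
move=> [_ [_ [_ [_ _ _ /(_ 0)[h _ _ _]]]]]; have := le_trans (normr_ge0 _) h.
by rewrite pmulr_lge0 // invr_gt0 (gauge_expr_gt0 hL).
Qed.

Lemma decaysN N M f : decays N M f -> decays N M (fun t => - f t).
Proof.
move=> [f1 [f2 [f3 [d1 d2 d3 b]]]].
exists (fun t => - f1 t), (fun t => - f2 t), (fun t => - f3 t); split => t; try exact: is_derive_opp.
by have [] := b t; split; rewrite normrN.
Qed.

Lemma ler_pow2 (m n : nat) (t : R) : (m <= n)%N -> (L t ^+ n)^-1 <= (L t ^+ m)^-1.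
Proof.
move=> mn; rewrite lef_pV2 ?posrE ?(gauge_expr_gt0 hL) //.
by rewrite ler_weXn2l // (gauge_ge1 hL).
Qed.

Lemma gauge_inv_shift (N : nat) (Delta b c u : R) : `|b - c| <= Delta ->
  (L (u - c) ^+ N)^-1 <= L Delta ^+ N / L (u - b) ^+ N.
Proof.
move=> bc.
have g0 t : 0 < L t ^+ N by exact: gauge_expr_gt0.
rewrite ler_pdivlMr // ler_pdivrMl // -exprMn.
apply: lerXn2r; rewrite ?nnegrE ?mulr_ge0 ?(ltW (gauge_gt0 hL _)) //.
rewrite (_ : u - b = (u - c) + (c - b)); last by ring.
apply: le_trans (gauge_sub hL _ _) _; rewrite ler_pM2l ?(gauge_gt0 hL) //.
by apply: (gauge_mono hL); rewrite distrC (le_trans bc) // ler_norm.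
Qed.

Lemma decays_shift N M f c : decays N M f ->
  C2_bounded (fun u => f (u - c)) (fun u => M / L (u - c) ^+ N).
Proof.
move=> [f1 [f2 [f3 [d1 d2 d3 b]]]].
exists (fun u => f1 (u - c)), (fun u => f2 (u - c)); split => u.
- exact: is_derive_shift.
- exact: is_derive_shift.
- by apply: is_derive_continuous; exact: is_derive_shift.
- by have [] := b (u - c).
Qed.

Lemma decays_shift_near N M f Delta b c : decays N M f -> `|b - c| <= Delta ->
  C2_bounded (fun u => f (u - c)) (fun u => M * L Delta ^+ N / L (u - b) ^+ N).
Proof.
move=> df bc; apply: C2_bounded_le (decays_shift c df) => u.
by rewrite -mulrA ler_wpM2l ?(decays_ge0 df) // gauge_inv_shift.
Qed.

Lemma decays_difference N M f delta Delta b c :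
  decays N M f -> `|b - c| <= delta -> delta <= Delta ->
  C2_bounded (fun u => f (u - b) - f (u - c))
    (fun u => delta * (M * L Delta ^+ N) / L (u - b) ^+ N).
Proof.
move=> df bc dD; have M0 := decays_ge0 df.
have [f1 [f2 [f3 [d1 d2 d3 hb]]]] := df.
have main (h dh : R -> R) u : (forall t, is_derive t (1 : R) h (dh t)) ->
    (forall t, `|dh t| <= M / L t ^+ N) ->
    `|h (u - b) - h (u - c)| <= delta * (M * L Delta ^+ N) / L (u - b) ^+ N.
  move=> dhE dhM; rewrite distrC.
  apply: le_trans (@le_derive_lipschitz h dh _ _ (M * L Delta ^+ N / L (u - b) ^+ N) dhE _) _.
    move=> z hz; apply: le_trans (dhM z) _; rewrite -mulrA ler_wpM2l //.
    have := @gauge_inv_shift N Delta b (u - z) u.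
    rewrite (_ : u - (u - z) = z); last by ring.
    apply; apply: le_trans (le_trans bc dD).
    rewrite (_ : b - (u - z) = z - (u - b)); last by ring.
    apply: le_trans hz _; rewrite (_ : u - c - (u - b) = b - c) //; ring.
  rewrite (_ : u - c - (u - b) = b - c); last by ring.
  rewrite [leRHS](_ : _ = M * L Delta ^+ N / L (u - b) ^+ N * delta); last by ring.
  by rewrite ler_wpM2l // divr_ge0 ?mulr_ge0 ?(ltW (gauge_expr_gt0 hL _ _)).
exists (fun u => f1 (u - b) - f1 (u - c)), (fun u => f2 (u - b) - f2 (u - c)); split => u.
- apply: is_derive_add; first exact: is_derive_shift.
  by apply: is_derive_opp; exact: is_derive_shift.
- apply: is_derive_add; first exact: is_derive_shift.
  by apply: is_derive_opp; exact: is_derive_shift.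
- apply: (@is_derive_continuous _ _ _ (f3 (u - b) - f3 (u - c))).
  apply: is_derive_add; first exact: is_derive_shift.
  by apply: is_derive_opp; exact: is_derive_shift.
- by split; apply: main => // t; have [] := hb t.
Qed.

End decay.

(** * Amplitude and residual phase at nearby positions *)

Section local_estimates.
Context {R : realType}.
Variables (D : set R) (F G w w1 : R -> R) (D1 : R).
Hypothesis hW : warp_data D F G w w1 D1.
Variables (L : R -> R) (C1 : R) (q : nat).
Hypothesis hL : gauge L.
Hypothesis hwL : forall s t, w (s + t) <= C1 * L s ^+ q * w t.

(** The normalisation [sqrt (F' x)] of the window at [x], for [b = F x]. *)
Definition warp_amp (b : R) : R := Num.sqrt (w b)^-1.

Lemma warp_amp_gt0 b : 0 < warp_amp b.
Proof. by rewrite sqrtr_gt0 invr_gt0 (wd_w_gt0 hW). Qed.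

Lemma warp_amp_sqr b : warp_amp b ^+ 2 = (w b)^-1.
Proof. by rewrite sqr_sqrtr // invr_ge0 ltW // (wd_w_gt0 hW). Qed.

Lemma w_inv_le b c Delta : `|b - c| <= Delta -> (w c)^-1 <= C1 * L Delta ^+ q / w b.
Proof.
move=> bc; rewrite ler_pdivlMr ?(wd_w_gt0 hW) // ler_pdivrMl ?(wd_w_gt0 hW) // mulrC.
apply: le_trans (w_le hwL b c) _; rewrite ler_pM2r ?(wd_w_gt0 hW) //.
rewrite ler_pM2l ?(wL_C1_gt0 hW hL hwL) //.
apply: lerXn2r; rewrite ?nnegrE ?(ltW (gauge_gt0 hL _)) //.
by apply: (gauge_mono hL); rewrite (le_trans bc) // ler_norm.
Qed.

Lemma warp_amp_le b c Delta : `|b - c| <= Delta ->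
  warp_amp c <= C1 * L Delta ^+ q * warp_amp b.
Proof.
move=> bc; have E1 := wL_factor_ge1 hW hL hwL Delta.
have E0 : 0 < C1 * L Delta ^+ q by exact: lt_le_trans E1.
have a0 := warp_amp_gt0.
have Ea : 0 <= C1 * L Delta ^+ q * warp_amp b by apply: mulr_ge0; exact: ltW.
rewrite -ler_sqr ?nnegrE ?Ea ?(ltW (a0 _)) // exprMn !warp_amp_sqr.
apply: le_trans (w_inv_le bc) _; rewrite ler_pM2r ?invr_gt0 ?(wd_w_gt0 hW) //.
by rewrite expr2 ler_peMr // ltW.
Qed.

(** The logarithmic derivative of [1 / w] is bounded by [D1]; dividing by the sum
    of the amplitudes passes to the square root. *)
Lemma warp_amp_diff b c delta Delta : `|b - c| <= delta -> delta <= Delta ->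
  `|warp_amp b - warp_amp c| <= delta * (D1 * (C1 * L Delta ^+ q)) * warp_amp b.
Proof.
move=> bc dD; have a0 := warp_amp_gt0.
have w0 := wd_w_gt0 hW.
have h : `|(w c)^-1 - (w b)^-1| <= D1 * (C1 * L Delta ^+ q) / w b * `|c - b|.
  apply: (@le_derive_lipschitz _ (fun u => (w u)^-1) (fun u => - (w1 u / w u ^+ 2))).
    by move=> z; apply: is_derive_inv; [rewrite gt_eqF | exact: (wd_dw hW)].
  move=> z zb; rewrite normrN normrM normfV (gtr0_norm (x := w z ^+ 2)) ?exprn_gt0 //.
  apply: (@le_trans _ _ (D1 * (w z)^-1)).
    rewrite ler_pdivrMr ?exprn_gt0 // expr2 mulrA -(mulrA D1) mulVf ?gt_eqF // mulr1.
    exact: (wd_w1_le hW).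
  rewrite -!mulrA ler_wpM2l ?(D1_ge0 hW) // mulrA; apply: w_inv_le.
  by rewrite distrC (le_trans zb) // distrC (le_trans bc).
rewrite -(ler_pM2r (a0 b)).
apply: (@le_trans _ _ (`|warp_amp b - warp_amp c| * (warp_amp b + warp_amp c))).
  by rewrite ler_wpM2l // lerDl ltW.
rewrite -[X in _ * X]ger0_norm ?addr_ge0 ?(ltW (a0 _)) // -normrM -subr_sqr !warp_amp_sqr distrC.
apply: le_trans h _.
rewrite [leRHS](_ : _ = D1 * (C1 * L Delta ^+ q) / w b * delta); last first.
  by rewrite -warp_amp_sqr; ring.
rewrite ler_wpM2l ?(distrC c) //.
apply: divr_ge0; last exact: ltW.
by apply: mulr_ge0; [exact: D1_ge0 hW | exact: le_trans ler01 (wL_factor_ge1 hW hL hwL Delta)].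
Qed.

(** The residual phase after correction by [Gamma]. As [kappa] is of order
    [delta / w b], it is of order [delta] with its derivatives, up to powers of the
    gauge in the distance to [b]. *)
Section phase.
Variables (C2 Delta delta kappa b : R).
Hypothesis C20 : 0 <= C2.
Hypothesis delta0 : 0 <= delta <= Delta.
Hypothesis hk : `|kappa| <= delta * C2 / w b.

Definition warp_phase u := kappa * (G u - G b).

Definition phase_const := C2 * C1 * (1 + D1 + Delta * (C2 * C1)).

Lemma phase_const_ge0 : 0 <= phase_const.
Proof.
have /andP[d0 dD] := delta0; have D0 : 0 <= Delta by exact: le_trans dD.
have cc : 0 <= C2 * C1 by rewrite mulr_ge0 // (ltW (wL_C1_gt0 hW hL hwL)).
apply: mulr_ge0 => //; apply: addr_ge0; last exact: mulr_ge0.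
by rewrite addr_ge0 // (D1_ge0 hW).
Qed.

Let X u := C2 * C1 * L (u - b) ^+ q.

Let X0 u : 0 <= X u.
Proof. by rewrite /X !mulr_ge0 ?(ltW (wL_C1_gt0 hW hL hwL)) ?(ltW (gauge_expr_gt0 hL _ _)). Qed.

Let dphase u : is_derive u (1 : R) warp_phase (kappa * w u).
Proof.
apply: is_derive_scale.
have h := is_derive_add (wd_dG hW u) (is_derive_cst (- G b) u (1 : R)).
by apply: (is_derive_eq h); rewrite addr0.
Qed.

Let phase1 u : `|kappa * w u| <= delta * X u.
Proof.
have w0 := wd_w_gt0 hW; have /andP[d0 _] := delta0.
rewrite normrM (gtr0_norm (w0 u)).
apply: le_trans (ler_wpM2r (ltW (w0 u)) hk) _.
rewrite (_ : _ * w u = delta * (C2 * (w u / w b))); last by ring.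
rewrite /X -(mulrA C2) ler_wpM2l // ler_wpM2l // ler_pdivrMr //.
exact: (w_le hwL).
Qed.

Let phase2 u : `|kappa * w1 u| <= D1 * (delta * X u).
Proof.
rewrite normrM; apply: (@le_trans _ _ (`|kappa| * (D1 * w u))).
  by rewrite ler_wpM2l // (wd_w1_le hW).
rewrite mulrCA ler_wpM2l ?(D1_ge0 hW) //; apply: le_trans (phase1 u).
by rewrite normrM (gtr0_norm (wd_w_gt0 hW u)).
Qed.

Let phase0 u : `|warp_phase u| <= delta * (X u * L (u - b)).
Proof.
have /andP[d0 _] := delta0.
have := @le_derive_lipschitz _ warp_phase (fun u => kappa * w u) b u (delta * X u) dphase.
rewrite {2}/warp_phase subrr mulr0 subr0 => h; apply: le_trans (h _) _.
  move=> z zu; apply: le_trans (phase1 z) _; rewrite ler_wpM2l // /X.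
  rewrite ler_wpM2l ?mulr_ge0 ?(ltW (wL_C1_gt0 hW hL hwL)) //.
  apply: lerXn2r; rewrite ?nnegrE ?(ltW (gauge_gt0 hL _)) //.
  exact: (gauge_mono hL).
rewrite -mulrA ler_wpM2l // ler_wpM2l //.
by apply: le_trans (gauge_ge hL _); rewrite lerDr.
Qed.

Let bnd (x : R) u : `|x| <= delta * (X u * L (u - b)) \/
    `|x| <= (delta * X u) ^+ 2 + D1 * (delta * X u) ->
  `|x| <= delta * phase_const * L (u - b) ^+ q.*2.+1.
Proof.
have /andP[d0 dD] := delta0; have D10 := D1_ge0 hW.
have c0 : 0 <= C2 * C1 by rewrite mulr_ge0 ?(ltW (wL_C1_gt0 hW hL hwL)).
have l1 := gauge_ge1 hL (u - b); have lq := gauge_expr_ge1 hL q (u - b).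
have D0 : 0 <= Delta by exact: le_trans dD.
have l0 := le_trans ler01 l1; have lq0 := le_trans ler01 lq.
have -> : L (u - b) ^+ q.*2.+1 = L (u - b) ^+ q * L (u - b) ^+ q * L (u - b).
  by rewrite exprSr -addnn exprD.
rewrite /X /phase_const.
set y := L (u - b) ^+ q in lq lq0 *; set l := L (u - b) in l1 l0 *.
move: y lq lq0 => y y1 y0.
set c := C2 * C1 in c0 *.
have yl : 1 <= y * l by rewrite -[leLHS]mulr1 ler_pM.
have yy : y * l <= y * y * l by rewrite -mulrA ler_peMl // mulr_ge0.
have cy : 0 <= c * (y * y * l) by apply: mulr_ge0 => //; apply: mulr_ge0 => //; apply: mulr_ge0.
have Dcy : 0 <= Delta * c * (c * (y * y * l)) by rewrite mulr_ge0 // mulr_ge0.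
have D1cy : 0 <= D1 * (c * (y * y * l)) by rewrite mulr_ge0.
have E : delta * (c * (1 + D1 + Delta * c)) * (y * y * l) =
    delta * (c * (y * y * l) + D1 * (c * (y * y * l)) + Delta * c * (c * (y * y * l))) by ring.
rewrite E; case=> h; apply: le_trans h _.
  rewrite ler_wpM2l // -mulrA.
  by apply: le_trans (ler_wpM2l c0 yy) _; lra.
rewrite (_ : _ ^+ 2 + _ = delta * (delta * c * (c * (y * y)) + D1 * (c * y))); last by ring.
rewrite ler_wpM2l //.
have yyl : y * y <= y * y * l by rewrite ler_peMr // mulr_ge0.
have yl' : y <= y * y * l by rewrite -mulrA ler_peMr.
have h1 : delta * c * (c * (y * y)) <= Delta * c * (c * (y * y * l)).
  apply: ler_pM; [exact: mulr_ge0 | | by rewrite ler_wpM2r | by rewrite ler_wpM2l].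
  by apply: mulr_ge0 => //; exact: mulr_ge0.
have h2 : D1 * (c * y) <= D1 * (c * (y * y * l)) by rewrite ler_wpM2l // ler_wpM2l.
by lra.
Qed.

Let sin_cos_le (x y : R) : `|sin x * y| <= `|y| /\ `|cos x * y| <= `|y|.
Proof.
by split; rewrite normrM ler_piMl // ler_norml ?sin_geN1 ?sin_le1 ?cos_geN1 ?cos_le1.
Qed.

Let sin_le_id (x : R) : `|sin x| <= `|x|.
Proof.
have := @le_derive_lipschitz _ sin cos 0 x 1 (fun z => is_derive_sin z).
rewrite sin0 !subr0 mul1r; apply => z _.
by rewrite ler_norml cos_geN1 cos_le1.
Qed.

Let cos_le_id (x : R) : `|1 - cos x| <= `|x|.
Proof.
have := @le_derive_lipschitz _ cos (fun x => - sin x) 0 x 1 (fun z => is_derive_cos z).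
rewrite cos0 !subr0 mul1r distrC; apply => z _.
by rewrite normrN ler_norml sin_geN1 sin_le1.
Qed.

Let cphase u : {for u, continuous warp_phase}.
Proof. by apply: is_derive_continuous; exact: dphase. Qed.

Let c1phase u : {for u, continuous (fun u => kappa * w u)}.
Proof. by apply: cvgMr; exact: (warp_w_continuous hW). Qed.

Let c2phase u : {for u, continuous (fun u => kappa * w1 u)}.
Proof. by apply: cvgMr; exact: (wd_w1_continuous hW). Qed.

Let d1phase u : is_derive u (1 : R) (fun u => kappa * w u) (kappa * w1 u).
Proof. by apply: is_derive_scale; exact: (wd_dw hW). Qed.

Let csin u : {for u, continuous (fun u => sin (warp_phase u))}.
Proof. by apply: (@continuous_comp _ _ _ warp_phase sin); [exact: cphase | exact: continuous_sin]. Qed.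

Let ccos u : {for u, continuous (fun u => cos (warp_phase u))}.
Proof. by apply: (@continuous_comp _ _ _ warp_phase cos); [exact: cphase | exact: continuous_cos]. Qed.

Let sqr_le u : `|(kappa * w u) ^+ 2| <= (delta * X u) ^+ 2.
Proof. by rewrite normrX ler_sqr ?nnegrE // (le_trans _ (phase1 u)). Qed.

Lemma phase_sin_bounded : C2_bounded (fun u => sin (warp_phase u))
  (fun u => delta * phase_const * L (u - b) ^+ q.*2.+1).
Proof.
have dsin u := @is_derive_compose _ sin warp_phase u _ _ (is_derive_sin _) (dphase u).
have dcos u := @is_derive_compose _ cos warp_phase u _ _ (is_derive_cos _) (dphase u).
exists (fun u => cos (warp_phase u) * (kappa * w u)),
  (fun u => cos (warp_phase u) * (kappa * w1 u) - sin (warp_phase u) * (kappa * w u) ^+ 2); split => u.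
- exact: dsin.
- have h := is_derive_mul (dcos u) (d1phase u).
  by apply: (is_derive_eq h); ring.
- apply: cvgB; first by apply: cvgM; [exact: ccos | exact: c2phase].
  apply: cvgM; first exact: csin.
  by apply: cvgM; exact: c1phase.
- split; apply: bnd.
  + by left; apply: le_trans (phase0 u); exact: sin_le_id.
  + left; apply: le_trans (sin_cos_le _ _).2 _; apply: le_trans (phase1 u) _.
    have /andP[d0 _] := delta0.
    by rewrite ler_wpM2l // ler_peMr // gauge_ge1.
  + right; apply: le_trans (ler_normB _ _) _; rewrite addrC; apply: lerD.
      by apply: le_trans (sin_cos_le _ _).1 _; exact: sqr_le.
    by apply: le_trans (sin_cos_le _ _).2 _; exact: phase2.
Qed.

Lemma phase_cos_bounded : C2_bounded (fun u => 1 - cos (warp_phase u))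
  (fun u => delta * phase_const * L (u - b) ^+ q.*2.+1).
Proof.
have dsin u := @is_derive_compose _ sin warp_phase u _ _ (is_derive_sin _) (dphase u).
have dcos u := @is_derive_compose _ cos warp_phase u _ _ (is_derive_cos _) (dphase u).
exists (fun u => sin (warp_phase u) * (kappa * w u)),
  (fun u => sin (warp_phase u) * (kappa * w1 u) + cos (warp_phase u) * (kappa * w u) ^+ 2); split => u.
- have h := is_derive_add (is_derive_cst (1 : R) u (1 : R)) (is_derive_opp (dcos u)).
  by apply: (is_derive_eq h); ring.
- have h := is_derive_mul (dsin u) (d1phase u).
  by apply: (is_derive_eq h); ring.
- apply: cvgD; first by apply: cvgM; [exact: csin | exact: c2phase].
  apply: cvgM; first exact: ccos.
  by apply: cvgM; exact: c1phase.
- split; apply: bnd.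
  + by left; apply: le_trans (phase0 u); exact: cos_le_id.
  + left; apply: le_trans (sin_cos_le _ _).1 _; apply: le_trans (phase1 u) _.
    have /andP[d0 _] := delta0.
    by rewrite ler_wpM2l // ler_peMr // gauge_ge1.
  + right; apply: le_trans (ler_normD _ _) _; rewrite addrC; apply: lerD.
      by apply: le_trans (sin_cos_le _ _).2 _; exact: sqr_le.
    by apply: le_trans (sin_cos_le _ _).1 _; exact: phase2.
Qed.

End phase.

End local_estimates.

(** * Profiles of the oscillation entries *)

Section perturbation.
Context {R : realType}.
Variables (D : set R) (F G w w1 : R -> R) (D1 : R).
Hypothesis hW : warp_data D F G w w1 D1.
Variables (L : R -> R) (C1 : R) (q : nat).
Hypothesis hL : gauge L.
Hypothesis hwL : forall s t, w (s + t) <= C1 * L s ^+ q * w t.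
Variables (N1 : nat) (M C2 Delta : R).
Hypothesis C20 : 0 <= C2.
Let N := (N1 + q.*2.+1)%N.
Notation amp := (warp_amp w).

(** One coordinate of the difference between the atom at warped position [b] and
    its phase-corrected copy at [c], split into the variation of the amplitude,
    the translation, and the residual phase [kappa (G u - G b)]. *)
Definition atom_difference (f g : R -> R) (b c kappa u : R) : R :=
  (amp b - amp c) * f (u - b) + amp c * (f (u - b) - f (u - c))
  + amp c * (f (u - c) * (1 - cos (warp_phase G kappa b u))
             - g (u - c) * sin (warp_phase G kappa b u)).

Definition atom_const : R :=
  let E := C1 * L Delta ^+ q in
  E * (D1 * M + M * L Delta ^+ N
       + 8 * (M * L Delta ^+ N * phase_const D1 C1 C2 Delta)).

(** Each of the three parts carries a factor [delta]; the phase costs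
    [q.*2.+1] powers of the gauge, which is why [N] exceeds [N1] by that much. *)
Lemma atom_difference_bounded f g delta b c kappa :
  decays L N M f -> decays L N M g ->
  0 <= delta <= Delta -> `|b - c| <= delta -> `|kappa| <= delta * C2 / w b ->
  C2_bounded (atom_difference f g b c kappa)
    (fun u => delta * atom_const * amp b / L (u - b) ^+ N1).
Proof.
move=> df dg hd bc hk; have /andP[d0 dD] := hd; have bcD := le_trans bc dD.
have M0 := decays_ge0 hL df.
have f1 := decays_shift b df.
have f2 := decays_difference hL df bc dD.
have f3 := decays_shift_near hL df bcD.
have g3 := decays_shift_near hL dg bcD.
have pc := phase_cos_bounded hW hL hwL C20 hd hk.
have ps := phase_sin_bounded hW hL hwL C20 hd hk.
have := C2_boundedD (C2_boundedD (C2_boundedZ (amp b - amp c) f1) (C2_boundedZ (amp c) f2))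
  (C2_boundedZ (amp c) (C2_boundedB (C2_boundedM f3 pc) (C2_boundedM g3 ps))).
apply: C2_bounded_le => u.
have a0 := warp_amp_gt0 hW; have ab := a0 b; have ac := a0 c.
have h1 := warp_amp_diff hW hL hwL bc dD.
have h2 := warp_amp_le hW hL hwL bcD.
have E1 := wL_factor_ge1 hW hL hwL Delta.
have LN : (L (u - b) ^+ N)^-1 <= (L (u - b) ^+ N1)^-1 by apply: ler_pow2; rewrite // leq_addr.
have LQ : (L (u - b) ^+ N)^-1 * L (u - b) ^+ q.*2.+1 = (L (u - b) ^+ N1)^-1.
  by rewrite /N exprD invfM mulfVK // gt_eqF // (gauge_expr_gt0 hL).
have j0 : 0 <= (L (u - b) ^+ N)^-1 by rewrite invr_ge0 ltW // (gauge_expr_gt0 hL).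
have LD : 0 <= L Delta ^+ N by rewrite ltW // (gauge_expr_gt0 hL).
have pc0 := phase_const_ge0 hW hL hwL C20 hd.
rewrite (gtr0_norm ac) /atom_const.
move: E1 h1 h2 LN LQ j0 LD pc0.
set E := C1 * L Delta ^+ q; set i := (L (u - b) ^+ N1)^-1; set j := (L (u - b) ^+ N)^-1.
set K := L Delta ^+ N; set pc' := phase_const _ _ _ _; set l := L (u - b) ^+ _.
move=> E1 h1 h2 LN LQ j0 LD pc0.
have MK : 0 <= M * K by exact: mulr_ge0.
have t1 : `|amp b - amp c| * (M * j) <= delta * (D1 * E) * amp b * (M * i).
  by apply: ler_pM => //; rewrite ?mulr_ge0 // ler_wpM2l.
have t2 : amp c * (delta * (M * K) * j) <= E * amp b * (delta * (M * K) * i).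
  apply: ler_pM => //; rewrite ?(ltW ac) ?mulr_ge0 //.
  by rewrite ler_wpM2l // mulr_ge0.
have t3 : amp c * (4 * (M * K * j * (delta * pc' * l)) + 4 * (M * K * j * (delta * pc' * l)))
   <= E * amp b * (8 * (delta * (M * K * pc' * i))).
  rewrite [X in amp c * X](_ : _ = 8 * (delta * (M * K * pc' * (j * l)))); last by ring.
  rewrite LQ ler_wpM2r //; apply: mulr_ge0 => //; apply: mulr_ge0 => //.
  by apply: mulr_ge0; [exact: mulr_ge0 | exact: le_trans LN].
apply: le_trans (lerD (lerD t1 t2) t3) _.
by rewrite [leRHS](_ : _ = delta * (D1 * E) * amp b * (M * i) + E * amp b * (delta * (M * K) * i) +
  E * amp b * (8 * (delta * (M * K * pc' * i)))) //; ring.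
Qed.

(** Decay in [u - a] and [N2] of the powers in [u - b] are traded for decay in
    [a - b]; the remaining [q.+2] powers in [u - b] are what [wave_bound] asks. *)
Lemma atom_product_bounded (f1 f2 X1 X2 : R -> R) (a b k B : R) (N2 : nat) :
  N1 = (N2 + q.+2)%N -> 0 <= k -> 0 <= B ->
  decays L N M f1 -> decays L N M f2 ->
  C2_bounded X1 (fun u => B / L (u - b) ^+ N1) ->
  C2_bounded X2 (fun u => B / L (u - b) ^+ N1) ->
  C2_bounded (fun u => k * (f1 (u - a) * X1 u + f2 (u - a) * X2 u))
   (fun u => k * (8 * M * B) / L (a - b) ^+ N2 / L (u - b) ^+ q.+2).
Proof.
move=> N1E k0 B0 df1 df2 hX1 hX2.
have M0 := decays_ge0 hL df1.
have := C2_boundedZ k (C2_boundedD (C2_boundedM (decays_shift a df1) hX1)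
  (C2_boundedM (decays_shift a df2) hX2)).
apply: C2_bounded_le => u.
rewrite (ger0_norm k0).
have g0 n t : 0 < L t ^+ n by exact: gauge_expr_gt0.
have La : (L (u - a) ^+ N)^-1 <= (L (u - a) ^+ N2)^-1.
  by apply: ler_pow2; rewrite // /N N1E -addnA leq_addr.
have Lab := gauge_inv_expr hL N2 a b u.
rewrite N1E exprD invfM.
rewrite [leLHS](_ : _ = k * (8 * M * B) * (((L (u - a) ^+ N)^-1 * (L (u - b) ^+ N2)^-1) * (L (u - b) ^+ q.+2)^-1)); last by ring.
rewrite -[leRHS]mulrA ler_wpM2l ?mulr_ge0 // ler_wpM2r ?invr_ge0 ?(ltW (g0 _ _)) //.
by apply: le_trans Lab; rewrite ler_wpM2r ?invr_ge0 ?(ltW (g0 _ _)).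
Qed.

End perturbation.

(** * Parseval formula for the atoms *)

Section lipschitz_at.
Context {R : realType}.

Lemma is_derive_lipschitz_at (f : R -> R) (s0 l : R) : is_derive s0 (1 : R) f l ->
  exists r K : R, [/\ 0 < r, 0 <= K & forall s, `|s - s0| < r -> `|f s - f s0| <= K * `|s - s0|].
Proof.
move=> [df dfE].
have : h^-1 *: (f (h *: 1 + s0) - f s0) @[h --> (0:R)^'] --> l by rewrite -dfE; exact: df.
move=> /cvgrPdist_lt /(_ 1 ltr01) [r /= r0 hr].
exists r, (`|l| + 1); split => // s sr; have [->|ss0] := eqVneq s s0; first by rewrite !subrr normr0 mulr0.
have sn0 : s - s0 != 0 by rewrite subr_eq0.
have := hr (s - s0); rewrite /= sub0r normrN => /(_ sr sn0).
rewrite /GRing.scale /= mulr1 subrK => h.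
rewrite -ler_pdivrMr ?normr_gt0 // mulrC -normfV -normrM.
set x := _ * _ in h *; apply: (@le_trans _ _ (`|l| + `|l - x|)).
  by rewrite -[X in `|X| <= _](subKr l) (le_trans (ler_normB _ _)).
by rewrite lerD2l ltW.
Qed.

(** Lipschitz continuity at the one point [s0], with a global bound: what
    [fourier_inversion] asks of a function. *)
Definition clipschitz_at (s0 : R) (f : R -> R[i]) := exists K M : R,
  (forall s, cnorm1 (f s - f s0) <= K * `|s - s0|) /\ (forall s, cnorm1 (f s) <= M).

Lemma cnorm1D (z1 z2 : R[i]) : cnorm1 (z1 + z2) <= cnorm1 z1 + cnorm1 z2.
Proof.
rewrite /cnorm1 creD cimD.
by apply: le_trans (lerD (ler_normD _ _) (ler_normD _ _)) _; lra.
Qed.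

Lemma cnorm1N (z : R[i]) : cnorm1 (- z) = cnorm1 z.
Proof. by rewrite /cnorm1; case: z => a b /=; rewrite !normrN. Qed.

Lemma clipschitz_atM s0 f g : clipschitz_at s0 f -> clipschitz_at s0 g ->
  clipschitz_at s0 (fun s => f s * g s).
Proof.
move=> [K [M [fK fM]]] [K' [M' [gK gM]]].
exists (K * M' + M * K'), (M * M'); split => s.
  rewrite (_ : f s * g s - f s0 * g s0 = (f s - f s0) * g s + f s0 * (g s - g s0)); last first.
    by rewrite mulrBl mulrBr addrA subrK.
  apply: le_trans (cnorm1D _ _) _; rewrite [leRHS]mulrDl.
  apply: lerD; apply: le_trans (cnorm1M _ _) _.
    by rewrite mulrAC; apply: ler_pM; rewrite ?cnorm1_ge0.
  by rewrite -mulrA; apply: ler_pM; rewrite ?cnorm1_ge0.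
by apply: le_trans (cnorm1M _ _) _; apply: ler_pM; rewrite ?cnorm1_ge0.
Qed.

Lemma clipschitz_at_cis s0 xi : clipschitz_at s0 (fun s => cis2pi (- (xi * s))).
Proof.
have e s : 2 * pi * - (xi * s) = (2 * pi * - xi) * s + 0 :> R by ring.
exists (2 * `|2 * pi * - xi|), 2; split => s; last exact: cnorm1_cis2pi.
rewrite /cnorm1 creB cimB /= !e.
rewrite [leRHS](_ : _ = `|2 * pi * - xi| * `|s - s0| + `|2 * pi * - xi| * `|s - s0|); last by ring.
apply: lerD.
  apply: (@le_derive_lipschitz _ (fun z => cos (2 * pi * - xi * z + 0)) (fun z => - sin (2 * pi * - xi * z + 0) * (2 * pi * - xi))).
    move=> z; exact: (@is_derive_compose _ cos _ _ _ _ (is_derive_cos _) (is_derive_affine _ 0 z)).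
  by move=> z _; rewrite normrM normrN ler_piMl // ler_norml sin_geN1 sin_le1.
apply: (@le_derive_lipschitz _ (fun z => sin (2 * pi * - xi * z + 0)) (fun z => cos (2 * pi * - xi * z + 0) * (2 * pi * - xi))).
  move=> z; exact: (@is_derive_compose _ sin _ _ _ _ (is_derive_sin _) (is_derive_affine _ 0 z)).
by move=> z _; rewrite normrM ler_piMl // ler_norml cos_geN1 cos_le1.
Qed.

(** Near [s0] differentiability gives the Lipschitz bound; at a distance [r] from
    [s0] the sup bound takes over. *)
Lemma clipschitz_at_local (D : set R) s0 (f : R -> R[i]) (h1 h2 : R -> R) (l1 l2 M : R) :
  open D -> D s0 ->
  (forall s, D s -> complex.Re (f s) = h1 s /\ complex.Im (f s) = h2 s) ->
  is_derive s0 (1 : R) h1 l1 -> is_derive s0 (1 : R) h2 l2 ->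
  (forall s, cnorm1 (f s) <= M) -> clipschitz_at s0 f.
Proof.
move=> oD Ds0 fh /is_derive_lipschitz_at[r1 [K1 [r10 K10 hK1]]]
  /is_derive_lipschitz_at[r2 [K2 [r20 K20 hK2]]] fM.
have : nbhs s0 D by apply: open_nbhs_nbhs; split.
move=> [r3 /= r30 hr3].
pose r := Num.min r1 (Num.min r2 r3).
have r0 : 0 < r by rewrite !lt_min r10 r20 r30.
have M0 : 0 <= M by exact: le_trans (cnorm1_ge0 _) (fM s0).
exists (K1 + K2 + 2 * M / r), M; split => // s.
have [sr|rs] := ltP `|s - s0| r.
  have := sr; rewrite /r !lt_min => /andP[sr1 /andP[sr2 sr3]].
  have Ds : D s by apply: hr3; rewrite /= distrC.
  have [e1 e2] := fh _ Ds; have [e3 e4] := fh _ Ds0.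
  rewrite /cnorm1 creB cimB e1 e2 e3 e4.
  apply: le_trans (lerD (hK1 _ sr1) (hK2 _ sr2)) _; rewrite -mulrDl ler_wpM2r //.
  by rewrite lerDl divr_ge0 ?mulr_ge0 // ltW.
apply: (@le_trans _ _ (2 * M)).
  apply: le_trans (cnorm1D _ _) _; rewrite cnorm1N.
  by apply: le_trans (lerD (fM s) (fM s0)) _; lra.
apply: (@le_trans _ _ (2 * M / r * `|s - s0|)).
  by rewrite -mulrA ler_peMr ?mulr_ge0 // ler_pdivlMl // mulr1.
by rewrite ler_wpM2r // lerDr addr_ge0.
Qed.

End lipschitz_at.

Section warped_atoms.
Context {R : realType}.
Notation mu := (@lebesgue_measure R).
Variables (D : set R) (F G w w1 : R -> R) (D1 : R).
Hypothesis hW : warp_data D F G w w1 D1.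
Variables (L : R -> R) (C1 : R) (q : nat).
Hypothesis hL : gauge L.
Hypothesis hwL : forall s t, w (s + t) <= C1 * L s ^+ q * w t.
Variables (N : nat) (M : R) (theta : R -> R[i]).
Hypothesis hN : (q.+2 <= N)%N.
Local Notation tr := (fun t => complex.Re (theta t)).
Local Notation ti := (fun t => complex.Im (theta t)).
Hypotheses (htr : decays L N M tr) (hti : decays L N M ti).
Local Notation amp := (warp_amp w).
Local Notation proto := (warped_proto D F theta).
Local Notation atom := (warped_atom D F theta).

Lemma proto_on x s : D x -> D s ->
  proto x s = (amp (F x))%:C%C * theta (F s - F x).
Proof.
move=> Dx Ds; rewrite /warped_proto mem_set // /warp_amp.
by rewrite derive1E (@derive_val _ _ _ _ _ _ _ (wd_dF hW Dx)).
Qed.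

Lemma proto_off x s : ~ D s -> proto x s = 0.
Proof. by move=> Ds; rewrite /warped_proto memNset. Qed.

Lemma proto_le x s : D x -> cnorm1 (proto x s) <= amp (F x) * (2 * M).
Proof.
move=> Dx; have M0 := decays_ge0 hL htr.
have a0 := ltW (warp_amp_gt0 hW (F x)).
have [Ds|Ds] := pselect (D s); last first.
  by rewrite proto_off // /cnorm1 /= normr0 addr0 !mulr_ge0.
have [? [? [? [_ _ _ b1]]]] := htr; have [? [? [? [_ _ _ b2]]]] := hti.
rewrite proto_on // /cnorm1 creM cimM /= !mul0r subr0 addr0 !normrM (ger0_norm a0) -mulrDr.
rewrite ler_wpM2l // (_ : 2 * M = M + M); last by ring.
have ML u : M / L u ^+ N <= M.
  by rewrite ler_pdivrMr ?(gauge_expr_gt0 hL) // ler_peMr // gauge_expr_ge1.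
apply: lerD; apply: le_trans (ML (F s - F x)).
  by have [] := b1 (F s - F x).
by have [] := b2 (F s - F x).
Qed.

Lemma Rintegral_supported (h h' : R -> R) :
  (forall s, D s -> h s = h' s) -> (forall s, ~ D s -> h s = 0) ->
  \int[mu]_s h s = \int[mu]_(s in D) h' s.
Proof.
move=> hD h0; rewrite [RHS]Rintegral_mkcond; apply: eq_Rintegral => s _.
rewrite /patch; case: ifPn => [/set_mem /hD //|/negP sD].
by rewrite h0 // => Ds; apply: sD; rewrite inE.
Qed.

Lemma integrable_supported (h h' : R -> R) :
  (forall s, D s -> h s = h' s) -> (forall s, ~ D s -> h s = 0) ->
  mu.-integrable D (EFin \o h') -> mu.-integrable setT (EFin \o h).
Proof.
move=> hD h0 ih; have := (@integrable_mkcond _ _ _ mu D (EFin \o h') (warp_measurable hW)).1 ih.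
rewrite (_ : _ \_ _ = EFin \o h) //; apply/funext => s.
rewrite /patch; case: ifPn => [/set_mem /hD /= -> //|/negP sD].
by rewrite /= h0 // => Ds; apply: sD; rewrite inE.
Qed.

Let shape_bounded (f : R -> R) a : decays L N M f ->
  C2_bounded (fun u => amp a * f (u - a)) (fun u => (amp a * M) / L (u - a) ^+ q.+2).
Proof.
move=> df; apply: C2_bounded_le (C2_boundedZ (amp a) (decays_shift a df)) => u.
rewrite (gtr0_norm (warp_amp_gt0 hW a)) mulrA ler_wpM2l //.
  by rewrite mulr_ge0 ?(ltW (warp_amp_gt0 hW a)) // (decays_ge0 hL df).
exact: ler_pow2.
Qed.

(** Each part of the integral is a combination of two real waves, in phase and in
    quadrature. *)
Lemma complex_wave (P : R -> R[i]) (H1 H2 : R -> R) (B b tau : R) :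
  C2_bounded H1 (fun u => B / L (u - b) ^+ q.+2) ->
  C2_bounded H2 (fun u => B / L (u - b) ^+ q.+2) ->
  (forall s, D s -> P s = Complex (H1 (F s)) (H2 (F s)) * cis2pi (tau * s)) ->
  (forall s, ~ D s -> P s = 0) ->
  cintegrable P /\
  cnorm1 (Cintegral P) <= 8 * (1 + D1) * C1 * pi * B * w b / (1 + (w b * tau) ^+ 2).
Proof.
move=> h1 h2 PD P0.
have i phi H (hH : C2_bounded H (fun u => B / L (u - b) ^+ q.+2)) :=
  (@wave_mass _ _ _ _ _ _ _ hW _ _ _ hL hwL H B b hH (2 * pi * tau) phi).1.
have e phi H (hH : C2_bounded H (fun u => B / L (u - b) ^+ q.+2)) :=
  @wave_bound _ _ _ _ _ _ _ hW _ _ _ hL hwL H B b hH tau phi.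
have Pre s : D s -> complex.Re (P s) = H1 (F s) * cos (2 * pi * tau * s + 0)
    - H2 (F s) * cos (2 * pi * tau * s + - (pi / 2)).
  by move=> Ds; rewrite (PD _ Ds) creM /= cosBpihalf addr0 mulrA.
have Pim s : D s -> complex.Im (P s) = H1 (F s) * cos (2 * pi * tau * s + - (pi / 2))
    + H2 (F s) * cos (2 * pi * tau * s + 0).
  by move=> Ds; rewrite (PD _ Ds) cimM /= cosBpihalf addr0 mulrA.
have Pre0 s : ~ D s -> complex.Re (P s) = 0 by move=> /P0 ->.
have Pim0 s : ~ D s -> complex.Im (P s) = 0 by move=> /P0 ->.
have mD := warp_measurable hW.
have i1 := i 0 H1 h1; have i2 := i (- (pi / 2)) H2 h2.
have i3 := i (- (pi / 2)) H1 h1; have i4 := i 0 H2 h2.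
split.
  split.
    by apply: (integrable_supported Pre Pre0); apply: integrable_sub.
  by apply: (integrable_supported Pim Pim0); apply: integrable_add.
rewrite /cnorm1 /Cintegral /= (Rintegral_supported Pre Pre0) (Rintegral_supported Pim Pim0).
rewrite RintegralB // RintegralD //.
apply: le_trans (lerD (ler_normB _ _) (ler_normD _ _)) _.
apply: le_trans (lerD (lerD (e _ _ h1) (e _ _ h2)) (lerD (e _ _ h1) (e _ _ h2))) _.
by rewrite le_eqVlt; apply/orP; left; apply/eqP; ring.
Qed.

Lemma proto_wave x xi : D x ->
  cintegrable (fun s => proto x s * cis2pi (xi * s)) /\
  cnorm1 (Cintegral (fun s => proto x s * cis2pi (xi * s))) <=
    8 * (1 + D1) * C1 * pi * (amp (F x) * M) * w (F x) / (1 + (w (F x) * xi) ^+ 2).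
Proof.
move=> Dx; apply: (complex_wave (shape_bounded (F x) htr) (shape_bounded (F x) hti)).
  move=> s Ds; rewrite proto_on //; congr (_ * _).
  by apply: complex_ext; rewrite ?creM ?cimM /= mul0r ?subr0 ?addr0.
by move=> s Ds; rewrite proto_off // mul0r.
Qed.

(** The Fourier transform of the atom: translating in time is modulating in
    frequency. *)
Definition modulated x xi s := proto x s * cis2pi (- (xi * s)).

Lemma modulated_integrable x xi : D x -> cintegrable (modulated x xi).
Proof.
move=> Dx; have [h _] := proto_wave (- xi) Dx.
by rewrite /modulated; under eq_fun do rewrite -mulNr.
Qed.

Lemma atomE x xi t : atom x xi t = inv_fourier (modulated x xi) t.
Proof.
rewrite /warped_atom /inv_fourier; apply: eq_Cintegral => s.
rewrite /modulated -mulrA -cis2piD; congr (_ * cis2pi _); ring.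
Qed.

(** [wave_bound] for a single window: the atom decays like a Lorentzian in time. *)
Lemma atom_integrable x xi : D x -> cintegrable (atom x xi).
Proof.
move=> Dx.
have -> : atom x xi = inv_fourier (modulated x xi) by apply/funext => t; exact: atomE.
pose K := 8 * (1 + D1) * C1 * pi * (amp (F x) * M).
have wx := wd_w_gt0 hW (F x).
apply: (@cintegrable_dominated _ _ (fun t => K * cauchy (w (F x)) (- (w (F x) * xi)) t)).
- by apply: measurable_inv_fourier; apply: cintegrable_measurable; exact: modulated_integrable.
- move=> t; have [_ h] := proto_wave (t - xi) Dx.
  rewrite (_ : inv_fourier _ t = Cintegral (fun s => proto x s * cis2pi ((t - xi) * s))).
    apply: le_trans h _; rewrite /cauchy.
    rewrite (_ : w (F x) * t + - (w (F x) * xi) = w (F x) * (t - xi)); last by ring.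
    by rewrite -/K -mulrA.
  by rewrite -atomE.
- by apply: integrable_scale => //; exact: cauchy_integrable.
Qed.

Lemma modulated_lipschitz x xi s0 : D x -> D s0 -> clipschitz_at s0 (modulated x xi).
Proof.
move=> Dx Ds0; apply: clipschitz_atM; last exact: clipschitz_at_cis.
have [f1 [f2 [f3 [d1 _ _ b1]]]] := htr; have [g1 [g2 [g3 [e1 _ _ b2]]]] := hti.
have dF0 : is_derive s0 (1 : R) (fun s => F s - F x) (w (F s0))^-1.
  have h := is_derive_add (wd_dF hW Ds0) (is_derive_cst (- F x) s0 (1 : R)).
  by apply: (is_derive_eq h); rewrite addr0.
apply: (@clipschitz_at_local _ D s0 (proto x)
   (fun s => amp (F x) * tr (F s - F x)) (fun s => amp (F x) * ti (F s - F x)) _ _ (amp (F x) * (2 * M))).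
- exact: (wd_open hW).
- by [].
- move=> s Ds; rewrite proto_on //.
  by rewrite creM cimM /= !mul0r subr0 addr0.
- exact: is_derive_scale (@is_derive_compose _ tr (fun s => F s - F x) s0 _ _ (d1 _) dF0).
- exact: is_derive_scale (@is_derive_compose _ ti (fun s => F s - F x) s0 _ _ (e1 _) dF0).
- by move=> s; exact: proto_le.
Qed.

Lemma atom_fourier x xi s : D x -> D s ->
  Cintegral (fun t => atom x xi t * cis2pi (- (t * s))) = modulated x xi s.
Proof.
move=> Dx Ds; have [K [M' [hK hM]]] := modulated_lipschitz xi Dx Ds.
have -> : atom x xi = inv_fourier (modulated x xi) by apply/funext => t; exact: atomE.
apply: (@fourier_inversion _ _ _ K (M' + M')) => //.
- exact: modulated_integrable.
- have <- : atom x xi = inv_fourier (modulated x xi) by apply/funext => t; exact: atomE.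
  exact: atom_integrable.
- by move=> t; apply: le_trans (cnorm1D _ _) _; rewrite cnorm1N lerD.
Qed.

(** [fourier_duality] moves the transform onto the difference of atoms, where
    inversion recovers the windows at every point of [D]. *)
Lemma atom_inner x y z xi om eta (g : R[i]) : D x -> D y -> D z ->
  inner (atom x xi) (fun t => atom y om t - g * atom z eta t) =
  Cintegral (fun s => modulated x xi s * (modulated y om s - g * modulated z eta s)^*%C).
Proof.
move=> Dx Dy Dz.
have -> : atom x xi = inv_fourier (modulated x xi) by apply/funext => t; exact: atomE.
have iy := atom_integrable om Dy; have iz := atom_integrable eta Dz.
have igz := cintegrableZ g iz.
rewrite fourier_duality; [|exact: modulated_integrable|exact: cintegrableB].
apply: eq_Cintegral => s.
have [Ds|Ds] := pselect (D s); last by rewrite /modulated proto_off // !mul0r.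
congr (_ * _^*%C).
have mcis : measurable_fun setT (fun t : R => - (t * s)).
  by apply: measurable_funN; exact: measurable_funM.
rewrite -(atom_fourier om Dy Ds) -(atom_fourier eta Dz Ds).
rewrite -CintegralZ; last exact: cintegrable_Mcis.
rewrite -CintegralB; last 2 first.
- exact: cintegrable_Mcis.
- by apply: cintegrableZ; exact: cintegrable_Mcis.
by apply: eq_Cintegral => t; rewrite mulrBl mulrA.
Qed.

End warped_atoms.

(** * Pointwise bound on the oscillation entries *)

Section conjugation.
Context {R : realType}.
Implicit Types z : R[i].

Lemma conjc_mul z1 z2 : (z1 * z2)^*%C = z1^*%C * z2^*%C.
Proof.
by apply: complex_ext; rewrite ?cre_conj ?cim_conj ?creM ?cimM ?cre_conj ?cim_conj; ring.
Qed.

Lemma conjc_sub z1 z2 : (z1 - z2)^*%C = z1^*%C - z2^*%C.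
Proof.
by apply: complex_ext; rewrite ?creB ?cimB ?cre_conj ?cim_conj ?creB ?cimB; ring.
Qed.

Lemma conjc_realC (x : R) : ((x%:C)^*)%C = (x%:C)%C.
Proof. by apply: complex_ext; rewrite ?cre_conj ?cim_conj /= ?oppr0. Qed.

End conjugation.

Section kernel.
Context {R : realType}.
Notation mu := (@lebesgue_measure R).
Variables (D : set R) (F G w w1 : R -> R) (D1 : R).
Hypothesis hW : warp_data D F G w w1 D1.
Variables (L : R -> R) (C1 : R) (q : nat).
Hypothesis hL : gauge L.
Hypothesis hwL : forall s t, w (s + t) <= C1 * L s ^+ q * w t.
Variables (M : R) (theta : R -> R[i]).
Let N2 := q.*2.+2.
Let N1 := (N2 + q.+2)%N.
Let N := (N1 + q.*2.+1)%N.
Local Notation tr := (fun t => complex.Re (theta t)).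
Local Notation ti := (fun t => complex.Im (theta t)).
Hypotheses (htr : decays L N M tr) (hti : decays L N M ti).
Local Notation amp := (warp_amp w).
Local Notation atom := (warped_atom D F theta).
Local Notation cmod := (modulated D F theta).

Definition osc_entry x y xi om z eta : R[i] :=
  inner (atom x xi) (fun t => atom y om t - phase y z om eta * atom z eta t).

Lemma window_order_ge : (q.+2 <= N)%N.
Proof. by rewrite /N /N1 -addnA addnCA leq_addr. Qed.

Lemma osc_entryE x y xi om z eta : D x -> D y -> D z ->
  osc_entry x y xi om z eta = Cintegral (fun s => cmod x xi s *
    (cmod y om s - phase y z om eta * cmod z eta s)^*%C).
Proof. by move=> *; apply: (atom_inner hW hL hwL window_order_ge htr hti). Qed.

Variables (C2 Delta : R).
Hypothesis C20 : 0 <= C2.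

Notation kappa om eta := (2 * pi * (eta - om)).

(** [Gamma] cancels the phase [(eta - om) * y], so that the relative phase of the
    two windows vanishes at [s = y]. *)
Lemma modulated_product x y z xi om eta s : D x -> D y -> D z -> D s ->
  let a := F x in let b := F y in let c := F z in let u := F s in
  let Xr := atom_difference G w tr ti b c (kappa om eta) u in
  let Xi := - atom_difference G w ti (fun t => - tr t) b c (kappa om eta) u in
  cmod x xi s * (cmod y om s - phase y z om eta * cmod z eta s)^*%C =
  Complex (amp a * (tr (u - a) * Xr + - ti (u - a) * Xi))
          (amp a * (ti (u - a) * Xr + tr (u - a) * Xi)) * cis2pi ((om - xi) * s).
Proof.
move=> Dx Dy Dz Ds a b c u Xr Xi.
have conjE : (cmod y om s - phase y z om eta * cmod z eta s)^*%C * cis2pi (- (xi * s)) =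
    ((amp b)%:C%C * (theta (u - b))^*%C - cis2pi ((eta - om) * (s - y)) * ((amp c)%:C%C * (theta (u - c))^*%C))
    * cis2pi ((om - xi) * s).
  have E1 : cis2pi (om * s) * cis2pi (- (xi * s)) = cis2pi ((om - xi) * s).
    by rewrite -cis2piD; congr cis2pi; ring.
  have E2 : cis2pi (- ((eta - om) * y)) * cis2pi (eta * s) * cis2pi (- (xi * s)) =
      cis2pi ((eta - om) * (s - y)) * cis2pi ((om - xi) * s).
    by rewrite -!cis2piD; congr cis2pi; ring.
  rewrite /modulated !(proto_on hW) // -/a -/b -/c -/u.
  rewrite conjc_sub !conjc_mul !conjc_realC !conj_cis2pi !opprK.
  move: (theta _)^*%C (theta _)^*%C ((amp b)%:C)%C ((amp c)%:C)%C => tc tb B C.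
  transitivity (B * tb * (cis2pi (om * s) * cis2pi (- (xi * s))) -
    (cis2pi (- ((eta - om) * y)) * cis2pi (eta * s) * cis2pi (- (xi * s))) * (C * tc)).
    by ring.
  by rewrite E1 E2; ring.
rewrite [cmod x xi s]/modulated -mulrA (mulrC (cis2pi _)) conjE mulrA; congr (_ * _).
rewrite (proto_on hW) // -/a -/u /Xr /Xi /atom_difference /warp_phase.
rewrite /u /b !(wd_GF hW) // -/u -/b.
have e : kappa om eta * (s - y) = 2 * pi * ((eta - om) * (s - y)) by rewrite !mulrA.
rewrite e; apply: complex_ext.
  rewrite !(creM, cimM, creB, cimB, cre_conj, cim_conj) /=.
  move: (cos _) (sin _) => co si.
  by ring.
rewrite !(creM, cimM, creB, cimB, cre_conj, cim_conj) /=.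
move: (cos _) (sin _) => co si.
by ring.
Qed.

Definition osc_entry_const : R :=
  8 * (1 + D1) * C1 * pi * (8 * M * atom_const D1 L C1 q N1 M C2 Delta) * C1.

Definition kernel_majorant (b om xi : R) := w b / (1 + (w b * (om - xi)) ^+ 2).

(** With [N2 = 2 q + 2]: [q] powers pay for the weight [m], [q] for comparing the
    amplitudes, and two are left for the quadratic decay. *)
Lemma amp_product_le a b :
  amp a * amp b / L (a - b) ^+ N2 * L (a - b) ^+ q <= C1 * ((w b)^-1 / (1 + (a - b) ^+ 2)).
Proof.
have g0 n : 0 < L (a - b) ^+ n by exact: gauge_expr_gt0.
have ab := warp_amp_gt0 hW b; have wb := wd_w_gt0 hW b.
have h : amp a <= C1 * L (a - b) ^+ q * amp b.
  rewrite -(gauge_norm hL (a - b)); apply: (warp_amp_le hW hL hwL); by rewrite distrC.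
have s2 := gauge_sqr_ge hL (a - b).
have N2E : L (a - b) ^+ N2 = L (a - b) ^+ q * L (a - b) ^+ q * L (a - b) ^+ 2.
  by rewrite -!exprD /N2 addnn addn2.
rewrite N2E.
rewrite [leLHS](_ : _ = amp a * (amp b / (L (a - b) ^+ q * L (a - b) ^+ 2))); last first.
  by field; rewrite !gt_eqF // (gauge_gt0 hL).
apply: (@le_trans _ _ (C1 * L (a - b) ^+ q * amp b * (amp b / (L (a - b) ^+ q * L (a - b) ^+ 2)))).
  by rewrite ler_wpM2r //; apply: divr_ge0; [exact: ltW | apply: mulr_ge0; exact: ltW].
rewrite [leLHS](_ : _ = C1 * (amp b ^+ 2 / L (a - b) ^+ 2)); last first.
  by field; rewrite !gt_eqF // (gauge_gt0 hL).
rewrite (warp_amp_sqr hW) ler_wpM2l ?(ltW (wL_C1_gt0 hW hL hwL)) //.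
by rewrite ler_wpM2l ?invr_ge0 ?(ltW wb) // lef_pV2 ?posrE ?onesqr_gt0.
Qed.

Lemma amp_product_le_sym a b :
  amp a * amp b / L (a - b) ^+ N2 * L (a - b) ^+ q <= C1 * ((w a)^-1 / (1 + (b - a) ^+ 2)).
Proof.
have := amp_product_le b a.
by rewrite (mulrC (amp b)) -(gaugeN hL (b - a)) opprB.
Qed.

(** The two bounds differ in the variable that is integrated over [D] against the
    pulled-back Cauchy density: [y] for the first marginal, [x] for the second. The
    factor [L (F x - F y) ^+ q] makes room for the weight [m]. *)
Lemma osc_entry_bound delta x y z xi om eta : D x -> D y -> D z ->
  0 <= delta <= Delta -> `|F y - F z| <= delta ->
  `|kappa om eta| <= delta * C2 / w (F y) ->
  Normc.normc (osc_entry x y xi om z eta) * L (F x - F y) ^+ q <=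
    delta * osc_entry_const * kernel_majorant (F y) om xi * warp_cauchy F w (F x) y /\
  Normc.normc (osc_entry x y xi om z eta) * L (F x - F y) ^+ q <=
    delta * osc_entry_const * kernel_majorant (F y) om xi * warp_cauchy F w (F y) x.
Proof.
move=> Dx Dy Dz hd bc hk; have /andP[d0 dD] := hd.
set a := F x; set b := F y; set c := F z.
pose AC := atom_const D1 L C1 q N1 M C2 Delta.
have M0 := decays_ge0 hL htr.
have a0 := ltW (warp_amp_gt0 hW a); have b0 := ltW (warp_amp_gt0 hW b).
have hXr := atom_difference_bounded hW hL hwL C20 htr hti hd bc hk.
have hXi := C2_boundedN (atom_difference_bounded hW hL hwL C20 hti (decaysN htr) hd bc hk).
have AC0 : 0 <= AC.
  have C10 := ltW (wL_C1_gt0 hW hL hwL); have D10 := D1_ge0 hW.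
  have L0 n : 0 <= L Delta ^+ n by rewrite ltW // (gauge_expr_gt0 hL).
  have p0 := phase_const_ge0 hW hL hwL C20 hd.
  apply: mulr_ge0; first exact: mulr_ge0.
  apply: addr_ge0; first by apply: addr_ge0; exact: mulr_ge0.
  by apply: mulr_ge0 => //; apply: mulr_ge0 => //; exact: mulr_ge0.
have B0 : 0 <= delta * AC * amp b by apply: mulr_ge0 => //; exact: mulr_ge0.
have h1 := atom_product_bounded hL a (erefl N1) a0 B0 htr (decaysN hti) hXr hXi.
have h2 := atom_product_bounded hL a (erefl N1) a0 B0 hti htr hXr hXi.
have C10 := ltW (wL_C1_gt0 hW hL hwL); have D10 := D1_ge0 hW.
have Lq : 0 <= L (a - b) ^+ q by rewrite ltW // (gauge_expr_gt0 hL).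
have wb := wd_w_gt0 hW b.
have km0 : 0 <= kernel_majorant b om xi.
  by rewrite divr_ge0 ?(ltW wb) // ltW // onesqr_gt0.
have main : Normc.normc (osc_entry x y xi om z eta) * L (a - b) ^+ q <=
    delta * (8 * (1 + D1) * C1 * pi * (8 * M * AC)) * kernel_majorant b om xi *
    (amp a * amp b / L (a - b) ^+ N2 * L (a - b) ^+ q).
  pose P s := cmod x xi s * (cmod y om s - phase y z om eta * cmod z eta s)^*%C.
  have P0 s : ~ D s -> P s = 0.
    by move=> Ds; rewrite /P /modulated (proto_off _ _ _ Ds) !mul0r.
  have PD := fun s (Ds : D s) => @modulated_product x y z xi om eta s Dx Dy Dz Ds.
  have [_ hP] := complex_wave hW hL hwL h1 h2 PD P0.
  rewrite osc_entryE //; apply: (@le_trans _ _ (cnorm1 (Cintegral P) * L (a - b) ^+ q)).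
    by rewrite ler_wpM2r // normc_le_cnorm1.
  apply: le_trans (ler_wpM2r Lq hP) _.
  by rewrite le_eqVlt; apply/orP; left; apply/eqP; rewrite -/AC /kernel_majorant; ring.
have K0 : 0 <= delta * (8 * (1 + D1) * C1 * pi * (8 * M * AC)) * kernel_majorant b om xi.
  apply: mulr_ge0 => //; apply: mulr_ge0 => //; apply: mulr_ge0.
    apply: mulr_ge0; last exact: pi_ge0.
    by apply: mulr_ge0 => //; apply: mulr_ge0 => //; exact: addr_ge0.
  by apply: mulr_ge0 => //; exact: mulr_ge0.
split; apply: le_trans main _.
  rewrite [leRHS](_ : _ = delta * (8 * (1 + D1) * C1 * pi * (8 * M * AC)) * kernel_majorant b om xi *
    (C1 * warp_cauchy F w a y)); last by rewrite /osc_entry_const -/AC; ring.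
  rewrite ler_wpM2l // /warp_cauchy -/b.
  rewrite (_ : (b - a) ^+ 2 = (a - b) ^+ 2); last by ring.
  exact: amp_product_le.
rewrite [leRHS](_ : _ = delta * (8 * (1 + D1) * C1 * pi * (8 * M * AC)) * kernel_majorant b om xi *
    (C1 * warp_cauchy F w b x)); last by rewrite /osc_entry_const -/AC; ring.
rewrite ler_wpM2l // /warp_cauchy -/a.
rewrite (_ : (a - b) ^+ 2 = (b - a) ^+ 2); last by ring.
exact: amp_product_le_sym.
Qed.

End kernel.

(** * Geometry of the cover *)

Section cover.
Context {R : realType}.
Notation mu := (@lebesgue_measure R).
Variables (D : set R) (F w w1 : R -> R) (D1 : R).
Let G := warp_inv D F.
Hypothesis hW : warp_data D F G w w1 D1.
Variables (L : R -> R) (C1 : R) (q : nat).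
Hypothesis hL : gauge L.
Hypothesis hwL : forall s t, w (s + t) <= C1 * L s ^+ q * w t.

Lemma warp_F_le s t : D s -> D t -> (F s <= F t) = (s <= t).
Proof.
by move=> Ds Dt; rewrite -[in RHS](wd_GF hW Ds) -[in RHS](wd_GF hW Dt) (warp_G_le hW).
Qed.

Lemma warp_itvP delta l y : 0 < delta -> warp_itv D F delta l y ->
  D y /\ delta * l%:~R <= F y <= delta * l%:~R + delta.
Proof.
move=> d0; rewrite /warp_itv /= in_itv /= => /andP[a1 a2].
have GD := wd_GD hW.
have Dy : D y by apply: (wd_convex hW (GD (delta * l%:~R)) (GD (delta * (l + 1)%:~R))); apply/andP.
split => //; rewrite -(warp_F_le (GD _) Dy) (wd_FG hW) in a1.
by rewrite -(warp_F_le Dy (GD _)) (wd_FG hW) intrD mulrDr mulr1 in a2; rewrite a1 a2.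
Qed.

Lemma warp_itv_length_gt0 delta l : 0 < delta -> 0 < warp_itv_length D F delta l.
Proof.
move=> d0; rewrite subr_gt0; apply: (wd_G_lt hW).
by rewrite ltr_pM2l // ltr_int ltrDl.
Qed.

(** The mean value theorem for [G], with [w] moderate. *)
Lemma warp_itv_length_ge delta Delta l b : 0 < delta <= Delta ->
  delta * l%:~R <= b <= delta * l%:~R + delta ->
  delta * w b / (C1 * L Delta ^+ q) <= warp_itv_length D F delta l.
Proof.
move=> /andP[d0 dD] /andP[b1 b2].
have E0 : 0 < C1 * L Delta ^+ q by exact: lt_le_trans (wL_factor_ge1 hW hL hwL Delta).
have w0 := wd_w_gt0 hW.
have e : delta * (l + 1)%:~R = delta * l%:~R + delta by rewrite intrD mulrDr mulr1.
rewrite /warp_itv_length e.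
have cG : continuous G by move=> u; apply: is_derive_continuous; exact: (wd_dG hW).
have le1 : delta * l%:~R <= delta * l%:~R + delta by rewrite lerDl ltW.
have [c /andP[c1 c2] ->] := MVT_segment le1 (fun u _ => wd_dG hW u) (continuous_subspaceT cG).
rewrite addrAC subrr add0r (mulrC (w c)) -mulrA ler_pM2l // ler_pdivrMr // mulrC.
apply: le_trans (w_ge hL hwL c b) _; rewrite ler_pM2r // ler_pM2l ?(wL_C1_gt0 hW hL hwL) //.
apply: lerXn2r; rewrite ?nnegrE ?(ltW (gauge_gt0 hL _)) //.
apply: (gauge_mono hL); apply: le_trans (ler_norm Delta); apply: le_trans dD.
by rewrite ler_norml; move: c1 c2; rewrite !bnd_simp => c1 c2; apply/andP; split; lra.
Qed.

(** [(z, eta)] shares a cell with [(y, om)]; its frequency height is [delta ^+ 2]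
    over its length, and [warp_itv_length_ge] bounds the length from below. *)
Lemma cover_nbhdP delta Delta y om z eta : 0 < delta <= Delta ->
  cover_nbhd D F delta y om (z, eta) ->
  [/\ D y, D z, `|F y - F z| <= delta &
   `|2 * pi * (eta - om)| <= delta * (2 * pi * (C1 * L Delta ^+ q)) / w (F y)].
Proof.
move=> hd [l [k [[/= hy hom] [/= hz heta]]]]; have /andP[d0 dD] := hd.
have [Dy Fy] := warp_itvP d0 hy; have [Dz Fz] := warp_itvP d0 hz.
have w0 := wd_w_gt0 hW (F y).
have E0 : 0 < C1 * L Delta ^+ q by exact: lt_le_trans (wL_factor_ge1 hW hL hwL Delta).
split => //.
  by move: Fy Fz => /andP[a1 a2] /andP[b1 b2]; rewrite ler_norml; apply/andP; split; lra.
have len := warp_itv_length_ge hd Fy; have len0 := warp_itv_length_gt0 l d0.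
rewrite normrM (gtr0_norm (x := 2 * pi)) ?mulr_gt0 ?pi_gt0 //.
rewrite [leRHS](_ : _ = 2 * pi * (delta * (C1 * L Delta ^+ q) / w (F y))); last by ring.
rewrite ler_pM2l ?mulr_gt0 ?pi_gt0 //.
have gap : `|eta - om| <= delta ^+ 2 / warp_itv_length D F delta l.
  move: hom heta; rewrite !in_itv /= intrD mulrDr mulr1 mulrDl => /andP[a1 a2] /andP[b1 b2].
  by rewrite ler_norml; apply/andP; split; lra.
apply: le_trans gap _; rewrite ler_pdivrMr // mulrAC ler_pdivlMr //.
move: len; rewrite ler_pdivrMr // => len.
rewrite [leRHS](_ : _ = delta * (warp_itv_length D F delta l * (C1 * L Delta ^+ q))); last by ring.
by rewrite expr2 -mulrA ler_pM2l.
Qed.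

(** The cells cover [D `*` setT]: round [F y / delta] and the rescaled [om] down. *)
Lemma cover_nbhd_refl delta y om : 0 < delta -> D y -> cover_nbhd D F delta y om (y, om).
Proof.
move=> d0 Dy; pose l := Num.floor (F y / delta).
have len0 := warp_itv_length_gt0 l d0.
pose k := Num.floor (om * warp_itv_length D F delta l / delta ^+ 2).
suff h : warp_cover D F delta l k (y, om) by exists l, k.
have d2 : 0 < delta ^+ 2 by rewrite exprn_gt0.
have /andP[l1 l2] := floor_itv (F y / delta).
have /andP[k1 k2] := floor_itv (om * warp_itv_length D F delta l / delta ^+ 2).
split; rewrite /= ?/warp_itv /= in_itv /=.
  have GD := wd_GD hW.
  rewrite -!(warp_F_le (GD _) Dy) -!(warp_F_le Dy (GD _)) !(wd_FG hW).
  rewrite mulrC -ler_pdivlMr // l1 /=.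
  by rewrite mulrC -ler_pdivrMr // ltW.
rewrite ler_pdivrMr // mulrC -ler_pdivlMr // k1 /=.
by rewrite ler_pdivlMr // -ler_pdivrMl // mulrC ltW.
Qed.

End cover.

(** * Norm of the oscillation *)

Section norm_bound.
Context {R : realType}.
Notation mu := (@lebesgue_measure R).
Variables (D : set R) (F w w1 : R -> R) (D1 : R).
Let G := warp_inv D F.
Hypothesis hW : warp_data D F G w w1 D1.
Variables (L : R -> R) (C1 : R) (q : nat).
Hypothesis hL : gauge L.
Hypothesis hwL : forall s t, w (s + t) <= C1 * L s ^+ q * w t.
Variables (M : R) (theta : R -> R[i]).
Let N := (q.*2.+2 + q.+2 + q.*2.+1)%N.
Hypotheses (htr : decays L N M (fun t => complex.Re (theta t)))
  (hti : decays L N M (fun t => complex.Im (theta t))).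
Variables (m1 : R -> R) (Cm : R).
Hypothesis m1_gt0 : forall x, D x -> 0 < m1 x.
Hypothesis hm : forall x y, D x -> D y -> m1 x / m1 y <= Cm * L (F x - F y) ^+ q.

Let A := (L2norm_sq theta)^-1.

Lemma weight_kernel_le x y xi om : D x -> D y ->
  0 <= weight_kernel m1 x y xi om <= Cm * L (F x - F y) ^+ q.
Proof.
move=> Dx Dy; apply/andP; split.
  by rewrite le_max divr_ge0 // ltW // m1_gt0.
rewrite ge_max hm //= -(gaugeN hL) opprB; exact: hm.
Qed.

Lemma normc_ge0 (z : R[i]) : 0 <= Normc.normc z.
Proof. by case: z => a b; exact: sqrtr_ge0. Qed.

Lemma L2norm_sq_ge0 : 0 <= L2norm_sq theta.
Proof. by apply: Rintegral_ge0 => x _; rewrite exprn_ge0 // normc_ge0. Qed.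

Definition osc_const (Delta : R) : R :=
  A * osc_entry_const D1 L C1 q M (2 * pi * (C1 * L Delta ^+ q)) Delta * Cm.

Notation osc delta := (oscillation D F delta phase theta).
Notation m := (weight_kernel m1).

Let E_ge0 Delta : 0 <= 2 * pi * (C1 * L Delta ^+ q).
Proof.
apply: mulr_ge0; first by rewrite mulr_ge0 ?pi_ge0.
exact: le_trans ler01 (wL_factor_ge1 hW hL hwL Delta).
Qed.

(** The lower bound uses [cover_nbhd_refl]: over an empty set the supremum would be
    [-oo]. *)
Lemma oscillation_bounds delta x y xi om (B : R) : 0 < delta -> D y ->
  (forall z eta, cover_nbhd D F delta y om (z, eta) ->
     Normc.normc (osc_entry D F theta x y xi om z eta) <= B) ->
  (0 <= osc delta x y xi om <= (A * B)%:E)%E.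
Proof.
move=> d0 Dy hB.
have A0 : 0 <= A by rewrite invr_ge0 L2norm_sq_ge0.
rewrite /oscillation -/A; apply/andP; split.
  apply: mule_ge0; first by rewrite lee_fin.
  apply: ereal_sup_ge; exists (Normc.normc (osc_entry D F theta x y xi om y om))%:E.
    by exists (y, om) => //; exact: (cover_nbhd_refl hW).
  by rewrite lee_fin normc_ge0.
rewrite EFinM lee_wpmul2l ?lee_fin //.
apply: ge_ereal_sup => _ [[z eta] hq <-]; rewrite lee_fin; exact: hB.
Qed.

Lemma oscillation_kernel_le delta Delta x y xi om : 0 < delta <= Delta -> D x -> D y ->
  let K := delta * osc_const Delta * kernel_majorant w (F y) om xi in
  (`|osc delta x y xi om * (m x y xi om)%:E| <= (K * warp_cauchy F w (F x) y)%:E)%E /\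
  (`|osc delta x y xi om * (m x y xi om)%:E| <= (K * warp_cauchy F w (F y) x)%:E)%E.
Proof.
move=> hd Dx Dy K; have /andP[d0 dD] := hd.
have hd' : 0 <= delta <= Delta by rewrite ltW.
have Lq : 0 < L (F x - F y) ^+ q by exact: gauge_expr_gt0.
have A0 : 0 <= A by rewrite invr_ge0 L2norm_sq_ge0.
pose T := delta * osc_entry_const D1 L C1 q M (2 * pi * (C1 * L Delta ^+ q)) Delta *
  kernel_majorant w (F y) om xi.
have ent z eta : cover_nbhd D F delta y om (z, eta) ->
    Normc.normc (osc_entry D F theta x y xi om z eta) * L (F x - F y) ^+ q <= T * warp_cauchy F w (F x) y /\
    Normc.normc (osc_entry D F theta x y xi om z eta) * L (F x - F y) ^+ q <= T * warp_cauchy F w (F y) x.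
  move=> /(cover_nbhdP hW hL hwL hd)[_ Dz h1 h2].
  exact: (osc_entry_bound hW hL hwL htr hti (E_ge0 Delta)).
have /andP[m0 mle] := weight_kernel_le xi om Dx Dy.
have main c : (forall z eta, cover_nbhd D F delta y om (z, eta) ->
    Normc.normc (osc_entry D F theta x y xi om z eta) * L (F x - F y) ^+ q <= T * c) ->
    (`|osc delta x y xi om * (m x y xi om)%:E| <= (K * c)%:E)%E.
  move=> hc.
  have /andP[ge0 ole] : (0 <= osc delta x y xi om <= (A * (T * c / L (F x - F y) ^+ q))%:E)%E.
    by apply: oscillation_bounds => // z eta hz; rewrite ler_pdivlMr // hc.
  rewrite gee0_abs; last by rewrite mule_ge0 // lee_fin.
  have Tc : 0 <= T * c.
    by apply: le_trans (hc _ _ (cover_nbhd_refl hW om d0 Dy)); rewrite mulr_ge0 ?normc_ge0 // ltW.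
  apply: (@le_trans _ _ ((A * (T * c / L (F x - F y) ^+ q))%:E * (Cm * L (F x - F y) ^+ q)%:E)%E).
    by apply: lee_pmul => //; rewrite lee_fin.
  rewrite -EFinM lee_fin le_eqVlt; apply/orP; left; apply/eqP.
  by rewrite /K /T /osc_const -/A; field; rewrite gt_eqF // (gauge_gt0 hL).
by split; apply: main => z eta /ent[].
Qed.

(** Read off from [oscillation_kernel_le] at one point, where the other factors
    are positive. *)
Lemma osc_const_ge0 delta Delta : 0 < delta <= Delta -> 0 <= osc_const Delta.
Proof.
move=> hd; have /andP[d0 dD] := hd.
have D0 := wd_GD hW 0.
have [h _] := oscillation_kernel_le 0 0 hd D0 D0.
have := le_trans (abse_ge0 _) h; rewrite lee_fin.
have c0 : 0 < warp_cauchy F w (F (G 0)) (G 0).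
  by rewrite divr_gt0 ?invr_gt0 ?(wd_w_gt0 hW) // onesqr_gt0.
have k0 : 0 < kernel_majorant w (F (G 0)) 0 0.
  by rewrite divr_gt0 ?(wd_w_gt0 hW) // onesqr_gt0.
by rewrite pmulr_lge0 // pmulr_lge0 // pmulr_rge0.
Qed.

Local Open Scope ereal_scope.

Let le_pi c (f : R -> R) (E : set R) : measurable E -> (0 <= c)%R ->
  measurable_fun E f -> (forall x, E x -> 0 <= f x)%R ->
  \int[mu]_(x in E) (f x)%:E <= pi%:E -> \int[mu]_(x in E) (c * f x)%:E <= (c * pi)%:E.
Proof.
move=> mE c0 mf f0 h; under eq_integral do rewrite EFinM.
rewrite ge0_integralZl //.
- by rewrite EFinM lee_wpmul2l // lee_fin.
- exact/measurable_EFinP.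
Qed.

(** The Lorentzian has mass [pi] in [om] and in [xi] alike, and the pulled-back
    Cauchy density has mass at most [pi] over [D]; this holds at every point, not
    just almost everywhere. *)
Lemma oscillation_norm_le delta Delta : (0 < delta <= Delta)%R ->
  Am_norm D m (osc delta) <= (delta * osc_const Delta * pi ^+ 2)%:E.
Proof.
move=> hd; have /andP[d0 dD] := hd.
have K0 := osc_const_ge0 hd; have c0 : (0 <= delta * osc_const Delta)%R by rewrite mulr_ge0 // ltW.
have mD := warp_measurable hW.
have wc0 b s := warp_cauchy_ge0 hW b s.
have mwc b : measurable_fun D (warp_cauchy F w b).
  by apply/measurable_EFinP; have /(measurable_int mu) := warp_cauchy_integrable hW b.
have km1 b om xi : kernel_majorant w b om xi = cauchy (w b) (- (w b * xi)) om.
  by rewrite /kernel_majorant /cauchy mulrBr.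
have km2 b om xi : kernel_majorant w b om xi = cauchy (w b) (- (w b * om)) xi.
  rewrite /kernel_majorant /cauchy; congr (_ / (_ + _))%R.
  by rewrite -sqrrN; congr (_ ^+ 2)%R; ring.
have ic b p : \int[mu]_s (cauchy (w b) p s)%:E <= pi%:E.
  by apply: cauchy_integral; exact: (wd_w_gt0 hW).
have mc b p : measurable_fun setT (cauchy (w b) p).
  by apply/measurable_EFinP; have /(measurable_int mu) := cauchy_integrable p (wd_w_gt0 hW b).
have cp0 b p s : (0 <= cauchy (w b) p s)%R by apply: cauchy_ge0; exact: (wd_w_gt0 hW).
have cpi : (0 <= delta * osc_const Delta * pi)%R by rewrite mulr_ge0 // pi_ge0.
have c2 : (0 <= delta * osc_const Delta * pi ^+ 2)%R by rewrite mulr_ge0 ?sqr_ge0.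
rewrite /Am_norm /A1_norm ge_max; apply/andP; split; apply/ess_supP; apply: aeW => -[u v];
  rewrite /patch; case: ifPn => [/set_mem[/= Du _]|_]; rewrite ?lee_fin //=.
- apply: (@le_trans _ _ (\int[mu]_(y in D) (delta * osc_const Delta * pi * warp_cauchy F w (F u) y)%:E)).
    apply: ge0_le_integral_nomeas => [y Dy|y Dy]; first exact: integral_ge0.
    apply: (@le_trans _ _ (\int[mu]_om (delta * osc_const Delta * warp_cauchy F w (F u) y * kernel_majorant w (F y) om v)%:E)).
      apply: ge0_le_integral_nomeas => // om _.
      have [h _] := oscillation_kernel_le v om hd Du Dy.
      by rewrite mulrAC.
    rewrite [X in _ <= X%:E]mulrAC; under eq_integral do rewrite km1.
    apply: le_pi => //.
    by rewrite mulr_ge0.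
  rewrite [X in _ <= X%:E](_ : _ = delta * osc_const Delta * pi * pi)%R; last by rewrite expr2 mulrA.
  apply: le_pi => //.
  exact: (warp_cauchy_integral hW).
- apply: (@le_trans _ _ (\int[mu]_(x in D) (delta * osc_const Delta * pi * warp_cauchy F w (F u) x)%:E)).
    apply: ge0_le_integral_nomeas => [x Dx|x Dx]; first exact: integral_ge0.
    apply: (@le_trans _ _ (\int[mu]_xi (delta * osc_const Delta * warp_cauchy F w (F u) x * kernel_majorant w (F u) v xi)%:E)).
      apply: ge0_le_integral_nomeas => // xi _.
      have [_ h] := oscillation_kernel_le xi v hd Dx Du.
      by rewrite mulrAC.
    rewrite [X in _ <= X%:E]mulrAC; under eq_integral do rewrite km2.
    apply: le_pi => //.
    by rewrite mulr_ge0.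
  rewrite [X in _ <= X%:E](_ : _ = delta * osc_const Delta * pi * pi)%R; last by rewrite expr2 mulrA.
  apply: le_pi => //.
  exact: (warp_cauchy_integral hW).
Qed.

End norm_bound.

(** * Continuity of the oscillation entries *)

Section complex_limits.
Context {R : realType}.
Implicit Types (u v : nat -> R[i]) (a b : R[i]).

Definition ccvg u a :=
  (complex.Re (u n) @[n --> \oo] --> complex.Re a) /\
  (complex.Im (u n) @[n --> \oo] --> complex.Im a).

Lemma ccvg_cst a : ccvg (fun=> a) a.
Proof. by split; exact: cvg_cst. Qed.

Lemma ccvgM u v a b : ccvg u a -> ccvg v b -> ccvg (fun n => u n * v n) (a * b).
Proof.
move=> [u1 u2] [v1 v2]; split; rewrite ?creM ?cimM.
  by under eq_fun do rewrite creM; apply: cvgB; apply: cvgM.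
by under eq_fun do rewrite cimM; apply: cvgD; apply: cvgM.
Qed.

Lemma ccvgB u v a b : ccvg u a -> ccvg v b -> ccvg (fun n => u n - v n) (a - b).
Proof.
move=> [u1 u2] [v1 v2]; split; rewrite ?creB ?cimB.
  by under eq_fun do rewrite creB; apply: cvgB.
by under eq_fun do rewrite cimB; apply: cvgB.
Qed.

Lemma ccvg_conj u a : ccvg u a -> ccvg (fun n => (u n)^*%C) a^*%C.
Proof.
move=> [u1 u2]; split; rewrite ?cre_conj ?cim_conj.
  by under eq_fun do rewrite cre_conj.
by under eq_fun do rewrite cim_conj; apply: cvgN.
Qed.

Lemma ccvg_real (h : nat -> R) (l : R) : h n @[n --> \oo] --> l ->
  ccvg (fun n => (h n)%:C%C) (l%:C)%C.
Proof. by move=> hl; split => //=; exact: cvg_cst. Qed.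

Lemma ccvg_cis (h : nat -> R) (l : R) : h n @[n --> \oo] --> l ->
  ccvg (fun n => cis2pi (h n)) (cis2pi l).
Proof.
move=> hl; have hl' : 2 * pi * h n @[n --> \oo] --> 2 * pi * l by apply: cvgMr.
split => /=; first by apply: (cvg_comp _ _ hl'); exact: continuous_cos.
by apply: (cvg_comp _ _ hl'); exact: continuous_sin.
Qed.

Lemma ccvg_normc u a : ccvg u a -> Normc.normc (u n) @[n --> \oo] --> Normc.normc a.
Proof.
have nE (z : R[i]) : Normc.normc z = Num.sqrt (complex.Re z ^+ 2 + complex.Im z ^+ 2) by case: z.
move=> [u1 u2]; rewrite nE; under eq_fun do rewrite nE.
have h : complex.Re (u n) ^+ 2 + complex.Im (u n) ^+ 2 @[n --> \oo] -->
    complex.Re a ^+ 2 + complex.Im a ^+ 2 by apply: cvgD; apply: cvgM.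
by apply: (cvg_comp _ _ h); exact: sqrt_continuous.
Qed.

End complex_limits.

Section oscillation_measurable.
Context {R : realType}.
Notation mu := (@lebesgue_measure R).
Variables (D : set R) (F w w1 : R -> R) (D1 : R).
Let G := warp_inv D F.
Hypothesis hW : warp_data D F G w w1 D1.
Variables (L : R -> R) (C1 : R) (q : nat).
Hypothesis hL : gauge L.
Hypothesis hwL : forall s t, w (s + t) <= C1 * L s ^+ q * w t.
Variables (M : R) (theta : R -> R[i]).
Let N := (q.*2.+2 + q.+2 + q.*2.+1)%N.
Hypotheses (htr : decays L N M (fun t => complex.Re (theta t)))
  (hti : decays L N M (fun t => complex.Im (theta t))).
Local Notation cmod := (modulated D F theta).
Local Notation entry := (osc_entry D F theta).
Local Notation amp := (warp_amp w).

Let retheta_continuous : continuous (fun t => complex.Re (theta t)).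
Proof. by have [? [? [? [d _ _ _]]]] := htr; move=> t; apply: is_derive_continuous; exact: d. Qed.

Let imtheta_continuous : continuous (fun t => complex.Im (theta t)).
Proof. by have [? [? [? [d _ _ _]]]] := hti; move=> t; apply: is_derive_continuous; exact: d. Qed.

Lemma warp_amp_continuous : continuous amp.
Proof.
move=> u; apply: (@continuous_comp _ _ _ (fun u => (w u)^-1) Num.sqrt); last exact: sqrt_continuous.
apply: cvgV; first by rewrite gt_eqF // (wd_w_gt0 hW).
exact: (warp_w_continuous hW).
Qed.

Lemma modulated_le x xi s : D x -> cnorm1 (cmod x xi s) <= 4 * M * amp (F x).
Proof.
move=> Dx; rewrite /modulated; apply: le_trans (cnorm1M _ _) _.
rewrite [leRHS](_ : _ = amp (F x) * (2 * M) * 2); last by ring.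
by apply: ler_pM; rewrite ?cnorm1_ge0 ?cnorm1_cis2pi // (proto_le hW hL htr hti).
Qed.

(** Dominated convergence on the frequency side, where the entry is an integral
    of windows that depend continuously on [c] and [eta]. *)
Lemma osc_entry_cvg x y xi om (c : R) (eta : R) (c_ eta_ : nat -> R) (delta : R) : D x -> D y ->
  c_ n @[n --> \oo] --> c -> eta_ n @[n --> \oo] --> eta -> (forall n, `|c - c_ n| <= delta) ->
  Normc.normc (entry x y xi om (G (c_ n)) (eta_ n)) @[n --> \oo] -->
  Normc.normc (entry x y xi om (G c) eta).
Proof.
move=> Dx Dy cc ec cd; apply: ccvg_normc.
have GD := wd_GD hW.
have M0 := decays_ge0 hL htr.
have a0 u := ltW (warp_amp_gt0 hW u).
have E0 : 0 <= C1 * L delta ^+ q by exact: le_trans ler01 (wL_factor_ge1 hW hL hwL delta).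
pose f_ n s := cmod x xi s * (cmod y om s - phase y (G (c_ n)) om (eta_ n) * cmod (G (c_ n)) (eta_ n) s)^*%C.
pose f s := cmod x xi s * (cmod y om s - phase y (G c) om eta * cmod (G c) eta s)^*%C.
have e_ n : entry x y xi om (G (c_ n)) (eta_ n) = Cintegral (f_ n) by exact: (osc_entryE hW hL hwL htr hti).
have e : entry x y xi om (G c) eta = Cintegral f by exact: (osc_entryE hW hL hwL htr hti).
rewrite e; under eq_fun do rewrite e_.
pose K := 4 * M * amp (F y) + 2 * (4 * M * (C1 * L delta ^+ q * amp c)).
have hN' : (q.+2 <= N)%N := window_order_ge q.
have imx := modulated_integrable hW hL hwL hN' htr hti xi Dx.
have imeas z zeta : D z -> cmeasurable (cmod z zeta).
  by move=> Dz; apply: cintegrable_measurable; exact: (modulated_integrable hW hL hwL hN' htr hti).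
have f_K n s : cnorm1 (f_ n s) <= K * cnorm1 (cmod x xi s).
  apply: le_trans (cnorm1M _ _) _; rewrite mulrC ler_wpM2r ?cnorm1_ge0 // cnorm1_conj.
  apply: le_trans (cnorm1D _ _) _; rewrite cnorm1N; apply: lerD; first exact: modulated_le.
  apply: le_trans (cnorm1M _ _) _; apply: ler_pM; rewrite ?cnorm1_ge0 ?cnorm1_cis2pi //.
  apply: le_trans (modulated_le _ _ (GD _)) _; rewrite (wd_FG hW).
  by rewrite ler_wpM2l ?mulr_ge0 // (warp_amp_le hW hL hwL).
have f_m n : cmeasurable (f_ n).
  apply: cmeasurableM; first exact: imeas.
  apply: cmeasurable_conj; apply: cmeasurableB; first exact: imeas.
  by apply: cmeasurableM; [split; exact: measurable_cst | exact: imeas].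
have f_f s : ccvg (f_ ^~ s) (f s).
  apply: ccvgM; first exact: ccvg_cst.
  apply: ccvg_conj; apply: ccvgB; first exact: ccvg_cst.
  apply: ccvgM.
    by apply: ccvg_cis; apply: cvgMl; apply: cvgB => //; exact: cvg_cst.
  have [Ds|Ds] := pselect (D s); last first.
    rewrite /modulated; under eq_fun do rewrite proto_off //.
    by rewrite proto_off //; under eq_fun do rewrite mul0r; rewrite mul0r; exact: ccvg_cst.
  have -> : (fun n => cmod (G (c_ n)) (eta_ n) s) = (fun n => ((amp (c_ n))%:C%C * theta (F s - c_ n)) * cis2pi (- (eta_ n * s))).
    by apply/funext => n; rewrite /modulated (proto_on hW) // (wd_FG hW).
  rewrite /modulated (proto_on hW) // (wd_FG hW).
  apply: ccvgM; first apply: ccvgM.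
  - have h : amp (c_ n) @[n --> \oo] --> amp c.
      by apply: (@cvg_comp _ _ _ c_ amp _ (nbhs c)) => //; exact: warp_amp_continuous.
    exact: ccvg_real.
  - have h : F s - c_ n @[n --> \oo] --> F s - c by apply: cvgB => //; exact: cvg_cst.
    split.
      apply: (@cvg_comp _ _ _ (fun n => F s - c_ n) (fun t => complex.Re (theta t)) _ (nbhs (F s - c))) => //.
      exact: retheta_continuous.
    apply: (@cvg_comp _ _ _ (fun n => F s - c_ n) (fun t => complex.Im (theta t)) _ (nbhs (F s - c))) => //.
    exact: imtheta_continuous.
  - by apply: ccvg_cis; apply: cvgN; apply: cvgMl.
have iK : mu.-integrable setT (EFin \o (fun s => K * cnorm1 (cmod x xi s))).
  by apply: integrable_scale => //; exact: cintegrable_cnorm1.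
split.
  apply: (@Rdominated_convergence _ _ _ mu setT measurableT (fun n s => complex.Re (f_ n s))
    (fun s => complex.Re (f s)) (fun s => K * cnorm1 (cmod x xi s))) => //.
  - by move=> n; have [] := f_m n.
  - by move=> s _; have [] := f_f s.
  - by move=> n s _; apply: le_trans (f_K n s); exact: cre_le.
apply: (@Rdominated_convergence _ _ _ mu setT measurableT (fun n s => complex.Im (f_ n s))
  (fun s => complex.Im (f s)) (fun s => K * cnorm1 (cmod x xi s))) => //.
- by move=> n; have [] := f_m n.
- by move=> s _; have [] := f_f s.
- by move=> n s _; apply: le_trans (f_K n s); exact: cim_le.
Qed.

(** * Measurability of the oscillation *)

Let theta_measurable : cmeasurable theta.
Proof.
split; apply: continuous_measurable_fun.
  exact: retheta_continuous.
exact: imtheta_continuous.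
Qed.

Let amp_measurable : measurable_fun setT amp.
Proof. by apply: continuous_measurable_fun; exact: warp_amp_continuous. Qed.

(** [F] is unspecified off [D]; a globally measurable version is needed to apply
    Tonelli's theorem with the base point as a parameter. *)
Let F0 : R -> R := F \_ D.

Let F0_measurable : measurable_fun setT F0.
Proof.
have mF : measurable_fun D F.
  by apply: (warp_continuous_measurable hW) => s; exact: (warp_F_continuous hW).
exact: (measurable_restrictT _ (warp_measurable hW)).1 mF.
Qed.

Let F0E s : D s -> F0 s = F s.
Proof. by move=> Ds; rewrite /F0 /patch mem_set. Qed.

(* the window with [F0] for [F], jointly measurable in all its arguments *)
Let tmod x xi s : R[i] :=
  (\1_D s * amp (F0 x))%:C%C * theta (F0 s - F0 x) * cis2pi (- (xi * s)).

Let tmodE x xi s : D x -> cmod x xi s = tmod x xi s.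
Proof.
move=> Dx; rewrite /modulated /tmod; congr (_ * _).
have [Ds|Ds] := pselect (D s).
  by rewrite (proto_on hW) // !F0E // indicE mem_set // mul1r.
by rewrite proto_off // indicE memNset // mul0r mul0r.
Qed.

Let tmod_measurable d (T : measurableType d) (X Xi S : T -> R) :
  measurable_fun setT X -> measurable_fun setT Xi -> measurable_fun setT S ->
  cmeasurable (fun p => tmod (X p) (Xi p) (S p)).
Proof.
move=> mX mXi mS.
have mFX : measurable_fun setT (fun p => F0 (X p)) := measurableT_comp F0_measurable mX.
have mFS : measurable_fun setT (fun p => F0 (S p)) := measurableT_comp F0_measurable mS.
apply: cmeasurableM; first apply: cmeasurableM.
- split; last exact: measurable_cst.
  apply: measurable_funM.
    apply: (@measurableT_comp _ _ _ _ _ _ (\1_D : R -> R) _ S) => //.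
    by apply: measurable_indic; exact: (warp_measurable hW).
  exact: (measurableT_comp amp_measurable mFX).
- apply: (@cmeasurable_comp _ _ _ _ _ theta (fun p => F0 (S p) - F0 (X p))) => //.
  exact: measurable_funB.
- by apply: cmeasurable_cis; apply: measurable_funN; exact: measurable_funM.
Qed.

Let quad := ((R * R) * (R * R))%type.

Let tentry z eta (p : quad) : R[i] := Cintegral (fun s =>
  tmod p.1.1 p.1.2 s * (tmod p.2.1 p.2.2 s - phase p.2.1 z p.2.2 eta * tmod z eta s)^*%C).

Let tentryE z eta (p : quad) : D z -> D p.1.1 -> D p.2.1 ->
  entry p.1.1 p.2.1 p.1.2 p.2.2 z eta = tentry z eta p.
Proof.
move=> Dz D1' D2'; rewrite (osc_entryE hW hL hwL htr hti) //.
by apply: eq_Cintegral => s; rewrite !tmodE.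
Qed.

Let tentry_measurable z eta : measurable_fun setT (fun p : quad => Normc.normc (tentry z eta p)).
Proof.
have nE (c : R[i]) : Normc.normc c = Num.sqrt (complex.Re c ^+ 2 + complex.Im c ^+ 2) by case: c.
have [g1 g2] : cmeasurable (fun ps : quad * R =>
   tmod ps.1.1.1 ps.1.1.2 ps.2 *
   (tmod ps.1.2.1 ps.1.2.2 ps.2 - phase ps.1.2.1 z ps.1.2.2 eta * tmod z eta ps.2)^*%C).
  have m1 : measurable_fun setT (fun ps : quad * R => ps.1) := measurable_fst.
  have m2 : measurable_fun setT (fun ps : quad * R => ps.2) := measurable_snd.
  have m11 : measurable_fun setT (fun ps : quad * R => ps.1.1) := measurableT_comp measurable_fst m1.
  have m12 : measurable_fun setT (fun ps : quad * R => ps.1.2) := measurableT_comp measurable_snd m1.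
  have m111 : measurable_fun setT (fun ps : quad * R => ps.1.1.1) := measurableT_comp measurable_fst m11.
  have m112 : measurable_fun setT (fun ps : quad * R => ps.1.1.2) := measurableT_comp measurable_snd m11.
  have m121 : measurable_fun setT (fun ps : quad * R => ps.1.2.1) := measurableT_comp measurable_fst m12.
  have m122 : measurable_fun setT (fun ps : quad * R => ps.1.2.2) := measurableT_comp measurable_snd m12.
  apply: cmeasurableM; first exact: tmod_measurable.
  apply: cmeasurable_conj; apply: cmeasurableB; first exact: tmod_measurable.
  apply: cmeasurableM; last by apply: tmod_measurable => //; exact: measurable_cst.
  by apply: cmeasurable_cis; apply: measurable_funM => //; apply: measurable_funB.
have h1 := @measurable_Rintegral_param _ _ _ _ _ mu _ g1.
have h2 := @measurable_Rintegral_param _ _ _ _ _ mu _ g2.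
under eq_fun do rewrite nE.
apply: (@measurableT_comp _ _ _ _ _ _ (Num.sqrt : R -> R)).
  by apply: continuous_measurable_fun; exact: sqrt_continuous.
by apply: measurable_funD; apply: measurable_funX.
Qed.

Variable delta : R.
Hypothesis d0 : 0 < delta.

(* Grid points at the fractions [i / r.+1], [j / r.+1] of a cell, end points
   included: all of them lie in the cell, and they are dense in it. *)
Let gridz (l : int) (i r : nat) : R := G (delta * l%:~R + delta * (i%:R / r.+1%:R)).
Let grideta (l k : int) (j r : nat) : R :=
  delta ^+ 2 * (k%:~R + j%:R / r.+1%:R) / warp_itv_length D F delta l.

Let grid := (int * int * nat * nat * nat)%type.

Let grid_value (g : grid) (p : quad) : R :=
  let: (l, k, i, j, r) := g in
  if (i <= r.+1)%N && (j <= r.+1)%N then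
    \1_(warp_cover D F delta l k) p.2 * Normc.normc (tentry (gridz l i r) (grideta l k j r) p)
  else 0.

Let grid_value_o (o : option grid) (p : quad) : R :=
  if o is Some g then grid_value g p else 0.

Let grid_value_n (n : nat) : quad -> R := grid_value_o (unpickle n).

Let cover_measurable l k : measurable (warp_cover D F delta l k).
Proof. by apply: measurableX; exact: measurable_itv. Qed.

Let grid_value_measurable n : measurable_fun setT (grid_value_n n).
Proof.
suff H (o : option grid) : measurable_fun setT (grid_value_o o) by exact: H.
case: o => [[[[[l k] i] j] r]|]; last exact: measurable_cst.
rewrite /grid_value_o /grid_value; case: ((i <= r.+1)%N && (j <= r.+1)%N); last exact: measurable_cst.
apply: measurable_funM; last exact: tentry_measurable.
apply: (@measurableT_comp _ _ _ _ _ _ (\1_(warp_cover D F delta l k) : R * R -> R) _ snd) => //.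
Qed.

Let frac_itv (i r : nat) : (i <= r.+1)%N -> 0 <= (i%:R / r.+1%:R : R) <= 1.
Proof.
move=> ir; rewrite divr_ge0 //= ler_pdivrMr ?ltr0Sn // mul1r ler_nat //.
Qed.

Let grid_in_cover l k i j r : (i <= r.+1)%N -> (j <= r.+1)%N ->
  warp_cover D F delta l k (gridz l i r, grideta l k j r).
Proof.
move=> /frac_itv/andP[i0 i1] /frac_itv/andP[j0 j1].
have len0 := warp_itv_length_gt0 hW l d0; have d2 : 0 < delta ^+ 2 by rewrite exprn_gt0.
split; rewrite /= ?/warp_itv /= in_itv /=.
  rewrite /gridz -/G !(@warp_G_le _ _ _ _ _ _ _ hW) intrD mulrDr mulr1 lerDl mulr_ge0 ?(ltW d0) //=.
  by rewrite lerD2l -[leRHS]mulr1 ler_pM2l.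
rewrite /grideta !ler_pM2r ?invr_gt0 // !ler_pM2l // intrD lerDl j0 /=.
by rewrite lerD2l.
Qed.

Let approx (t : R) (r : nat) : nat := Num.truncn (t * r.+1%:R).

Let approx_le t r : 0 <= t <= 1 -> (approx t r <= r.+1)%N.
Proof.
move=> /andP[t0 t1]; rewrite -(ler_nat R).
have := truncn_le (t * r.+1%:R); rewrite mulr_ge0 // => h.
by apply: le_trans h _; rewrite ler_piMl.
Qed.

Let approx_cvg t : 0 <= t <= 1 -> (approx t r)%:R / r.+1%:R @[r --> \oo] --> t.
Proof.
move=> /andP[t0 t1].
apply: (@squeeze_cvgr _ _ _ _ (fun r => t - harmonic r) (fun=> t)); last 2 first.
- rewrite -[X in _ --> X]subr0; apply: cvgB; first exact: cvg_cst.
  exact: cvg_harmonic.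
- exact: cvg_cst.
apply: nearW => r; have r0 : (0 : R) < r.+1%:R by rewrite ltr0Sn.
have /andP[h1 h2] := truncn_itv (mulr_ge0 t0 (ltW r0)).
rewrite ler_pdivlMr // ler_pdivrMr // h1 andbT mulrBl /harmonic /= mulVf ?gt_eqF //.
by rewrite lerBlDr natr1; exact: ltW.
Qed.

Let osc_set (p : quad) : set (\bar R) :=
  [set (Normc.normc (entry p.1.1 p.2.1 p.1.2 p.2.2 qq.1 qq.2))%:E | qq in cover_nbhd D F delta p.2.1 p.2.2].

(* Cells that do not contain [(y, om)] contribute the value [0], which is
   harmless as the supremum is nonnegative. *)
Let osc_setE (p : quad) : D p.1.1 -> D p.2.1 ->
  ereal_sup (osc_set p) = ereal_sup (range (fun n => (grid_value_n n p)%:E)).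
Proof.
case: p => -[x xi] [y om] /= Dx Dy.
have GD := wd_GD hW.
have nb := cover_nbhd_refl hW om d0 Dy.
apply/eqP; rewrite eq_le; apply/andP; split.
- apply: ge_ereal_sup => _ [[z eta] [l [k [hy hz]]] <-].
  rewrite -[leLHS]/((Normc.normc (entry x y xi om z eta))%:E).
  have [Dz /andP[z1 z2]] := warp_itvP hW d0 hz.1.
  have len0 := warp_itv_length_gt0 hW l d0; have d2 : 0 < delta ^+ 2 by rewrite exprn_gt0.
  pose t1 := (F z - delta * l%:~R) / delta.
  pose t2 := eta * warp_itv_length D F delta l / delta ^+ 2 - k%:~R.
  have t1_01 : 0 <= t1 <= 1.
    rewrite divr_ge0 ?(ltW d0) ?subr_ge0 //= ler_pdivrMr // mul1r.
    by rewrite lerBlDl.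
  have t2_01 : 0 <= t2 <= 1.
    have := hz.2; rewrite /= in_itv /= ler_pdivrMr // ler_pdivlMr // intrD => /andP[e1 e2].
    rewrite subr_ge0 ler_pdivlMr // mulrC e1 /= lerBlDl ler_pdivrMr //.
    by rewrite [leRHS]mulrC.
  have zE : G (delta * l%:~R + delta * t1) = z.
    by rewrite -[RHS](wd_GF hW Dz) /t1; congr G; field; rewrite gt_eqF.
  have etaE : delta ^+ 2 * (k%:~R + t2) / warp_itv_length D F delta l = eta.
    by rewrite /t2; field; rewrite !gt_eqF.
  pose v r := Normc.normc (entry x y xi om (gridz l (approx t1 r) r) (grideta l k (approx t2 r) r)).
  have vcvg : v r @[r --> \oo] --> Normc.normc (entry x y xi om z eta).
    rewrite -zE -etaE.
    apply: (@osc_entry_cvg x y xi om _ _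
      (fun r => delta * l%:~R + delta * ((approx t1 r)%:R / r.+1%:R))
      (fun r => delta ^+ 2 * (k%:~R + (approx t2 r)%:R / r.+1%:R) / warp_itv_length D F delta l) delta) => //.
    + by apply: cvgD; [exact: cvg_cst | apply: cvgMr; exact: approx_cvg].
    + apply: cvgMl; apply: cvgMr; apply: cvgD; first exact: cvg_cst.
      exact: approx_cvg.
    + move=> r; have /andP[a1 a2] := frac_itv (approx_le r t1_01).
      rewrite (_ : _ - _ = delta * (t1 - (approx t1 r)%:R / r.+1%:R)); last by ring.
      rewrite normrM (gtr0_norm d0) -[leRHS]mulr1 ler_pM2l // ler_norml.
      move: t1_01 a1 a2 => /andP[b1 b2]; move: ((approx t1 r)%:R / r.+1%:R) => a a1 a2.
      by apply/andP; split; lra.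
  have v_le r : ((v r)%:E <= ereal_sup (range (fun n => (grid_value_n n (x, xi, (y, om)))%:E)))%E.
    apply: ereal_sup_ubound; exists (pickle ((l, k, approx t1 r, approx t2 r, r) : grid)) => //.
    rewrite /grid_value_n pickleK /grid_value_o /grid_value (approx_le r t1_01) (approx_le r t2_01).
    rewrite indicE mem_set // mul1r.
    have te := @tentryE (gridz l (approx t1 r) r) (grideta l k (approx t2 r) r) (x, xi, (y, om)) (GD _) Dx Dy.
    by rewrite -te.
  have vE : (v r)%:E @[r --> \oo] --> (Normc.normc (entry x y xi om z eta))%:E.
    by apply: cvg_EFin => //; exact: nearW.
  rewrite -(cvg_lim _ vE) //; apply: lime_le; first by apply/cvg_ex; eexists; exact: vE.
  exact: nearW.
- have sup0 : (0 <= ereal_sup (osc_set (x, xi, (y, om))))%E.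
    apply: ereal_sup_ge; exists (Normc.normc (entry x y xi om y om))%:E.
      by exists (y, om).
    by rewrite lee_fin normc_ge0.
  suff H (o : option grid) : ((grid_value_o o (x, xi, (y, om)))%:E <= ereal_sup (osc_set (x, xi, (y, om))))%E.
    by apply: ge_ereal_sup => _ [n _ <-]; exact: H.
  case: o => [[[[[l k] i] j] r]|] //.
  rewrite /grid_value_o /grid_value; case: ifP => // /andP[hi hj].
  rewrite indicE; have [hy|hy] := pselect (warp_cover D F delta l k (y, om)); last first.
    by rewrite memNset // mul0r.
  rewrite mem_set // mul1r; apply: ereal_sup_ubound.
  exists (gridz l i r, grideta l k j r); last first.
    by rewrite -(@tentryE (gridz l i r) (grideta l k j r) (x, xi, (y, om)) (GD _) Dx Dy).
  by exists l, k; split => //; exact: grid_in_cover.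
Qed.

Lemma oscillation_measurable :
  measurable_fun ((D `*` setT) `*` (D `*` setT))
    (fun pq : quad => oscillation D F delta phase theta pq.1.1 pq.2.1 pq.1.2 pq.2.2).
Proof.
have mD := warp_measurable hW.
have mh : measurable_fun setT (fun p : quad => ((L2norm_sq theta)^-1%:E *
    ereal_sup (range (fun n => (grid_value_n n p)%:E)))%E).
  apply: measurable_funeM.
  rewrite (_ : (fun p => _) = (fun p : quad => esups (fun n => (grid_value_n n p)%:E) 0%N)).
    apply: (@measurable_fun_esups _ _ _ setT (fun n (p : quad) => (grid_value_n n p)%:E)) => n.
    by apply/measurable_EFinP; exact: grid_value_measurable.
  apply/funext => p; rewrite /esups /sdrop /=; congr ereal_sup.
  by apply/seteqP; split => [_ [n _ <-]|_ [n _ <-]]; exists n.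
apply: eq_measurable_fun (measurable_funTS mh).
move=> p /set_mem[[/= Dx _] [/= Dy _]].
by rewrite /oscillation -osc_setE.
Qed.

End oscillation_measurable.

(** * Growth of submultiplicative weights *)

Section submultiplicative_growth.
Context {R : realType}.
Notation mu := (@lebesgue_measure R).

Lemma lebesgue_measure_reflect (x : R) (A : set R) : measurable A ->
  mu ((fun t => x - t) @^-1` A) = mu A.
Proof.
move=> mA.
have mphi : measurable_fun setT ((fun t : R => x - t) : measurableTypeR R -> measurableTypeR R).
  by apply: measurable_funB.
have := @lebesgue_measure_unique R (pushforward mu ((fun t => x - t) : measurableTypeR R -> measurableTypeR R)).
move=> h; symmetry; apply: (h mphi) => // _ [[a b]] _ <-.
have E : (fun t : R => x - t) @^-1` `]a, b]%classic = `[x - b, x - a[%classic.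
  by apply/seteqP; split => t /=; rewrite !in_itv /= => /andP[h1 h2]; apply/andP; split; lra.
transitivity (mu `[x - b, x - a[%classic); last by rewrite -E.
rewrite !lebesgue_measure_itv /= !lte_fin ltrD2l ltrN2.
by case: ifP => // _; rewrite -!EFinB; congr (_%:E); ring.
Qed.

(** An argument in the manner of Steinhaus: if [v x > n ^ 2] then every [t] has
    [v t >= n] or [v (x - t) >= n], so the set where [v >= n] keeps a fixed mass;
    yet these sets decrease to the empty set. *)
Lemma submultiplicative_locally_bounded (v : R -> R) (A : R) :
  submultiplicative v -> 0 < A -> exists K : R, forall x, `|x| <= A -> v x <= K.
Proof.
move=> [[mv v0'] vM] A0; have v0 x : 0 < v x by exact: v0'.
apply: contrapT => /forallNP hK.
have big (K : R) : exists x, `|x| <= A /\ K < v x.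
  have /existsNP[x /not_implyP[xA /negP]] := hK K.
  by rewrite -ltNge => h; exists x.
pose S (n : nat) : set R := [set t | `|t| <= 2 * A] `&` [set t | n%:R <= v t].
have ballE (B : R) : [set t : R | `|t| <= B] = `[- B, B]%classic.
  by apply/seteqP; split => t /=; rewrite in_itv /= ler_norml.
have mS n : measurable (S n).
  apply: measurableI; first by rewrite ballE; exact: measurable_itv.
  rewrite (_ : [set t | _] = v @^-1` `[n%:R, +oo[%classic); last first.
    by apply/seteqP; split => t /=; rewrite in_itv /= andbT.
  by rewrite -[X in measurable X]setTI; apply: mv => //; exact: measurable_itv.
have muB (B : R) : 0 < B -> mu [set t : R | `|t| <= B] = (2 * B)%:E.
  move=> B0; rewrite ballE lebesgue_measure_itv /= lte_fin ifT; last by lra.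
  by rewrite -EFinB; congr (_%:E); ring.
have Sbig n : (A%:E <= mu (S n))%E.
  have [x [xA vx]] := big (n%:R * n%:R).
  have cover : [set t | `|t| <= A] `<=` S n `|` (fun t => x - t) @^-1` S n.
    move=> t /= tA; have [nt|tn] := leP n%:R (v t).
      by left; split => //=; rewrite (le_trans tA) //; lra.
    right; split => /=.
      by apply: le_trans (ler_normB _ _) _; lra.
    rewrite leNgt; apply/negP => xtn.
    have := vM t (x - t); rewrite addrC subrK leNgt => /negP; apply.
    apply: le_lt_trans vx; apply: ler_pM.
    - exact: ltW (v0 _).
    - exact: ltW (v0 _).
    - exact: ltW.
    - exact: ltW.
  have mR : measurable ((fun t => x - t) @^-1` S n).
    rewrite -[X in measurable X]setTI.
    have mphi : measurable_fun setT ((fun t : R => x - t) : measurableTypeR R -> measurableTypeR R).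
      by apply: measurable_funB.
    exact: (mphi measurableT _ (mS n)).
  have : (mu [set t : R | (`|t| <= A)%R] <= mu (S n) + mu ((fun t => (x - t)%R) @^-1` S n))%E.
    apply: le_trans (measureU2 mu (mS n) mR).
    apply: le_measure; rewrite ?inE //; last exact: (measurableU _ _ (mS n) mR).
    by rewrite ballE; exact: measurable_itv.
  rewrite lebesgue_measure_reflect // muB //.
  case: (mu (S n)) => [r| |]; rewrite ?leey // -?EFinD ?lee_fin; lra.
have S0 : \bigcap_n S n = set0.
  apply/seteqP; split => t //= h.
  have [_ /=] := h (Num.truncn (v t)).+1 I.
  by rewrite leNgt truncnS_gt.
have := @nonincreasing_cvg_mu _ _ _ mu S; rewrite S0 measure0.
have -> : (mu (S 0%N) < +oo)%E.
  apply: (@le_lt_trans _ _ (mu [set t : R | (`|t| <= 2 * A)%R])).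
    apply: le_measure; last by move=> t [].
      by rewrite inE; exact: mS.
    by rewrite inE ballE; exact: measurable_itv.
  by rewrite muB ?ltry // mulr_gt0.
move=> /(_ erefl mS measurable0) h.
have {h} : mu \o S @ \oo --> 0%E.
  apply: h => m n mn; apply/subsetPset => t [t1 t2]; split => //=.
  by apply: le_trans t2; rewrite ler_nat.
move=> /cvg_lim => /(_ (@ereal_hausdorff R)) h.
have : (A%:E <= limn (mu \o S))%E.
  apply: lime_ge; last by apply: nearW => n; exact: Sbig.
  apply: ereal_nonincreasing_is_cvgn => m n mn.
  apply: le_measure; [by rewrite inE; exact: mS | by rewrite inE; exact: mS |].
  by move=> t [t1 t2]; split => //=; apply: le_trans t2; rewrite ler_nat.
by rewrite h lee_fin leNgt A0.
Qed.

(** With [v <= K] on the unit ball, [t] is a sum of at most [|t| + 1] equal steps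
    in that ball, whence [v t <= K ^ (|t| + 1)]. *)
Lemma submultiplicative_exp (v : R -> R) : submultiplicative v ->
  exists K q, [/\ 0 < K & forall t, v t <= K * expR `|t| ^+ q].
Proof.
move=> hv; have [[_ v0'] vM] := hv; have v0 x : 0 < v x by exact: v0'.
have [K0 hK0] := submultiplicative_locally_bounded hv ltr01.
pose K := Num.max K0 1; have K1 : 1 <= K by rewrite le_max lexx orbT.
have K_gt0 : 0 < K by exact: lt_le_trans K1.
have hK x : `|x| <= 1 -> v x <= K by move=> /hK0 h; rewrite le_max h.
exists K, (Num.truncn (ln K)).+1; split => // t.
have pow (n : nat) s : v (n.+1%:R * s) <= v s ^+ n.+1.
  elim: n => [|n ih]; first by rewrite mul1r expr1.
  rewrite -natr1 mulrDl mul1r exprSr; apply: le_trans (vM _ _) _.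
  by rewrite ler_wpM2r // ltW.
pose n := Num.truncn `|t|.
have n0 : 0 < n.+1%:R :> R by rewrite ltr0Sn.
have -> : t = n.+1%:R * (t / n.+1%:R) by field; rewrite gt_eqF.
apply: le_trans (pow _ _) _.
have tn : `|t / n.+1%:R| <= 1.
  by rewrite normrM normfV (gtr0_norm n0) ler_pdivrMr // mul1r ltW // truncnS_gt.
have e : n.+1%:R * (t / n.+1%:R) = t by field; rewrite gt_eqF.
rewrite e; apply: (@le_trans _ _ (K ^+ n.+1)).
  by apply: lerXn2r; rewrite ?nnegrE ?(ltW K_gt0) ?(ltW (v0 _)) // hK.
rewrite exprS ler_wpM2l ?(ltW K_gt0) // -[in leLHS](lnK K_gt0) -!expRM_natl ler_expR.
apply: (@le_trans _ _ (n%:R * (Num.truncn (ln K)).+1%:R)).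
  by rewrite ler_wpM2l // ltW // truncnS_gt.
rewrite mulrC ler_wpM2l //.
by have /andP[] := truncn_itv (normr_ge0 t).
Qed.

End submultiplicative_growth.

(** * The two gauges *)

Section gauges.
Context {R : realType}.

Lemma gauge_exp : gauge (fun t : R => expR `|t|).
Proof.
split=> [t|s t|s t st]; first exact: expR_ge1Dx.
  by rewrite -expRD ler_expR ler_normD.
by rewrite ler_expR.
Qed.

Lemma gauge_affine : gauge (fun t : R => 1 + `|t|).
Proof.
split=> [t|s t|s t st] //; last by rewrite lerD2l.
apply: (@le_trans _ _ (1 + (`|s| + `|t|))); first by rewrite lerD2l ler_normD.
by have := mulr_ge0 (normr_ge0 s) (normr_ge0 t); lra.
Qed.

(** [ln w] is Lipschitz with constant [D1]. *)
Lemma log_lipschitz_growth (w w1 : R -> R) (D1 : R) :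
  (forall u, 0 < w u) -> (forall u, is_derive u (1 : R) w (w1 u)) ->
  (forall u, `|w1 u| <= D1 * w u) ->
  forall s t, w (s + t) <= expR (D1 * `|s|) * w t.
Proof.
move=> w0 dw w1w s t.
have dln u : is_derive u (1 : R) (fun u => ln (w u)) (w1 u / w u).
  have h := @is_derive_compose _ (@ln R) w u _ _ (is_derive1_ln (w0 u)) (dw u).
  by apply: (is_derive_eq h); rewrite mulrC.
have := @le_derive_lipschitz _ (fun u => ln (w u)) (fun u => w1 u / w u) t (s + t) D1 dln.
rewrite addrK => h.
have {}h : `|ln (w (s + t)) - ln (w t)| <= D1 * `|s|.
  apply: h => z _; rewrite normrM normfV (gtr0_norm (w0 z)).
  by rewrite ler_pdivrMr.
rewrite -[leLHS]lnK ?posrE // -[X in _ * X]lnK ?posrE // -expRD ler_expR -lerBlDr.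
by apply: le_trans h; exact: ler_norm.
Qed.

Lemma exp_growth (w w1 : R -> R) (D1 : R) :
  (forall u, 0 < w u) -> (forall u, is_derive u (1 : R) w (w1 u)) ->
  (forall u, `|w1 u| <= D1 * w u) ->
  forall q, D1 <= q%:R -> forall s t, w (s + t) <= expR `|s| ^+ q * w t.
Proof.
move=> w0 dw w1w q D1q s t; apply: le_trans (log_lipschitz_growth w0 dw w1w s t) _.
rewrite ler_pM2r // -expRM_natl ler_expR ler_wpM2r //.
Qed.

(** The growth condition only concerns large [|t|]; the local bound handles the
    remaining interval. *)
Lemma bigO_infty_power (f : R -> R) (p : R) : 0 < p ->
  bigO_infty f (fun x => (1 + `|x|) `^ p) ->
  (forall A, 0 < A -> exists K, forall x, `|x| <= A -> f x <= K) ->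
  forall q, p <= q%:R -> exists2 K, 0 < K & forall t, f t <= K * (1 + `|t|) ^+ q.
Proof.
move=> p0 [C [B hB]] hf q pq.
have [K0 hK0] := hf (`|B| + 1) (ltr_wpDl (normr_ge0 _) ltr01).
pose K := `|C| + `|K0| + 1; have K_gt0 : 0 < K by rewrite /K ltr_wpDl ?addr_ge0.
exists K => // t.
have g1 : 1 <= 1 + `|t| by rewrite lerDl.
have gq : 1 <= (1 + `|t|) ^+ q by rewrite exprn_ege1.
have [tB|Bt] := leP `|t| (`|B| + 1).
  apply: le_trans (hK0 _ tB) _; apply: (@le_trans _ _ K).
    by apply: le_trans (ler_norm _) _; rewrite /K; have := normr_ge0 C; lra.
  by rewrite ler_peMr // ltW.
have Bt' : B <= `|t| by apply: le_trans (ltW Bt); apply: le_trans (ler_norm _) _; rewrite lerDl.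
apply: le_trans (ler_norm _) _; apply: le_trans (hB _ Bt') _.
rewrite ger0_norm ?powR_ge0 //; apply: (@le_trans _ _ (`|C| * (1 + `|t|) `^ p)).
  by rewrite ler_wpM2r ?powR_ge0 // ler_norm.
apply: ler_pM; rewrite ?powR_ge0 //.
  by rewrite /K; have := normr_ge0 K0; lra.
by rewrite -powR_mulrn ?(le_trans ler01 g1) // ler_powR.
Qed.

End gauges.

(** * Decay of test functions *)

Section test_functions.
Context {R : realType}.
Implicit Types f : R -> R.

Lemma smoothR_derive f n t : smoothR f -> is_derive t (1 : R) (f^`(n)) (f^`(n.+1) t).
Proof.
by move=> hf; rewrite derive1nS derive1E; apply: DeriveDef => //; exact: hf.
Qed.

Lemma smoothR_decays (L : R -> R) (N : nat) f : gauge L -> smoothR f ->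
  (forall n, exists M, forall t, `|f^`(n) t| <= M / L t ^+ N) ->
  exists2 M0, 0 <= M0 & forall M, M0 <= M -> decays L N M f.
Proof.
move=> hL hf hM.
have [M1 h1] := hM 0%N; have [M2 h2] := hM 1%N.
have [M3 h3] := hM 2%N; have [M4 h4] := hM 3%N.
exists (`|M1| + `|M2| + `|M3| + `|M4|); first by rewrite !addr_ge0.
move=> M MM; exists (f^`(1)), (f^`(2)), (f^`(3)); split.
- by move=> t; exact: (smoothR_derive 0).
- by move=> t; exact: (smoothR_derive 1).
- by move=> t; exact: (smoothR_derive 2).
have mono M' t : M' <= M -> M' / L t ^+ N <= M / L t ^+ N.
  by move=> h; rewrite ler_pM2r // invr_gt0 gauge_expr_gt0.
have := ler_norm M1; have := ler_norm M2; have := ler_norm M3; have := ler_norm M4.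
have := normr_ge0 M1; have := normr_ge0 M2; have := normr_ge0 M3; have := normr_ge0 M4.
move=> ? ? ? ? ? ? ? ? t; split.
- by apply: le_trans (h1 t) _; apply: mono; lra.
- by apply: le_trans (h2 t) _; apply: mono; lra.
- by apply: le_trans (h3 t) _; apply: mono; lra.
- by apply: le_trans (h4 t) _; apply: mono; lra.
Qed.

Lemma rapid_decayR_power f (N n : nat) : rapid_decayR f ->
  exists M, forall t, `|f^`(n) t| <= M / (1 + `|t|) ^+ N.
Proof.
move=> hf; have [M0 h0] := hf 0%N n; have [M1 h1] := hf N n.
exists (2 ^+ N * (M0 + M1)) => t.
have g0 : 0 < 1 + `|t| by rewrite ltr_wpDr.
rewrite ler_pdivlMr ?exprn_gt0 //.
have m0 := h0 t; have m1 := h1 t; rewrite expr0 mul1r in m0.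
have M0_ge0 := le_trans (normr_ge0 _) m0.
have M1_ge0 : 0 <= M1 by apply: le_trans m1; rewrite mulr_ge0 // exprn_ge0.
have [t1|t1] := leP `|t| 1.
  rewrite mulrC; apply: ler_pM; rewrite ?exprn_ge0 ?(ltW g0) //.
    by apply: lerXn2r; rewrite ?nnegrE ?(ltW g0) //; lra.
  by apply: le_trans m0 _; rewrite lerDl.
apply: (@le_trans _ _ (`|f^`(n) t| * (2 * `|t|) ^+ N)).
  rewrite ler_wpM2l //; apply: lerXn2r; rewrite ?nnegrE ?(ltW g0) ?mulr_ge0 //.
  by lra.
rewrite exprMn mulrCA ler_wpM2l ?exprn_ge0 // mulrC.
by apply: le_trans m1 _; rewrite lerDr.
Qed.

Lemma derive1n_vanish f (r : R) n : (forall t, r < `|t| -> f t = 0) ->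
  forall t, r < `|t| -> f^`(n) t = 0.
Proof.
elim: n => [//|n ih] f0 t rt.
rewrite derive1nS derive1E (@near_eq_derive _ _ _ _ (cst 0)) ?derive_cst //.
have h : {for t, continuous (fun s : R => `|s|)} by exact: norm_continuous.
have : \forall s \near t, r < `|s| by apply: (cvgr_gt _ h).
by apply: filterS => s rs; rewrite ih.
Qed.

(** A continuous function is bounded on the compact interval that carries it, and
    the gauge is bounded there as well. *)
Lemma compact_support_decay (L : R -> R) f (r : R) (N n : nat) : gauge L -> smoothR f ->
  0 < r -> (forall t, r < `|t| -> f t = 0) ->
  exists M, forall t, `|f^`(n) t| <= M / L t ^+ N.
Proof.
move=> hL hf r0 f0.
have cf : continuous (fun t => `|f^`(n) t|).
  move=> t; apply: (@continuous_comp _ _ _ (f^`(n)) (fun x : R => `|x|)); last exact: norm_continuous.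
  by apply: is_derive_continuous; exact: smoothR_derive.
have rr : - r <= r by rewrite ge0_cp // ltW.
have [c _ hc] := EVT_max rr (continuous_subspaceT cf).
exists (`|f^`(n) c| * L r ^+ N) => t.
rewrite -mulrA; have [tr|rt] := leP `|t| r; last first.
  rewrite (derive1n_vanish n f0 rt) normr0 mulr_ge0 // divr_ge0 // ltW //; exact: gauge_expr_gt0.
have h : `|f^`(n) t| <= `|f^`(n) c| by apply: hc; rewrite in_itv /= -ler_norml.
apply: le_trans h _; rewrite ler_peMr // ler_pdivlMr ?(gauge_expr_gt0 hL) // mul1r.
apply: lerXn2r; rewrite ?nnegrE ?(ltW (gauge_gt0 hL _)) //.
by apply: (gauge_mono hL); rewrite (gtr0_norm r0).
Qed.

Lemma schwartz_decays (theta : R -> R[i]) (N : nat) : schwartz theta ->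
  exists M, decays (fun t => 1 + `|t|) N M (fun t => complex.Re (theta t)) /\
            decays (fun t => 1 + `|t|) N M (fun t => complex.Im (theta t)).
Proof.
move=> [[s1 s2] r1 r2].
have [M1 M10 h1] := smoothR_decays gauge_affine s1 (fun n => rapid_decayR_power N n r1).
have [M2 M20 h2] := smoothR_decays gauge_affine s2 (fun n => rapid_decayR_power N n r2).
by exists (M1 + M2); split; [apply: h1; rewrite lerDl | apply: h2; rewrite lerDr].
Qed.

Lemma Cc_infty_decays (theta : R -> R[i]) (N : nat) : Cc_infty theta ->
  exists M, decays (fun t => expR `|t|) N M (fun t => complex.Re (theta t)) /\
            decays (fun t => expR `|t|) N M (fun t => complex.Im (theta t)).
Proof.
move=> [[s1 s2] /compact_bounded[B [_ hB]]].
pose r := `|B| + 1; have r0 : 0 < r by rewrite /r ltr_wpDl.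
have th0 t : r < `|t| -> theta t = 0.
  move=> rt; apply: contrapT => /eqP nz.
  have Br : B < r by rewrite /r (le_lt_trans (ler_norm _)) // ltrDl.
  have := hB r Br t; rewrite /= leNgt rt => h.
  by have := h (@subset_closure _ [set t | theta t != 0] t nz).
have [|M1 M10 h1] := @smoothR_decays (fun t => expR `|t|) N _ gauge_exp s1.
  move=> n; apply: compact_support_decay s1 r0 _ => //; first exact: gauge_exp.
  by move=> t rt; rewrite /comp th0.
have [|M2 M20 h2] := @smoothR_decays (fun t => expR `|t|) N _ gauge_exp s2.
  move=> n; apply: compact_support_decay s2 r0 _ => //; first exact: gauge_exp.
  by move=> t rt; rewrite /comp th0.
by exists (M1 + M2); split; [apply: h1; rewrite lerDl | apply: h2; rewrite lerDr].
Qed.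

End test_functions.

(** * The oscillation is small in the weighted norm *)

Section conclusion.
Context {R : realType}.
Variables (D : set R) (F w w1 : R -> R) (D1 : R).
Let G := warp_inv D F.
Hypothesis hW : warp_data D F G w w1 D1.
Variables (L : R -> R) (C1 : R) (q : nat).
Hypothesis hL : gauge L.
Hypothesis hwL : forall s t, w (s + t) <= C1 * L s ^+ q * w t.
Variables (m1 : R -> R) (Cm : R).
Hypothesis Cm0 : 0 <= Cm.
Hypothesis m1_gt0 : forall x, D x -> 0 < m1 x.
Hypothesis hm : forall x y, D x -> D y -> m1 x / m1 y <= Cm * L (F x - F y) ^+ q.
Notation m := (weight_kernel m1).

Lemma cover_sup_le delta Delta : 0 < delta <= Delta ->
  (cover_sup D F delta m <= (Cm * L Delta ^+ q)%:E)%E.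
Proof.
move=> /andP[d0 dD]; apply: ge_ereal_sup => _ [l [k [p [p' [[hp _] [hp' _] ->]]]]].
have [Dp /andP[p1 p2]] := warp_itvP hW d0 hp.
have [Dp' /andP[p3 p4]] := warp_itvP hW d0 hp'.
have /andP[_ mle] := weight_kernel_le hL m1_gt0 hm p.2 p'.2 Dp Dp'.
rewrite lee_fin; apply: le_trans mle _; rewrite ler_wpM2l //.
apply: lerXn2r; rewrite ?nnegrE ?(ltW (gauge_gt0 hL _)) //.
apply: (gauge_mono hL); apply: le_trans (ler_norm Delta); apply: le_trans dD.
by rewrite ler_norml; apply/andP; split; lra.
Qed.

Section window.
Variables (M : R) (theta : R -> R[i]).
Let N := (q.*2.+2 + q.+2 + q.*2.+1)%N.
Hypotheses (htr : decays L N M (fun t => complex.Re (theta t)))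
  (hti : decays L N M (fun t => complex.Im (theta t))).

Lemma oscillation_in_Am delta : 0 < delta -> in_Am D m (oscillation D F delta phase theta).
Proof.
move=> d0; split; first exact: (oscillation_measurable hW hL hwL htr hti d0).
have hd : 0 < delta <= delta by rewrite d0 lexx.
apply: le_lt_trans (oscillation_norm_le hW hL hwL htr hti m1_gt0 hm hd) _.
exact: ltry.
Qed.

(** [osc_const] is taken at the fixed scale [1], so the bound is linear in
    [delta <= 1]. *)
Lemma oscillation_small eps : 0 < eps ->
  exists delta, 0 < delta /\ (Am_norm D m (oscillation D F delta phase theta) < eps%:E)%E.
Proof.
move=> e0.
have h1 : 0 < (1 : R) <= 1 by rewrite ltr01 /=.
have K0 := osc_const_ge0 hW hL hwL htr hti m1_gt0 hm h1.
set K := osc_const _ _ _ _ _ _ _ _ in K0.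
pose c := K * pi ^+ 2.
have c0 : 0 <= c by rewrite mulr_ge0 // sqr_ge0.
pose delta := Num.min 1 (eps / (c + 1)).
have d0 : 0 < delta by rewrite lt_min ltr01 divr_gt0 // ltr_wpDl.
have hd : 0 < delta <= 1 by rewrite d0 ge_min lexx.
exists delta; split => //.
apply: le_lt_trans (oscillation_norm_le hW hL hwL htr hti m1_gt0 hm hd) _.
rewrite -/K -mulrA -/c lte_fin.
apply: (@le_lt_trans _ _ (eps / (c + 1) * c)).
  by rewrite ler_wpM2r // ge_min lexx orbT.
rewrite mulrAC ltr_pdivrMr ?ltr_wpDl // ltr_pM2l //.
by rewrite ltrDl.
Qed.

End window.
End conclusion.

Unset Implicit Arguments.

Theorem theorem6p1 (R : realType) (D : set R) (F : R -> R)
    (hD : D = setT \/ D = `]0, +oo[)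
    (hF : warping_function D F)
    (w_derivable : forall s, derivable (warp_weight D F) s 1)
    (w_C1 : continuous (derive1 (warp_weight D F)))
    (C D1 : R)
    (hC : forall x y, warp_weight D F (x + y) /
            (warp_weight D F x * warp_weight D F y) <= C)
    (hD1 : forall x, `|derive1 (warp_weight D F) x / warp_weight D F x| <= D1)
    (m1 v1 : R -> R)
    (hm1 : weight_on D m1)
    (hv1 : submultiplicative v1)
    (v1_sym : forall x, v1 (- x) = v1 x)
    (hm1v1 : moderate v1 (m1 \o warp_inv D F)) :
  let m := weight_kernel m1 in
  let osc delta theta := oscillation D F delta phase theta in
  let poly_growth := exists p : R, [/\ 0 < p,
      bigO_infty (warp_weight D F) (fun x => (1 + `|x|) `^ p) &
      bigO_infty v1 (fun x => (1 + `|x|) `^ p)] in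
  [/\ forall delta, 0 < delta -> (cover_sup D F delta m < +oo)%E,
      forall theta, Cc_infty theta -> nonzero_fun theta ->
        forall delta, 0 < delta -> in_Am D m (osc delta theta),
      poly_growth ->
        forall theta, schwartz theta -> nonzero_fun theta ->
        forall delta, 0 < delta -> in_Am D m (osc delta theta),
      exists delta0 C' : R, [/\ 0 < delta0, 0 < C' &
        forall delta, 0 < delta < delta0 ->
          exists Cm : R, (cover_sup D F delta m <= Cm%:E)%E /\ Cm < C'] &
      (forall theta, Cc_infty theta -> nonzero_fun theta ->
        forall eps, 0 < eps ->
        exists delta, 0 < delta /\ (Am_norm D m (osc delta theta) < eps%:E)%E)
      /\
      (poly_growth ->
        forall theta, schwartz theta -> nonzero_fun theta ->
        forall eps, 0 < eps ->
        exists delta, 0 < delta /\ (Am_norm D m (osc delta theta) < eps%:E)%E)].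
Proof.
move=> m osc poly_growth.
pose w := warp_weight D F.
have hW : warp_data D F (warp_inv D F) w (derive1 w) D1.
  exact: warping_function_data.
have w0 := wd_w_gt0 hW.
have m1_gt0 x : D x -> 0 < m1 x by case: hm1 => _; apply.
have [Cv hCv] := hm1v1.
(* moderateness compares the values of [m1] at two warped points *)
have hm (L : R -> R) (K : R) (q : nat) : (forall t, v1 t <= K * L t ^+ q) ->
    forall x y, D x -> D y -> m1 x / m1 y <= `|Cv| * K * L (F x - F y) ^+ q.
  move=> hK x y Dx Dy; rewrite ler_pdivrMr ?m1_gt0 //.
  have := hCv (F x - F y) (F y); rewrite /= subrK !(wd_GF hW) // => h.
  apply: le_trans h _; rewrite ler_pM2r ?m1_gt0 // -mulrA.
  have [[_ v0] _] := hv1.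
  apply: (@le_trans _ _ (`|Cv| * v1 (F x - F y))).
    by rewrite ler_wpM2r ?ler_norm // ltW // v0.
  by rewrite ler_wpM2l.
have [K [q1 [K0 hK]]] := submultiplicative_exp hv1.
pose q := maxn q1 (Num.truncn D1).+1.
pose L (t : R) := expR `|t|.
have hL : gauge L := gauge_exp.
have hwL s t : w (s + t) <= 1 * L s ^+ q * w t.
  rewrite mul1r; apply: (exp_growth w0 (wd_dw hW) (wd_w1_le hW)).
  apply: le_trans (ltW (truncnS_gt _)) _; by rewrite ler_nat leq_maxr.
have hvL t : v1 t <= K * L t ^+ q.
  apply: le_trans (hK t) _; rewrite ler_pM2l // ler_weXn2l ?leq_maxl //.
  exact: (gauge_ge1 hL).
have hmL := hm _ _ _ hvL.
have CK0 : 0 <= `|Cv| * K by rewrite mulr_ge0 // ltW.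
have cover_le := cover_sup_le hW hL CK0 m1_gt0 hmL.
(* here the bound [hC] turns polynomial growth of [w] into moderateness *)
have poly : poly_growth -> exists C1 K' q', [/\ forall s t, w (s + t) <= C1 * (1 + `|s|) ^+ q' * w t,
    0 < K' & forall t, v1 t <= K' * (1 + `|t|) ^+ q'].
  move=> [p [p0 wp vp]]; pose q' := (Num.truncn p).+1.
  have pq : p <= q'%:R by apply: ltW; exact: truncnS_gt.
  have [Kw Kw0 hKw] : exists2 Kw, 0 < Kw & forall t, w t <= Kw * (1 + `|t|) ^+ q'.
    apply: (bigO_infty_power p0 wp) pq => A A0; exists (expR (D1 * A) * w 0) => x xA.
    have := log_lipschitz_growth w0 (wd_dw hW) (wd_w1_le hW) x 0; rewrite addr0 => h.
    apply: le_trans h _; rewrite ler_pM2r // ler_expR ler_wpM2l //; exact: (D1_ge0 hW).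
  have [Kv Kv0 hKv] := bigO_infty_power p0 vp (fun A => @submultiplicative_locally_bounded _ _ A hv1) pq.
  exists (C * Kw), Kv, q'; split => // s t.
  have C0 : 0 < C by apply: lt_le_trans (hC 0 0); rewrite divr_gt0 ?mulr_gt0.
  have := hC s t; rewrite ler_pdivrMr ?mulr_gt0 // => h; apply: le_trans h _.
  by rewrite mulrA ler_pM2r // -mulrA ler_pM2l.
split.
- move=> delta d0; apply: le_lt_trans (ltry (`|Cv| * K * L delta ^+ q)).
  by apply: cover_le; rewrite d0 lexx.
- move=> theta hth _ delta d0.
  have [M [h1 h2]] := Cc_infty_decays (q.*2.+2 + q.+2 + q.*2.+1)%N hth.
  exact: (oscillation_in_Am hW hL hwL m1_gt0 hmL h1 h2 d0).
- move=> /poly[C1 [K' [q' [hw' K'0 hv']]]] theta hth _ delta d0.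
  have [M [h1 h2]] := schwartz_decays (q'.*2.+2 + q'.+2 + q'.*2.+1)%N hth.
  exact: (oscillation_in_Am hW gauge_affine hw' m1_gt0 (hm _ _ _ hv') h1 h2 d0).
- exists 1, (`|Cv| * K * L 1 ^+ q + 1).
  have L1 : 0 <= `|Cv| * K * L 1 ^+ q by rewrite mulr_ge0 // ltW // (gauge_expr_gt0 hL).
  split => //; first by rewrite ltr_wpDl.
  move=> delta /andP[d0 d1]; exists (`|Cv| * K * L 1 ^+ q); split; last by rewrite ltrDl.
  by apply: cover_le; rewrite d0 ltW.
- split.
    move=> theta hth _ eps e0.
    have [M [h1 h2]] := Cc_infty_decays (q.*2.+2 + q.+2 + q.*2.+1)%N hth.
    exact: (oscillation_small hW hL hwL m1_gt0 hmL h1 h2 e0).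
  move=> /poly[C1 [K' [q' [hw' K'0 hv']]]] theta hth _ eps e0.
  have [M [h1 h2]] := schwartz_decays (q'.*2.+2 + q'.+2 + q'.*2.+1)%N hth.
  exact: (oscillation_small hW gauge_affine hw' m1_gt0 (hm _ _ _ hv') h1 h2 e0).
Qed.
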